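(* Consider the linear regression model $X_k=\theta\phi_k+\varepsilon_k$, $1\le k\le n$, where $\theta\in\mathbf{R}$ is the unknown parameter, $(\phi_k)_{1\le k\le n}$ is a sequence of independent real random variables, $(\varepsilon_k)_{1\le k\le n}$ is a sequence of martingale differences with respect to its natural filtration $\mathcal{F}_k=\sigma\{\varepsilon_i,1\le i\le k\}$ satisfying $\mathbf{E}[\varepsilon_k^2|\mathcal{F}_{k-1}]=\sigma^2>0$ a.s. for all $k$ (with $\sigma>0$ a constant), and the sequences $(\phi_k)$ and $(\varepsilon_k)$ are independent of each other. Let $$\theta_n=\frac{\sum_{k=1}^n\phi_kX_k}{\sum_{k=1}^n\phi_k^2}$$ be the least squares estimator of $\theta$ (with $\sum_{k=1}^n\phi_k^2>0$ a.s.). Assume that there exist two positive numbers $\epsilon_1,\epsilon_2$ with $\epsilon:=\epsilon_1\epsilon_2/\sigma\le\frac12$ such that $$\frac{|\phi_k|}{\sqrt{\sum_{j=1}^n\phi_j^2}}\le\epsilon_1\quad\text{a.s. for all }1\le k\le n$$ and $$\big|\mathbf{E}[\varepsilon_k^l|\mathcal{F}_{k-1}]\big|\le\frac12\,l!\,\epsilon_2^{l-2}\sigma^2\quad\text{a.s. for all integers }l\ge2\text{ and all }1\le k\le n.$$ Then the following hold, where $C$ denotes an absolute constant (possibly with different values in different places). (i) For all $x\in\mathbf{R}$, $$\Big|\mathbf{P}\Big((\theta_n-\theta)\sqrt{\textstyle\sum_{k=1}^n\phi_k^2}\le x\sigma\Big)-\Phi(x)\Big|\le C\,(1+x^2)\,\epsilon|\log\epsilon|\exp\Big\{-\frac{\breve{x}^2}{2}\Big\},\qquad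 \breve{x}=\frac{2|x|}{1+\sqrt{1+2|x|\epsilon}}.$$ (ii) Moreover, the following Berry-Esseen bound holds: for all $x\in\mathbf{R}$, $$\Big|\mathbf{P}\Big((\theta_n-\theta)\sqrt{\textstyle\sum_{k=1}^n\phi_k^2}\le x\sigma\Big)-\Phi(x)\Big|\le C\,\epsilon|\log\epsilon|.$$ (iii) For all $0\le x=O(\epsilon^{-1/3})$ as $\epsilon\to0$, the following Cramér large deviation result holds: $$\frac{\mathbf{P}\Big((\theta_n-\theta)\sqrt{\sum_{k=1}^n\phi_k^2}\ge x\sigma\Big)}{1-\Phi(x)}=1+\vartheta\,C\,(1+x^3)\,\epsilon|\log\epsilon|,\qquad\text{where }|\vartheta|\le1.$$
   Context: $\Phi$ is the standard normal distribution function. $\mathcal{F}_0$ is the trivial $\sigma$-field, and martingale differences means $\mathbf{E}[\varepsilon_k|\mathcal{F}_{k-1}]=0$ a.s. ''Absolute constant'' means that $C$ depends on nothing (not on $n$, the laws of the variables, $\theta,\sigma,\epsilon_1,\epsilon_2$ or $x$). *)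

(* Defs.v *)
From HB Require Import structures.
From mathcomp Require Import all_boot all_order all_algebra.
From mathcomp Require Import all_classical all_reals all_analysis.
Set Implicit Arguments.
Unset Strict Implicit.
Unset Printing Implicit Defensive.
Import Order.TTheory GRing.Theory Num.Theory.
Import numFieldNormedType.Exports.
Local Open Scope classical_set_scope.
Local Open Scope ring_scope.

Section probability_notions.
Context d (T : measurableType d) (R : realType) (P : probability T R).

Definition independent_families n (G : 'I_n -> set (set T)) : Prop :=
  forall (J : {set 'I_n}) (A : 'I_n -> set T), (forall i, i \in J -> G i (A i)) ->
    (P (\big[setI/setT]_(i in J) A i) = \prod_(i in J) P (A i))%E.

Definition independent_RVs n (X : 'I_n -> {RV P >-> R}) : Prop :=
  independent_families (fun i => g_sigma_algebra_preimage (X i)).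

Definition independent_classes (G H : set (set T)) : Prop :=
  forall A B, G A -> H B -> (P (A `&` B) = P A * P B)%E.

Definition independent_sequences m n (X : 'I_m -> {RV P >-> R})
    (Y : 'I_n -> {RV P >-> R}) : Prop :=
  independent_classes (g_sigma_preimage (fun i => X i : T -> R))
                      (g_sigma_preimage (fun i => Y i : T -> R)).

(* Indices start at 0: [natural_filtration X k] is generated by the first k
   variables X_0, ..., X_(k-1); it is the trivial sigma-field for k = 0. *)
Definition natural_filtration n (X : 'I_n -> {RV P >-> R}) (k : nat) :
    set (set T) :=
  <<s \bigcup_(i in [set i : 'I_n | (i < k)%N]) g_sigma_algebra_preimage (X i) >>.

(* Y is a version of E[X | G]; "E[X | G] = c a.s." says that the constant
   function c is such a version. *)
Definition is_cond_exp (G : set (set T)) (X Y : T -> R) : Prop :=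
  [/\ P.-integrable setT (EFin \o X),
      P.-integrable setT (EFin \o Y),
      (forall B : set R, measurable B -> G (Y @^-1` B)) &
      forall A, G A ->
        (\int[P]_(w in A) (Y w)%:E = \int[P]_(w in A) (X w)%:E)%E].

(* As the index of the first variable is 0, the sigma-field of the past of
   X_k is [natural_filtration X k]. *)
Definition martingale_differences n (X : 'I_n -> {RV P >-> R}) : Prop :=
  forall k : 'I_n, is_cond_exp (natural_filtration X k) (X k) (cst 0).

End probability_notions.

Section regression.
Context d (T : measurableType d) (R : realType) (P : probability T R) (n : nat).
Variables (phi eps : 'I_n -> {RV P >-> R}) (theta : R).

Definition sum_sq (w : T) : R := \sum_(k < n) phi k w ^+ 2.

Definition observation (k : 'I_n) (w : T) : R := theta * phi k w + eps k w.

Definition least_squares (w : T) : R :=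
  (\sum_(k < n) phi k w * observation k w) / sum_sq w.

Definition normalized_error (w : T) : R :=
  (least_squares w - theta) * Num.sqrt (sum_sq w).

Record regression_model (sigma e1 e2 : R) : Prop := RegressionModel {
  sigma_gt0 : 0 < sigma ;
  e1_gt0 : 0 < e1 ;
  e2_gt0 : 0 < e2 ;
  epsilon_le_half : e1 * e2 / sigma <= 2^-1 ;
  regressors_independent : independent_RVs phi ;
  noise_martingale_differences : martingale_differences eps ;
  noise_cond_variance : forall k : 'I_n,
    is_cond_exp P (natural_filtration eps k) (fun w => eps k w ^+ 2)
      (cst (sigma ^+ 2)) ;
  regressors_noise_independent : independent_sequences phi eps ;
  sum_sq_gt0 : {ae P, forall w, 0 < sum_sq w} ;
  regressors_bound : forall k : 'I_n,
    {ae P, forall w, `|phi k w| / Num.sqrt (sum_sq w) <= e1} ;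
  noise_bernstein : forall (k : 'I_n) (l : nat), (2 <= l)%N ->
    exists2 Y : T -> R,
      is_cond_exp P (natural_filtration eps k) (fun w => eps k w ^+ l) Y &
      {ae P, forall w,
        `|Y w| <= 2^-1 * l`!%:R * e2 ^+ (l - 2) * sigma ^+ 2}
}.

End regression.

Definition std_normal_cdf (R : realType) (x : R) : R :=
  fine (normal_prob 0 1 `]-oo, x]).

Definition x_breve (R : realType) (e x : R) : R :=
  2 * `|x| / (1 + Num.sqrt (1 + 2 * `|x| * e)).

(* Main.v *)
(* Given the regressors, the normalized error divided by [sigma] is a sum
   [sum_k a_k eps_k / sigma] with a deterministic unit vector [a], i.e. the last
   term of a martingale [M_k] with deterministic conditional variances [a_k ^ 2]
   and conditional Bernstein moments of scale [e = e1 e2 / sigma].  For such a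
   martingale and a tilt [lam], the exponentially weighted density of [M_k]
   convolved with a Gaussian of the remaining variance is bounded uniformly in
   [k], by a Gronwall argument.  This controls each step of a Lindeberg
   telescoping sum comparing the tail of [M_n], smoothed at scale [e], with the
   Gaussian tail; the singularity of the kernel at the last steps costs the
   factor [|ln e|].  The optimal tilt turns the Chernoff factor into
   [exp (- x_breve ^ 2 / 2)].  In (iii), (i) suffices for [x ^ 3 e <= 1]; beyond
   that the ratio is only shown to be bounded, which is enough since the error
   term is then at least [|ln e|]. *)
Require Import Defs.
From HB Require Import structures.
From mathcomp Require Import all_boot all_order all_algebra.
From mathcomp Require Import all_classical all_reals all_analysis.
From mathcomp Require Import measurable_realfun ring lra.
Import Order.TTheory GRing.Theory Num.Theory.
Import numFieldNormedType.Exports.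
Local Open Scope classical_set_scope.
Local Open Scope ring_scope.
Set Implicit Arguments.
Unset Strict Implicit.
Unset Printing Implicit Defensive.

(** * Expectations of real functions: linearity and limit theorems *)

Section expectation.
Context {d : measure_display} {T : measurableType d} {R : realType}.
Variable P : probability T R.

(** The hypotheses bound conditional moments with the absolute value outside the expectation, so
    absolute third moments have to be recovered from exponential moments of both signs; a
    third-order remainder then costs [e v] for a step of variance [v]. As [v] is deterministic, so
    is the remaining variance [s], and a step can be exchanged for a Gaussian of variance [v]: the
    kernels solve the heat equation, so the terms of order one and two cancel. The Gronwall loop
    closes because the remainder is controlled by a Laplace kernel [kap], whose tilted expectation
    is bounded by the density bound itself times [sqrt s]. Up to the tilt, a density step costs a
    factor [1 + C e v s ^ (-3/2)]; the sum of [v s ^ (-3/2)] is of order [1 / delta] when the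
    smoothing scale is [delta], so [delta >= 8 e] keeps the product bounded. A tail step costs
    [e v / s], whose sum is the logarithm. All exponents must add up to the exact Bernstein
    exponent, hence [exp (lam X)] is never expanded in a leading term. *)

Definition integ (f : T -> R) : Prop := P.-integrable setT (EFin \o f).

Definition Ex (f : T -> R) : R := (\int[P]_w f w)%R.

Lemma eq_Ex (f g : T -> R) : (forall w, f w = g w) -> Ex f = Ex g.
Proof. by move=> /funext ->. Qed.

Lemma integ_mfun (f : T -> R) : integ f -> measurable_fun setT f.
Proof. by move=> /measurable_int /measurable_EFinP. Qed.

Lemma integ_dom (f g : T -> R) : measurable_fun setT f -> integ g ->
  (forall w, `|f w| <= g w) -> integ f.
Proof.
move=> mf ig fg; apply: le_integrable ig => //; first exact/measurable_EFinP.
by move=> w _ /=; rewrite lee_fin (le_trans (fg w))// ler_norm.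
Qed.

Lemma integ_bdd (f : T -> R) (c : R) : measurable_fun setT f ->
  (forall w, `|f w| <= c) -> integ f.
Proof.
move=> mf fc; apply: (integ_dom (g := cst c)) => //.
exact: finite_measure_integrable_cst.
Qed.

Lemma integ_add (f g : T -> R) : integ f -> integ g ->
  integ (fun w => f w + g w).
Proof. by move=> h1 h2; exact: (integrableD measurableT h1 h2). Qed.

Lemma integ_scale (c : R) (f : T -> R) : integ f -> integ (fun w => c * f w).
Proof. by move=> h1; exact: (integrableZl measurableT c h1). Qed.

Lemma integ_opp (f : T -> R) : integ f -> integ (fun w => - f w).
Proof.
move=> h; have := integ_scale (-1) h.
by rewrite (_ : (fun w => -1 * f w) = (fun w => - f w)) //; apply/funext => w; rewrite mulN1r.
Qed.

Lemma integ_norm (f : T -> R) : integ f -> integ (fun w => `|f w|).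
Proof. by move=> h1; exact: (integrable_norm h1). Qed.

Lemma integ_ext (f g : T -> R) : (forall w, f w = g w) -> integ f -> integ g.
Proof. by move=> /funext ->. Qed.

Lemma integ_sum (I : Type) (r : seq I) (f : I -> T -> R) :
  (forall i, integ (f i)) -> integ (fun w => \sum_(i <- r) f i w).
Proof.
move=> h; elim: r => [|a r IH].
  apply: (integ_bdd (c := 0)) => [|w]; last by rewrite big_nil normr0.
  by under eq_fun do rewrite big_nil; exact: measurable_cst.
by under eq_fun do rewrite big_cons; apply: integ_add.
Qed.

Lemma Ex_add (f g : T -> R) : integ f -> integ g ->
  Ex (fun w => f w + g w) = Ex f + Ex g.
Proof. by move=> h1 h2; rewrite /Ex RintegralD. Qed.

Lemma Ex_scale (c : R) (f : T -> R) : integ f ->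
  Ex (fun w => c * f w) = c * Ex f.
Proof. by move=> h1; rewrite /Ex RintegralZl. Qed.

Lemma Ex_opp (f : T -> R) : integ f -> Ex (fun w => - f w) = - Ex f.
Proof.
move=> h; rewrite -mulN1r -Ex_scale//.
by apply: eq_Ex => w; rewrite mulN1r.
Qed.

Lemma Ex_sum (I : Type) (r : seq I) (f : I -> T -> R) :
  (forall i, integ (f i)) ->
  Ex (fun w => \sum_(i <- r) f i w) = \sum_(i <- r) Ex (f i).
Proof.
move=> h; elim: r => [|a r IH].
  rewrite big_nil (@eq_Ex _ (fun=> 0)) => [|w]; last by rewrite big_nil.
  by rewrite /Ex /Rintegral integral0.
rewrite big_cons -IH -Ex_add//; last exact: integ_sum.
by apply: eq_Ex => w; rewrite big_cons.
Qed.

Lemma Ex_le (f g : T -> R) : integ f -> integ g -> (forall w, f w <= g w) ->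
  Ex f <= Ex g.
Proof. by move=> h1 h2 h; apply: le_Rintegral. Qed.

Lemma Ex_ge0 (f : T -> R) : (forall w, 0 <= f w) -> 0 <= Ex f.
Proof. by move=> h; apply: Rintegral_ge0. Qed.

Lemma Ex_norm (f : T -> R) : integ f -> `|Ex f| <= Ex (fun w => `|f w|).
Proof. by move=> h; apply: le_normr_Rintegral. Qed.

Lemma Ex_cst (c : R) : Ex (fun=> c) = c.
Proof.
have := Rintegral_cst P measurableT c; rewrite /Ex /cst => ->.
rewrite -[RHS]mulr1; congr (_ * _); exact: (congr1 fine (probability_setT P)).
Qed.

Lemma Ex_indic (A : set T) : measurable A -> Ex (\1_A) = fine (P A).
Proof. by move=> mA; rewrite /Ex /Rintegral integral_indic// setIT. Qed.

Lemma Ex_EFin (f : T -> R) : integ f ->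
  (Ex f)%:E = (\int[P]_w (f w)%:E)%E.
Proof. by move=> h; rewrite /Ex /Rintegral fineK// integrable_fin_num. Qed.

Lemma Ex_dominated_cvg (u : nat -> T -> R) (f g : T -> R) :
  (forall n, measurable_fun setT (u n)) -> measurable_fun setT f ->
  integ g -> (forall n w, `|u n w| <= g w) ->
  (forall w, u n w @[n --> \oo] --> f w) ->
  integ f /\ Ex (u n) @[n --> \oo] --> Ex f.
Proof.
move=> mu mf ig ug uf.
have [|//|||h1 _ h3] := @dominated_convergence _ _ _ P setT measurableT
   (fun n => EFin \o u n) (EFin \o f) (EFin \o g) _ _ _ ig.
- by move=> n; exact/measurable_EFinP.
- exact/measurable_EFinP.
- by apply: aeW => w _ /=; apply: cvg_EFin; [exact: nearW|exact: uf].
- by apply: aeW => w n _ /=; rewrite lee_fin.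
split => //.
have iu n : integ (u n) by apply: integ_dom (ug n).
rewrite -(fineK (integrable_fin_num _ h1))// in h3.
move/fine_cvgP : h3 => [_].
exact: cvg_trans.
Qed.

(** Fatou yields integrability of the limit where no integrable dominating function is known yet:
    for exponentials and for truncated weights. *)
Lemma Ex_fatou_bound (u : nat -> T -> R) (f : T -> R) (c : R) :
  (forall n, integ (u n)) -> (forall n w, 0 <= u n w) ->
  measurable_fun setT f ->
  (forall w, u n w @[n --> \oo] --> f w) ->
  (forall n, Ex (u n) <= c) -> integ f /\ Ex f <= c.
Proof.
move=> iu u0 mf uf uc.
have f0 w : 0 <= f w.
  by apply: (cvgr_to_ge (uf w)); exact: nearW.
have le1 : (\int[P]_w (f w)%:E <= c%:E)%E.
  have -> : (\int[P]_w (f w)%:E =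
     \int[P]_w limn_einf (fun n => (u n w)%:E))%E.
    apply: eq_integral => w _; have uw : ((u n w)%:E @[n --> \oo] --> (f w)%:E)%E.
      by apply: cvg_EFin; [exact: nearW|exact: uf].
    rewrite is_cvg_limn_einfE; last by apply/cvg_ex; exists (f w)%:E.
    exact/esym/cvg_lim.
  apply: (le_trans (@fatou _ _ _ P setT measurableT (fun n => EFin \o u n) _ _)).
  - by move=> n; apply/measurable_EFinP/integ_mfun.
  - by move=> n w _ /=; rewrite lee_fin.
  rewrite limn_einf_lim.
  apply: lime_le; first exact: is_cvg_einfs.
  apply: nearW => n; apply: ge_ereal_inf.
  exists (\int[P]_x (u n x)%:E)%E; first by exists n => /=.
  by rewrite -Ex_EFin// lee_fin.
have iif : integ f.
  apply/integrableP; split; first exact/measurable_EFinP.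
  under eq_integral do rewrite /= ger0_norm//.
  exact: le_lt_trans le1 (ltry _).
by split => //; rewrite -lee_fin Ex_EFin.
Qed.

End expectation.

(** * Conditional Bernstein moments *)

Section exponential_moments.
Context {d : measure_display} {T : measurableType d} {R : realType}.
Variable P : probability T R.

Local Notation integ := (integ P).
Local Notation Ex := (Ex P).

(* [Z] stands for a nonnegative function of the past of a martingale difference
   [X], so that [E (Z X ^ l)] tests the conditional moments of [X]. *)
Record bernstein_moments (X Z : T -> R) (v e : R) : Prop := BernsteinMoments {
  bm_X : measurable_fun setT X ;
  bm_ge0 : forall w, 0 <= Z w ;
  bm_int : forall l, integ (fun w => Z w * X w ^+ l) ;
  bm_1 : Ex (fun w => Z w * X w) = 0 ;
  bm_2 : Ex (fun w => Z w * X w ^+ 2) = v * Ex Z ;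
  bm_l : forall l, (2 <= l)%N ->
    `|Ex (fun w => Z w * X w ^+ l)| <= 2^-1 * l`!%:R * e ^+ (l - 2) * v * Ex Z }.

Lemma exp_psum_norm (x : R) n : `|series (exp_coeff x) n| <= expR `|x|.
Proof.
apply: (@le_trans _ _ (series (exp_coeff `|x|) n)).
  rewrite /series /=; apply: (le_trans (ler_norm_sum _ _ _)).
  by apply: ler_sum => i _; rewrite normrM normrX (ger0_norm (x := _^-1)).
apply: (cvgr_to_ge (is_cvg_series_exp_coeff `|x|)).
near=> m; have nm : (n <= m)%N by near: m; exact: nbhs_infty_ge.
rewrite -subr_ge0 sub_series_geq//; apply: sumr_ge0 => i _.
by rewrite mulr_ge0 ?exprn_ge0.
Unshelve. all: end_near. Qed.

(** Odd powers cancel and even ones are nonnegative. A partial sum of [exp] alone may be negative,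
    which would rule out Fatou. *)
Lemma exp_psum_sym_ge0 (x : R) n :
  0 <= series (exp_coeff x) n + series (exp_coeff (- x)) n.
Proof.
rewrite /series /= -big_split /=; apply: sumr_ge0 => i _.
rewrite /exp_coeff /= -mulrDl mulr_ge0//.
rewrite exprNn -signr_odd; case: (boolP (odd i)) => oi /=.
  by rewrite expr1 mulN1r subrr.
by rewrite expr0 mul1r; apply: addr_ge0; apply: exprn_even_ge0.
Qed.

Variables (X Z : T -> R) (v e : R).
Hypotheses (v0 : 0 <= v) (e0 : 0 < e) (mom : bernstein_moments X Z v e).

Lemma bm_intZ : integ Z.
Proof. by apply: integ_ext (bm_int mom 0) => w; rewrite mulr1. Qed.

Let iZ := bm_intZ.
Let mZ := integ_mfun iZ.
Let mX := bm_X mom.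

Let z0 : 0 <= Ex Z.
Proof. exact: Ex_ge0 (bm_ge0 mom). Qed.

Lemma integ_psum lam n :
  integ (fun w => Z w * series (exp_coeff (lam * X w)) n).
Proof.
have -> : (fun w => Z w * series (exp_coeff (lam * X w)) n) =
    (fun w => \sum_(0 <= l < n) (lam ^+ l / l`!%:R * (Z w * X w ^+ l))).
  apply/funext => w; rewrite /series /= mulr_sumr; apply: eq_bigr => l _.
  by rewrite /exp_coeff /= exprMn; ring.
apply: integ_sum => l; apply: integ_scale; exact: (bm_int mom).
Qed.

(** Orders 0 and 1 contribute [Ex Z] and 0. At order [l + 2] the factorial of the Bernstein bound
    cancels that of the exponential series, leaving [lam ^ 2 v / 2] times [r ^ l] with
    [r = |lam| e]: a geometric series. *)
Lemma Ex_psum_le lam n : `|lam| * e < 1 ->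
  Ex (fun w => Z w * series (exp_coeff (lam * X w)) n) <=
  (1 + lam ^+ 2 / (2 * (1 - `|lam| * e)) * v) * Ex Z.
Proof.
move=> le1; set r := `|lam| * e.
have r0 : 0 <= r by rewrite mulr_ge0 ?normr_ge0 ?ltW.
have r1 : 0 < 1 - r by rewrite subr_gt0.
pose m l := lam ^+ l / l`!%:R * Ex (fun w => Z w * X w ^+ l).
have -> : Ex (fun w => Z w * series (exp_coeff (lam * X w)) n) =
    \sum_(0 <= l < n) m l.
  have -> : (fun w => Z w * series (exp_coeff (lam * X w)) n) =
      (fun w => \sum_(0 <= l < n) (lam ^+ l / l`!%:R * (Z w * X w ^+ l))).
    apply/funext => w; rewrite /series /= mulr_sumr; apply: eq_bigr => l _.
    by rewrite /exp_coeff /= exprMn; ring.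
  rewrite Ex_sum; last by move=> l; apply: integ_scale; exact: (bm_int mom).
  by apply: eq_bigr => l _; rewrite Ex_scale//; exact: (bm_int mom).
have m0 : m 0%N = Ex Z.
  rewrite /m expr0 fact0 divr1 mul1r; apply: eq_Rintegral => w _.
  by rewrite expr0 mulr1.
have m1 : m 1%N = 0.
  have -> : m 1%N = lam ^+ 1 / 1`!%:R * Ex (fun w => Z w * X w) by [].
  by rewrite (bm_1 mom) mulr0.
have ml l : m l.+2 <= 2^-1 * lam ^+ 2 * r ^+ l * v * Ex Z.
  apply: (le_trans (ler_norm _)); rewrite /m normrM normf_div normrX normr_nat.
  apply: (@le_trans _ _ (`|lam| ^+ l.+2 / (l.+2)`!%:R *
     (2^-1 * (l.+2)`!%:R * e ^+ (l.+2 - 2) * v * Ex Z))).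
    by apply: ler_wpM2l; [rewrite divr_ge0// exprn_ge0|exact: (bm_l mom)].
  rewrite subn2 /= -[lam ^+ 2]real_normK ?num_real//.
  rewrite le_eqVlt; apply/orP; left; apply/eqP.
  have f0 : (l.+2)`!%:R != 0 :> R by rewrite pnatr_eq0 -lt0n fact_gt0.
  by rewrite /r exprMn -addn2 exprD; field.
have geo k : \sum_(0 <= l < k.+2) m l <=
    Ex Z + 2^-1 * lam ^+ 2 * v * Ex Z * ((1 - r ^+ k) / (1 - r)).
  elim: k => [|k IH].
    by rewrite big_nat_recr//= big_nat1 m0 m1 expr0 subrr mul0r mulr0.
  rewrite big_nat_recr//=; apply: (le_trans (lerD IH (ml k))).
  rewrite -addrA lerD2l le_eqVlt; apply/orP; left; apply/eqP.
  by rewrite (exprS r); field; rewrite lt0r_neq0.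
have L0 : 0 <= lam ^+ 2 / (2 * (1 - r)) * v.
  by rewrite mulr_ge0// divr_ge0 ?sqr_ge0// mulr_ge0// ltW.
case: n => [|[|k]].
- by rewrite big_geq// mulr_ge0// addr_ge0.
- by rewrite big_nat1 m0 ler_peMl// lerDl.
apply: (le_trans (geo k)); rewrite [leRHS]mulrDl mul1r lerD2l.
have -> : lam ^+ 2 / (2 * (1 - r)) * v * Ex Z =
   2^-1 * lam ^+ 2 * v * Ex Z * (1 / (1 - r)) by field; rewrite lt0r_neq0.
apply: ler_wpM2l; first by rewrite mulr_ge0// mulr_ge0// mulr_ge0 ?sqr_ge0.
by rewrite ler_pM2r ?invr_gt0// gerBl exprn_ge0.
Qed.

Let psum_cvg (x : R) : series (exp_coeff x) n @[n --> \oo] --> expR x.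
Proof. exact: is_cvg_series_exp_coeff. Qed.

Lemma mfun_expX lam : measurable_fun setT (fun w => expR (lam * X w)).
Proof. by apply: measurableT_comp => //; exact: measurable_funM. Qed.

(** No absolute moment is at hand to dominate the series, so Fatou is applied to the series of
    [exp y + exp (- y)], whose expectations are bounded by [Ex_psum_le] at [lam] and [- lam]. *)
Lemma integ_Zexp (lam : R) : `|lam| * e < 1 -> integ (fun w => Z w * expR (lam * X w)).
Proof.
move=> le1.
have le1' : `|- lam| * e < 1 by rewrite normrN.
pose c := 2 * ((1 + lam ^+ 2 / (2 * (1 - `|lam| * e)) * v) * Ex Z).
have [|||||h _] := @Ex_fatou_bound _ _ _ P
   (fun n w => Z w * (series (exp_coeff (lam * X w)) n +
                      series (exp_coeff (- (lam * X w))) n))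
   (fun w => Z w * (expR (lam * X w) + expR (- (lam * X w)))) c.
- move=> n; under eq_fun do rewrite mulrDr -mulNr.
  by apply: integ_add; exact: integ_psum.
- by move=> n w; rewrite mulr_ge0 ?(bm_ge0 mom)// exp_psum_sym_ge0.
- apply: measurable_funM => //; apply: measurable_funD; first exact: mfun_expX.
  by under eq_fun do rewrite -mulNr; exact: mfun_expX.
- by move=> w; apply: cvgMr; apply: cvgD; exact: psum_cvg.
- move=> n.
  have -> : (fun w => Z w * (series (exp_coeff (lam * X w)) n +
                      series (exp_coeff (- (lam * X w))) n)) =
    (fun w => Z w * series (exp_coeff (lam * X w)) n +
              Z w * series (exp_coeff (- lam * X w)) n).
    by apply/funext => w; rewrite mulrDr -mulNr.
  rewrite Ex_add; [|exact: integ_psum|exact: integ_psum].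
  rewrite /c mulr_natl mulr2n; apply: lerD; first exact: Ex_psum_le.
  by have := Ex_psum_le n le1'; rewrite sqrrN normrN.
apply: integ_dom h _; first by apply: measurable_funM => //; exact: mfun_expX.
move=> w; rewrite normrM (ger0_norm (bm_ge0 mom w)) (ger0_norm (expR_ge0 _)).
by rewrite ler_wpM2l ?(bm_ge0 mom)// lerDl expR_ge0.
Qed.

Lemma integ_Zexp_norm (lam : R) : `|lam| * e < 1 ->
  integ (fun w => Z w * expR (`|lam| * `|X w|)).
Proof.
move=> le1; have le1' : `|- lam| * e < 1 by rewrite normrN.
have h := integ_add (integ_Zexp le1) (integ_Zexp le1').
apply: integ_dom h _.
  apply: measurable_funM => //; apply: measurableT_comp => //.
  by apply: measurable_funM => //; exact: measurableT_comp.
move=> w; rewrite normrM (ger0_norm (bm_ge0 mom w)) (ger0_norm (expR_ge0 _)).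
rewrite -mulrDr ler_wpM2l ?(bm_ge0 mom)//.
rewrite -normrM; have [h0|h0] := ler0P (lam * X w).
  by rewrite -mulNr lerDr expR_ge0.
by rewrite lerDl expR_ge0.
Qed.

(** With [exp (|lam| |X|)] now integrable against [Z], dominated convergence passes the bound on
    partial sums to the limit. *)
Lemma Ex_Zexp_le (lam : R) : `|lam| * e < 1 ->
  Ex (fun w => Z w * expR (lam * X w)) <=
  (1 + lam ^+ 2 / (2 * (1 - `|lam| * e)) * v) * Ex Z.
Proof.
move=> le1.
have [||||_ cv] := @Ex_dominated_cvg _ _ _ P
   (fun n w => Z w * series (exp_coeff (lam * X w)) n)
   (fun w => Z w * expR (lam * X w)) _ _ _ (integ_Zexp_norm le1).
- by move=> n; exact/integ_mfun/integ_psum.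
- by apply: measurable_funM => //; exact: mfun_expX.
- move=> n w; rewrite normrM (ger0_norm (bm_ge0 mom w)).
  by rewrite ler_wpM2l ?(bm_ge0 mom)// -normrM; exact: exp_psum_norm.
- by move=> w; apply: cvgMr; exact: psum_cvg.
by apply: (cvgr_to_le cv); apply: nearW => n; exact: Ex_psum_le.
Qed.

End exponential_moments.

Lemma expR_ge_pow (R : realType) (s : R) n : 0 <= s -> s ^+ n.+1 <= n.+1`!%:R * expR s.
Proof.
move=> s0; rewrite mulrC -ler_pdivrMr ?ltr0n ?fact_gt0//.
by apply: le_trans (expR_ge1Dxn n s0); rewrite lerDr.
Qed.

(** In [cube_exp_le_cosh], with [x = exp s], the bounds [s <= x], [s ^ 2 <= 2 x], [s ^ 3 <= 6 x]
    give [s + 4 s ^ 2 + 4 s ^ 3 <= 33 x], and 264 is 8 times 33. It is locked so as to behave as an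
    opaque constant. *)
Definition cube_cst {R : realType} : R := locked 264.

Lemma cube_cst_gt0 (R : realType) : 0 < cube_cst :> R.
Proof. by rewrite /cube_cst -lock ltr0n. Qed.

(** Trades an absolute third moment with exponential weight for exponential moments of both signs.
    Subtracting 2 makes the right-hand side quadratic at 0, so that its expectation is proportional
    to the variance. *)
Lemma cube_exp_le_cosh (R : realType) (t : R) :
  `|t| ^+ 3 * expR (`|t| / 4) <= 2 * cube_cst * (expR (t / 2) + expR (- (t / 2)) - 2).
Proof.
set s := `|t| / 4.
have s0 : 0 <= s by rewrite divr_ge0.
have -> : `|t| = 4 * s by rewrite /s; field.
have -> : expR (t / 2) + expR (- (t / 2)) = expR (2 * s) + expR (- (2 * s)).
  rewrite /s; have [t0|t0] := ger0P t.
    by rewrite (_ : 2 * (t / 4) = t / 2)//; field.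
  by rewrite (_ : 2 * (- t / 4) = - (t / 2)) ?opprK 1?addrC//; field.
have x0 := expR_gt0 s.
have y0 := expR_gt0 (- s).
have xy : expR s * expR (- s) = 1 by rewrite -expRD subrr expR0.
rewrite (_ : 2 * s = s + s); last by rewrite mulr_natl mulr2n.
rewrite opprD !expRD.
have h1 : 1 + 2 * s <= expR s * expR s.
  by rewrite -expRD (_ : s + s = 2 * s) ?expR_ge1Dx// mulr_natl mulr2n.
have p1 := expR_ge_pow 0 s0; have p2 := expR_ge_pow 1 s0.
have p3 := expR_ge_pow 2 s0.
rewrite expr1 in p1.
have {}p1 : s <= expR s by move: p1; rewrite (_ : 1`! = 1%N)// mul1r.
have {}p2 : s ^+ 2 <= 2 * expR s by [].
have {}p3 : s ^+ 3 <= 6 * expR s by [].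
move: x0 y0 xy h1 p1 p2 p3; set x := expR s; set y := expR (- s).
move=> x0 y0 xy h1 p1 p2 p3.
(* with [x = exp s] the right-hand side is [528 (x - 1/x)^2] and
   [x^2 - 1 >= 2 s] *)
have xyE : x * x + y * y - 2 = (x - y) ^+ 2.
  have -> : (x - y) ^+ 2 = x * x + y * y - 2 * (x * y) by ring.
  by rewrite xy mulr1.
rewrite xyE.
have u1 : 2 * s * x <= (1 + 2 * s) * (x - y).
  have := ler_wpM2l (ltW y0) h1; rewrite (mulrA y x x) (mulrC y x) xy mul1r => h2.
  by rewrite -subr_ge0; move: h2; rewrite -subr_ge0; congr (0 <= _); ring.
have w0 : 0 < 1 + 2 * s by lra.
have u0 : 0 <= 2 * s * x by rewrite !mulr_ge0// ltW.
have u2 : (2 * s * x) ^+ 2 <= (1 + 2 * s) ^+ 2 * (x - y) ^+ 2.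
  by rewrite -exprMn lerXn2r ?nnegrE// (le_trans u0).
rewrite -(ler_pM2l (exprn_gt0 2 w0)).
have k0 := cube_cst_gt0 R.
have kE : cube_cst = 264 :> R by rewrite /cube_cst -lock.
move: k0 kE; set k := cube_cst => k0 kE.
have k2 : 0 <= 2 * k by rewrite mulr_ge0// ltW.
apply: (@le_trans _ _ (2 * k * (2 * s * x) ^+ 2)); last first.
  by rewrite [leRHS]mulrCA; apply: ler_wpM2l.
have -> : (1 + 2 * s) ^+ 2 * ((4 * s) ^+ 3 * x) =
  64 * s ^+ 2 * x * (s + 4 * s ^+ 2 + 4 * s ^+ 3) by ring.
have -> : 2 * k * (2 * s * x) ^+ 2 = 64 * s ^+ 2 * x * (33 * x) by rewrite kE; ring.
apply: ler_wpM2l; last by lra.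
by apply: mulr_ge0 (ltW x0); apply: mulr_ge0; [exact: ler0n|exact: sqr_ge0].
Qed.

Section bernstein_step.
Context {d : measure_display} {T : measurableType d} {R : realType}.
Variable P : probability T R.

Local Notation integ := (integ P).
Local Notation Ex := (Ex P).

(** At the tilt [c = 1 / (2 e)] each exponential moment is at most [(1 + c ^ 2 v) Ex Z]; the
    subtracted 2 removes the mass, and [2 c ^ 2 v e ^ 3 = e v / 2]. The extra factor [e] beyond the
    variance is the gain of every step below. *)
Lemma Ex_cube_exp (X Z : T -> R) (v e : R) : 0 <= v -> 0 < e ->
  bernstein_moments P X Z v e ->
  integ (fun w => Z w * (`|X w| ^+ 3 * expR (`|X w| / (4 * e)))) /\
  Ex (fun w => Z w * (`|X w| ^+ 3 * expR (`|X w| / (4 * e)))) <=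
    cube_cst * e * v * Ex Z.
Proof.
move=> v0 e0 mom.
have e_neq0 : e != 0 by rewrite gt_eqF.
pose c := (2 * e)^-1.
have c0 : 0 < c by rewrite invr_gt0 mulr_gt0.
have ce : `|c| * e = 2^-1 by rewrite gtr0_norm// /c; field.
have c1 : `|c| * e < 1 by rewrite ce; lra.
have cN1 : `|- c| * e < 1 by rewrite normrN.
have i1 := integ_Zexp v0 e0 mom c1.
have i2 := integ_Zexp v0 e0 mom cN1.
have iZ := bm_intZ mom.
have i3 := integ_scale (-2) iZ.
have i12 := integ_add i1 i2.
have i123 := integ_scale (2 * cube_cst * e ^+ 3) (integ_add i12 i3).
have le w : Z w * (`|X w| ^+ 3 * expR (`|X w| / (4 * e))) <=
    2 * cube_cst * e ^+ 3 * (Z w * expR (c * X w) + Z w * expR (- c * X w) + -2 * Z w).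
  have := cube_exp_le_cosh (X w / e).
  rewrite normf_div (gtr0_norm e0).
  have -> : `|X w| / e / 4 = `|X w| / (4 * e) by field.
  have -> : X w / e / 2 = c * X w by rewrite /c; field.
  rewrite -mulNr expr_div_n.
  move=> /(ler_wpM2l (mulr_ge0 (bm_ge0 mom w) (exprn_ge0 3 (ltW e0)))) h.
  apply: (le_trans (le_trans _ h)).
    rewrite le_eqVlt; apply/orP; left; apply/eqP; by field.
  by rewrite le_eqVlt; apply/orP; left; apply/eqP; ring.
have ii : integ (fun w => Z w * (`|X w| ^+ 3 * expR (`|X w| / (4 * e)))).
  apply: integ_dom i123 _.
    have mX := bm_X mom; have mZ := integ_mfun iZ.
    apply: measurable_funM => //; apply: measurable_funM.
      by apply: measurable_funX; exact: measurableT_comp.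
    apply: measurableT_comp => //; apply: measurable_funM => //.
    exact: measurableT_comp.
  move=> w; rewrite ger0_norm//.
  by rewrite mulr_ge0 ?(bm_ge0 mom)// mulr_ge0 ?expR_ge0// exprn_ge0.
split => //; apply: (le_trans (Ex_le ii i123 le)).
rewrite Ex_scale; last exact: integ_add.
rewrite Ex_add// Ex_add// Ex_scale//.
have h1 := Ex_Zexp_le v0 e0 mom c1; have h2 := Ex_Zexp_le v0 e0 mom cN1.
rewrite sqrrN normrN ce in h2; rewrite ce in h1.
have -> : cube_cst * e * v * Ex Z = 2 * cube_cst * e ^+ 3 *
  ((1 + c ^+ 2 / (2 * (1 - 2^-1)) * v) * Ex Z +
   (1 + c ^+ 2 / (2 * (1 - 2^-1)) * v) * Ex Z + -2 * Ex Z).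
  by rewrite /c; field.
apply: ler_wpM2l; first by rewrite mulr_ge0 ?exprn_ge0 ?(ltW e0)// mulr_ge0// ltW// cube_cst_gt0.
by apply: lerD => //; apply: lerD.
Qed.

(** Conditional moments are tested only against functions of [M], as all kernels below have that
    form. The weights may be unbounded, to allow exponential tilts of [M]. *)
Record bernstein_step (M X : T -> R) (v e : R) : Prop := BernsteinStep {
  bs_M : measurable_fun setT M ;
  bs_X : measurable_fun setT X ;
  bs_v : 0 <= v ;
  bs_e : 0 < e ;
  bs_mom : forall f : R -> R, measurable_fun setT f -> (forall m, 0 <= f m) ->
    integ (fun w => f (M w)) -> bernstein_moments P X (fun w => f (M w)) v e }.

Variables (M X : T -> R) (v e : R).
Hypothesis step : bernstein_step M X v e.

Let mM := bs_M step.
Let mX := bs_X step.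
Let v0 := bs_v step.
Let e0 := bs_e step.

Lemma bs_signed (f : R -> R) : measurable_fun setT f ->
  integ (fun w => f (M w)) ->
  [/\ integ (fun w => f (M w) * X w), integ (fun w => f (M w) * X w ^+ 2),
      Ex (fun w => f (M w) * X w) = 0 &
      Ex (fun w => f (M w) * X w ^+ 2) = v * Ex (fun w => f (M w))].
Proof.
move=> mf i_f.
pose fp x := Num.max (f x) 0; pose fm x := Num.max (- f x) 0.
have mfp : measurable_fun setT fp by exact: measurable_maxr.
have mfm : measurable_fun setT fm.
  by apply: measurable_maxr => //; exact: measurableT_comp.
have fp0 x : 0 <= fp x by rewrite /fp le_max lexx orbT.
have fm0 x : 0 <= fm x by rewrite /fm le_max lexx orbT.
have fE x : f x = fp x - fm x.
  rewrite /fp /fm; have [h|h] := leP (f x) 0.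
    by rewrite max_l ?oppr_ge0// sub0r opprK.
  by rewrite max_r ?subr0// oppr_le0 ltW.
have ifp : integ (fun w => fp (M w)).
  apply: integ_dom (integ_norm i_f) _; first exact: measurableT_comp.
  move=> w; rewrite ger0_norm// /fp.
  by have [h|h] := leP (f (M w)) 0; rewrite ?normr_ge0// ler_norm.
have ifm : integ (fun w => fm (M w)).
  apply: integ_dom (integ_norm i_f) _; first exact: measurableT_comp.
  move=> w; rewrite ger0_norm// /fm.
  by have [h|h] := leP (- f (M w)) 0; rewrite ?normr_ge0// -normrN ler_norm.
have bp := bs_mom step mfp fp0 ifp; have bm := bs_mom step mfm fm0 ifm.
have ip1 : integ (fun w => fp (M w) * X w) := bm_int bp 1.
have im1 : integ (fun w => fm (M w) * X w) := bm_int bm 1.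
have ip2 : integ (fun w => fp (M w) * X w ^+ 2) := bm_int bp 2.
have im2 : integ (fun w => fm (M w) * X w ^+ 2) := bm_int bm 2.
have E1 : (fun w => f (M w) * X w) = (fun w => fp (M w) * X w + - (fm (M w) * X w)).
  by apply/funext => w; rewrite fE mulrBl.
have E2 : (fun w => f (M w) * X w ^+ 2) =
    (fun w => fp (M w) * X w ^+ 2 + - (fm (M w) * X w ^+ 2)).
  by apply/funext => w; rewrite fE mulrBl.
have E0 : (fun w => f (M w)) = (fun w => fp (M w) + - fm (M w)).
  by apply/funext => w; rewrite fE.
have im1N := integ_opp im1; have im2N := integ_opp im2.
have ifmN := integ_opp ifm.
have Ep2 : Ex (fun w => fp (M w) * X w ^+ 2) = v * Ex (fun w => fp (M w)) := bm_2 bp.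
have Em2 : Ex (fun w => fm (M w) * X w ^+ 2) = v * Ex (fun w => fm (M w)) := bm_2 bm.
have Ep1 : Ex (fun w => fp (M w) * X w) = 0 := bm_1 bp.
have Em1 : Ex (fun w => fm (M w) * X w) = 0 := bm_1 bm.
rewrite E1 E2 E0; split.
- exact: integ_add.
- exact: integ_add.
- by rewrite Ex_add// Ex_opp// Ep1 Em1 subrr.
- rewrite (Ex_add ip2 im2N) (Ex_opp im2) Ep2 Em2.
  by rewrite (Ex_add ifp ifmN) (Ex_opp ifm) mulrBr.
Qed.

(** The rate [1 / (4 e)] is what the later conditions [lam e <= 1 / 8] and [e rho <= 1 / 8] are
    tuned to: together they give [lam + rho <= 1 / (4 e)]. *)
Lemma bs_remainder (B : R -> R) (g : T -> R) : measurable_fun setT B ->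
  (forall m, 0 <= B m) -> integ (fun w => B (M w)) -> measurable_fun setT g ->
  (forall w, `|g w| <= B (M w) * (`|X w| ^+ 3 * expR (`|X w| / (4 * e)))) ->
  integ g /\ `|Ex g| <= cube_cst * e * v * Ex (fun w => B (M w)).
Proof.
move=> mB B0 iB mg gB.
have [h1 h2] := Ex_cube_exp v0 e0 (bs_mom step mB B0 iB).
have ig : integ g by exact: integ_dom h1 gB.
split => //; apply: (le_trans (Ex_norm ig)); apply: le_trans h2.
by apply: Ex_le => //; exact: integ_norm.
Qed.

(** The leading term keeps [exp (lam X)] whole, to be estimated by the Bernstein bound: expanding it
    would spoil the exponent. The [f1] term vanishes by centering. *)
Lemma bs_tilted_expansion (lam : R) (f0 f1 f2 B : R -> R) (G : T -> R) :
  `|lam| * e < 1 ->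
  measurable_fun setT f0 -> (forall m, 0 <= f0 m) -> integ (fun w => f0 (M w)) ->
  measurable_fun setT f1 -> integ (fun w => f1 (M w)) ->
  measurable_fun setT f2 -> integ (fun w => f2 (M w)) ->
  measurable_fun setT B -> (forall m, 0 <= B m) -> integ (fun w => B (M w)) ->
  measurable_fun setT G ->
  (forall w, `|G w - (f0 (M w) * expR (lam * X w) + f1 (M w) * X w +
               f2 (M w) * X w ^+ 2)| <=
     B (M w) * (`|X w| ^+ 3 * expR (`|X w| / (4 * e)))) ->
  integ G /\
  Ex G <= (1 + lam ^+ 2 / (2 * (1 - `|lam| * e)) * v) * Ex (fun w => f0 (M w))
          + v * Ex (fun w => f2 (M w)) + cube_cst * e * v * Ex (fun w => B (M w)).
Proof.
move=> le1 mf0 f00 if0 mf1 if1 mf2 if2 mB B0 iB mG GB.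
have mom := bs_mom step mf0 f00 if0.
have i0 := integ_Zexp v0 e0 mom le1.
have [i1 _ E1 _] := bs_signed mf1 if1.
have [_ i2 _ E2] := bs_signed mf2 if2.
have i01 := integ_add i0 i1; have i012 := integ_add i01 i2.
have [|ig hg] := bs_remainder mB B0 iB _ GB.
  by apply: measurable_funB => //; exact: integ_mfun i012.
have GE : G = (fun w => (f0 (M w) * expR (lam * X w) + f1 (M w) * X w +
    f2 (M w) * X w ^+ 2) + (G w - (f0 (M w) * expR (lam * X w) + f1 (M w) * X w +
    f2 (M w) * X w ^+ 2))).
  by apply/funext => w; rewrite addrC subrK.
have iG := integ_add i012 ig; rewrite -GE in iG; split => //.
rewrite GE (Ex_add i012 ig) (Ex_add i01 i2) (Ex_add i0 i1) E1 E2 addr0.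
apply: lerD; last exact: le_trans (ler_norm _) hg.
rewrite lerD2r; exact: (Ex_Zexp_le v0 e0 mom le1).
Qed.

Lemma bs_expansion (f0 f1 f2 B : R -> R) (G : T -> R) :
  measurable_fun setT f0 -> integ (fun w => f0 (M w)) ->
  measurable_fun setT f1 -> integ (fun w => f1 (M w)) ->
  measurable_fun setT f2 -> integ (fun w => f2 (M w)) ->
  measurable_fun setT B -> (forall m, 0 <= B m) -> integ (fun w => B (M w)) ->
  measurable_fun setT G ->
  (forall w, `|G w - (f0 (M w) + f1 (M w) * X w + f2 (M w) * X w ^+ 2)| <=
     B (M w) * (`|X w| ^+ 3 * expR (`|X w| / (4 * e)))) ->
  integ G /\
  `|Ex G - (Ex (fun w => f0 (M w)) + v * Ex (fun w => f2 (M w)))| <=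
     cube_cst * e * v * Ex (fun w => B (M w)).
Proof.
move=> mf0 if0 mf1 if1 mf2 if2 mB B0 iB mG GB.
have [i1 _ E1 _] := bs_signed mf1 if1.
have [_ i2 _ E2] := bs_signed mf2 if2.
have i01 := integ_add if0 i1; have i012 := integ_add i01 i2.
have [|ig hg] := bs_remainder mB B0 iB _ GB.
  by apply: measurable_funB => //; exact: integ_mfun i012.
have GE : G = (fun w => (f0 (M w) + f1 (M w) * X w +
    f2 (M w) * X w ^+ 2) + (G w - (f0 (M w) + f1 (M w) * X w +
    f2 (M w) * X w ^+ 2))).
  by apply/funext => w; rewrite addrC subrK.
have iG := integ_add i012 ig; rewrite -GE in iG; split => //.
rewrite {1}GE (Ex_add i012 ig) (Ex_add i01 i2) (Ex_add if0 i1) E1 E2 addr0.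
by rewrite addrC addKr.
Qed.

End bernstein_step.

(** * Gaussian kernels *)

Section mean_value.
Context {R : realType}.
Implicit Types f df : R -> R.

Lemma mvt_le f df (l r : R) : l <= r ->
  (forall y : R, l <= y <= r -> is_derive y 1 f (df y)) ->
  exists2 c, l <= c <= r & f r - f l = df c * (r - l).
Proof.
move=> lr hd.
have [||c cab E] := @MVT_segment R f df l r lr.
- by move=> x; rewrite in_itv /= => /andP[/ltW h1 /ltW h2]; apply: hd; rewrite h1.
- apply: derivable_within_continuous => x; rewrite in_itv /= => hx.
  by have := hd _ hx => -[].
by exists c => //; move: cab; rewrite in_itv.
Qed.

Lemma mvt0 f df (b : R) : (forall y : R, is_derive y 1 f (df y)) ->
  exists2 c, `|c| <= `|b| & f b - f 0 = df c * b.
Proof.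
move=> hd; have [b0|/ltW b0] := leP 0 b.
  have [c /andP[c1 c2] E] := mvt_le b0 (fun y _ => hd y).
  by exists c; [rewrite !ger0_norm | rewrite E subr0].
have [c /andP[c1 c2] E] := mvt_le b0 (fun y _ => hd y).
exists c; first by rewrite !ler0_norm// lerN2.
by rewrite -[LHS]opprB E; ring.
Qed.

Lemma taylor2_bound (g g1 g2 : R -> R) (a h K : R) : 0 <= h ->
  (forall y : R, a <= y <= a + h -> is_derive y 1 g (g1 y)) ->
  (forall y : R, a <= y <= a + h -> is_derive y 1 g1 (g2 y)) ->
  (forall y, a <= y <= a + h -> `|g2 y| <= K) ->
  `|g (a + h) - g a - h * g1 a| <= K * h ^+ 2.
Proof.
move=> h0 d1 d2 gK.
have ah : a <= a + h by rewrite lerDl.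
have [c /andP[c1 c2] E1] := mvt_le ah d1.
have [y /andP[h1 h2]|c' /andP[c3 c4] E2] := @mvt_le g1 g2 _ _ c1.
  by apply: d2; rewrite h1 (le_trans h2).
have -> : g (a + h) - g a - h * g1 a = g2 c' * (c - a) * h.
  by rewrite -E2 E1; ring.
rewrite !normrM (ger0_norm h0) expr2 mulrA; apply: ler_wpM2r => //.
have c'a : a <= c' <= a + h by rewrite c3 (le_trans c4).
apply: ler_pM => //; first exact: gK.
by rewrite ger0_norm ?subr_ge0// lerBlDl.
Qed.

Lemma taylor3_bound (g g1 g2 g3 : R -> R) (x K : R) :
  (forall y : R, is_derive y 1 g (g1 y)) ->
  (forall y : R, is_derive y 1 g1 (g2 y)) ->
  (forall y : R, is_derive y 1 g2 (g3 y)) ->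
  (forall y, `|y| <= `|x| -> `|g3 y| <= K) ->
  `|g x - g 0 - g1 0 * x - 2^-1 * g2 0 * x ^+ 2| <= K * `|x| ^+ 3.
Proof.
move=> d1 d2 d3 gK.
pose r y := g y - g 0 - g1 0 * y - 2^-1 * g2 0 * y ^+ 2.
have dr (y : R) : is_derive y 1 r (g1 y - g1 0 - g2 0 * y).
  have h1 := d1 y; rewrite /r.
  by apply: is_derive_eq; rewrite /= !scaler1 /GRing.scale /=; field.
have [c hc E1] := mvt0 x dr.
have r0 : r 0 = 0 by rewrite /r; ring.
have [c' hc' E2] : exists2 c', `|c'| <= `|c| & g1 c - g1 0 - g2 0 * c = (g2 c' - g2 0) * c.
  by have [c' h E] := mvt0 c d2; exists c' => //; rewrite E; ring.
have [c'' hc'' E3] := mvt0 c' d3.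
rewrite -/(r x) -[r x]subr0 -r0 E1 E2 E3 !normrM.
have cx' := le_trans hc' hc; have cx'' := le_trans hc'' cx'.
have -> : K * `|x| ^+ 3 = K * `|x| * `|x| * `|x| by ring.
apply: ler_wpM2r => //; apply: ler_pM => //.
by apply: ler_pM => //; exact: gK.
Qed.

(** The limit along the integers suffices, since [F] is nonincreasing beyond [a]. Gaussian tail
    inequalities thereby reduce to inequalities between derivatives. *)
Lemma decr_ge0 (F dF : R -> R) (a : R) :
  (forall y : R, a <= y -> is_derive y 1 F (dF y)) ->
  (forall y, a <= y -> dF y <= 0) ->
  F n%:R @[n --> \oo] --> (0 : R) ->
  forall x, a <= x -> 0 <= F x.
Proof.
move=> hd h0 cv x ax.
apply: (cvgr_to_le cv); near=> n.
have xn : x <= n%:R by near: n; exact: nbhs_infty_ger.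
rewrite -subr_le0.
have [y /andP[xy _]|c /andP[xc _] ->] := @mvt_le F dF x n%:R xn.
  by apply: hd; exact: le_trans xy.
by rewrite mulr_le0_ge0 ?subr_ge0// h0// (le_trans ax).
Unshelve. all: end_near. Qed.

End mean_value.

(** * The Gaussian density and its tail *)

Section gaussian.
Context {R : realType}.

Definition gpdf (t : R) : R := normal_peak 1 * expR (- (t ^+ 2 / 2)).

Lemma normal_pdf01 : normal_pdf 0 1 = gpdf.
Proof.
apply/funext => t; rewrite normal_pdfE ?oner_neq0// /normal_fun /gpdf subr0.
by rewrite expr1n mulNr.
Qed.

Lemma gpdf_gt0 (t : R) : 0 < gpdf t.
Proof. by rewrite mulr_gt0 ?expR_gt0// normal_peak_gt0 ?oner_neq0. Qed.

Lemma is_derive_gauss (t : R) :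
  is_derive t 1 (fun t : R => expR (- (t ^+ 2 / 2))) (- t * expR (- (t ^+ 2 / 2))).
Proof.
have h : is_derive t 1 (fun t : R => - (t ^+ 2 / 2)) (- t).
  by apply: is_derive_eq; rewrite /= !scaler1 /GRing.scale /=; field.
by rewrite mulrC; exact: (is_derive1_comp (is_derive_expR _) h).
Qed.

Lemma is_derive_gpdf (t : R) : is_derive t 1 gpdf (- t * gpdf t).
Proof.
have h := is_derive_gauss t.
by rewrite /gpdf mulrCA; exact: (is_deriveZ (normal_peak 1) h).
Qed.

Definition gtail (t : R) : R := 1 - std_normal_cdf t.

Lemma is_derive_gtail (t : R) : is_derive t 1 gtail (- gpdf t).
Proof.
have cpdf : continuous gpdf.
  by move=> y; apply/differentiable_continuous/derivable1_diffP; case: (is_derive_gpdf y).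
have [] := @continuous_FTC1 R gpdf -oo%O t (t + 1) _ _ _ (cpdf t).
- by rewrite ltrDl.
- rewrite -normal_pdf01; apply: (integrableS _ _ (subsetT _)) => //.
  exact: integrable_normal_pdf.
- exact: ltNyr.
move=> h1 h2.
have h : is_derive t 1 (@std_normal_cdf R) (gpdf t).
  rewrite -h2 derive1E.
  have -> : (@std_normal_cdf R) = (fun x => \int[lebesgue_measure]_(t in [set` Interval -oo%O (BRight x)]) (gpdf t))%R.
    by apply/funext => x; rewrite /std_normal_cdf /normal_prob normal_pdf01.
  exact: derivableP.
by rewrite -[- gpdf t]sub0r; exact: (is_deriveB (is_derive_cst (1 : R) t 1) h).
Qed.

Local Open Scope measure_display_scope.
(* The identity as a random variable under [normal_prob 0 1], so that the
   library's results on [cdf] apply to [std_normal_cdf]. *)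
Let idTR : measurableTypeR R -> R := idfun.

#[local] HB.instance Definition _ :=
  @isMeasurableFun.Build _ _ _ _ idTR (@measurable_id _ _ setT).

Let std_normal_cdfE (t : R) :
  (std_normal_cdf t)%:E = cdf (idTR : {RV (normal_prob (0 : R) 1) >-> R}) t.
Proof.
rewrite /std_normal_cdf fineK//; apply: fin_num_measure; exact: measurable_itv.
Qed.

Lemma cvg_std_normal_cdfy : std_normal_cdf n%:R @[n --> \oo] --> (1 : R).
Proof.
have h := @cvg_cdfy1 _ _ _ _ (idTR : {RV (normal_prob (0 : R) 1) >-> R}).
have : (std_normal_cdf n%:R)%:E @[n --> \oo] --> (1 : R)%:E.
  under eq_cvg do rewrite std_normal_cdfE.
  by move/cvge_pinftyP : h; apply; apply/cvgryPge/nbhs_infty_ger.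
by move/fine_cvgP => [_].
Qed.

Lemma cvg_std_normal_cdfNy : std_normal_cdf (- n%:R) @[n --> \oo] --> (0 : R).
Proof.
have h := @cvg_cdfNy0 _ _ _ _ (idTR : {RV (normal_prob (0 : R) 1) >-> R}).
have : (std_normal_cdf (- n%:R))%:E @[n --> \oo] --> (0 : R)%:E.
  under eq_cvg do rewrite std_normal_cdfE.
  move/cvge_ninftyP : h; apply; apply/cvgNrNy; apply/cvgryPge/nbhs_infty_ger.
by move/fine_cvgP => [_].
Qed.

Lemma gtail_ge0 (t : R) : 0 <= gtail t.
Proof.
rewrite subr_ge0 -lee_fin std_normal_cdfE; exact: cdf_le1.
Qed.

Lemma gtail_le1 (t : R) : gtail t <= 1.
Proof.
rewrite lerBlDr lerDl -lee_fin std_normal_cdfE; exact: cdf_ge0.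
Qed.

Lemma cvg_gtail : gtail n%:R @[n --> \oo] --> (0 : R).
Proof.
rewrite -(subrr 1); apply: cvgB; first exact: cvg_cst.
exact: cvg_std_normal_cdfy.
Qed.

(** The sum of the tails at [y] and [- y] has zero derivative; its value is read off at infinity. *)
Lemma gtailN (t : R) : gtail (- t) = 1 - gtail t.
Proof.
pose F (y : R) := gtail y + gtail (- y).
have dF (y : R) : is_derive y 1 F 0.
  have h1 := is_derive_gtail y.
  have h2 := is_derive_gtail (- y).
  have h3 : is_derive y 1 (gtail \o -%R) (- gpdf (- y) * -1) by exact: is_derive1_comp.
  have -> : 0 = - gpdf y + (- gpdf (- y) * -1) :> R.
    by rewrite /gpdf sqrrN; ring.
  exact: is_deriveD.
have F1 y : F y = F 0.
  by have [c _] := mvt0 y dF; rewrite mul0r => /eqP; rewrite subr_eq0 => /eqP.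
have cF : F n%:R @[n --> \oo] --> (1 : R).
  have h : F n%:R @[n --> \oo] --> ((1 - 1) + (1 - 0) : R).
    apply: cvgD; apply: cvgB; first exact: cvg_cst.
    - exact: cvg_std_normal_cdfy.
    - exact: cvg_cst.
    - exact: cvg_std_normal_cdfNy.
  by rewrite subrr subr0 add0r in h.
have F01 : F 0 = 1.
  have cF0 : F n%:R @[n --> \oo] --> F 0.
    by under eq_cvg do rewrite F1; exact: cvg_cst.
  exact: (cvg_unique _ cF0 cF).
by apply/eqP; rewrite eq_sym subr_eq addrC -F01 -(F1 t) eq_sym.
Qed.

Lemma cvg_gauss : expR (- (n%:R ^+ 2 / 2)) @[n --> \oo] --> (0 : R).
Proof.
apply: (@squeeze_cvgr _ _ _ _ (fun=> 0) (fun n => expR (- (2^-1 : R)) ^+ n)).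
- apply: nearW => n; rewrite expR_ge0/= -expRM_natr ler_expR mulNr lerN2 mulrC.
  apply: ler_wpM2r; first by rewrite invr_ge0.
  by rewrite -natrX ler_nat; case: n => // n; rewrite -{1}[n.+1]expn1 leq_pexp2l.
- exact: cvg_cst.
- apply: cvg_expr; rewrite ger0_norm ?expR_ge0// expR_lt1 oppr_lt0 invr_gt0//.
Qed.

Lemma normal_peak1_le1 : normal_peak (1 : R) <= 1.
Proof.
have h : 1 <= 1 ^+ 2 * pi *+ 2 :> R.
  by rewrite expr1n mul1r mulr2n; have := @pi_ge2 R; lra.
rewrite /normal_peak invf_le1 ?sqrtr_gt0 ?(lt_le_trans _ h)//.
by rewrite -[X in X <= _]sqrtr1; exact: ler_wsqrtr.
Qed.

(** For [t <= 1] the right-hand side is at least 1. Beyond 1, [y exp (- y ^ 2 / 2)] dominates the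
    density, so [exp (- y ^ 2 / 2) - gtail y] decreases to 0. *)
Lemma gtail_le (t : R) : 0 <= t -> gtail t <= 2 * expR (- (t ^+ 2 / 2)).
Proof.
move=> t0; have [t1|t1] := leP t 1.
  apply: (le_trans (gtail_le1 t)).
  have := expR_ge1Dx (- (t ^+ 2 / 2)); have : t ^+ 2 <= 1 by rewrite expr_le1.
  by lra.
pose F (y : R) := expR (- (y ^+ 2 / 2)) - gtail y.
have F0 : 0 <= F t.
  apply: (@decr_ge0 _ F (fun y => - y * expR (- (y ^+ 2 / 2)) - - gpdf y) 1) (ltW t1).
  - by move=> y y1; apply: is_deriveB; [exact: is_derive_gauss|exact: is_derive_gtail].
  - move=> y y1; rewrite /gpdf opprK -mulrDl pmulr_lle0 ?expR_gt0//.
    by have := normal_peak1_le1; lra.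
  - rewrite -(subrr 0); apply: cvgB; [exact: cvg_gauss|exact: cvg_gtail].
have := expR_gt0 (- (t ^+ 2 / 2)); move: F0; rewrite /F; lra.
Qed.

(** A Mills ratio bound. With [u = 1 / (1 + y)], so that [y u = 1 - u], the difference has
    derivative [gpdf y (u ^ 2 - u) <= 0]. *)
Lemma gtail_ge (t : R) : 0 <= t -> gpdf t / (1 + t) <= gtail t.
Proof.
move=> t0; rewrite -subr_ge0.
pose F (y : R) := gtail y - gpdf y * (1 + y)^-1.
apply: (@decr_ge0 _ F (fun y => - gpdf y -
   (gpdf y * (- (1 + y) ^- 2) + (1 + y)^-1 * (- y * gpdf y))) 0) t0.
- move=> y y0; have y1 : 1 + y != 0 by rewrite gt_eqF// ltr_wpDr.
  have h0 : is_derive y 1 (fun y : R => 1 + y) 1.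
    by rewrite -[X in is_derive _ _ _ X]add0r; exact: is_deriveD.
  have h1 : is_derive y 1 (fun y : R => (1 + y)^-1) (- (1 + y) ^- 2).
    by rewrite -[X in is_derive _ _ _ X]mulr1; exact: is_deriveV y1 h0.
  have h2 := is_derive_gpdf y.
  apply: is_deriveB; first exact: is_derive_gtail.
  exact: is_deriveM.
- move=> y y0.
  have u0 : 0 < (1 + y)^-1 by rewrite invr_gt0 ltr_wpDr.
  have u1 : (1 + y)^-1 <= 1 by rewrite invf_le1 ?lerDl// ltr_wpDr.
  rewrite -exprVn; set u := (1 + y)^-1 in u0 u1 *.
  have yu : y * u = 1 - u.
    by rewrite /u; field; rewrite gt_eqF// ltr_wpDr.
  have -> : - gpdf y - (gpdf y * - u ^+ 2 + u * (- y * gpdf y)) =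
    gpdf y * (u ^+ 2 + y * u - 1) by ring.
  rewrite pmulr_rle0 ?gpdf_gt0// yu.
  have : u ^+ 2 <= u by rewrite expr2 ler_piMl// ltW.
  by lra.
- rewrite -(subrr 0); apply: cvgB; first exact: cvg_gtail.
  apply: (@squeeze_cvgr _ _ _ _ (fun=> 0) (fun n => normal_peak 1 * expR (- (n%:R ^+ 2 / 2)))).
  + apply: nearW => n; rewrite mulr_ge0 ?invr_ge0 ?(ltW (gpdf_gt0 _)) ?addr_ge0//=.
    by rewrite ler_piMr ?(ltW (gpdf_gt0 _))// invf_le1 ?lerDl// ltr_wpDr.
  + exact: cvg_cst.
  + rewrite -(mulr0 (normal_peak 1)); apply: cvgMr; exact: cvg_gauss.
Qed.

End gaussian.

(** * Hermite functions and tilted bounds on Gaussian derivatives *)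

Section hermite.
Context {R : realType}.

(* [psi l] is the [l]-th derivative of the Gaussian tail, given by the Hermite
   recurrence; this makes [dens l] solve the backward heat equation. *)
Fixpoint psi (l : nat) (t : R) : R :=
  match l with
  | 0 => gtail t
  | l1.+1 => match l1 with
             | 0 => - gpdf t
             | l2.+1 => - t * psi l1 t - l2%:R * psi l2 t
             end
  end.

Lemma psiSS l t : psi l.+2 t = - t * psi l.+1 t - l%:R * psi l t.
Proof. by []. Qed.

Lemma is_derive_psi l (t : R) : is_derive t 1 (psi l) (psi l.+1 t).
Proof.
suff [//] : (is_derive t 1 (psi l) (psi l.+1 t) *
             is_derive t 1 (psi l.+1) (psi l.+2 t))%type.
elim: l => [|l [IH1 IH2]].
  split; first exact: is_derive_gtail.
  have h := is_derive_gpdf t.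
  have -> : psi 2 t = - (- t * gpdf t) by rewrite psiSS /=; ring.
  exact: is_deriveN.
split => //.
have -> : psi l.+3 t = (- t * psi l.+2 t + psi l.+1 t * (- 1)) - l%:R * psi l.+1 t.
  by rewrite (psiSS l.+1) -natr1; ring.
have hN : is_derive t 1 (-%R : R -> R) (- 1) by exact: is_deriveNid.
exact: (is_deriveB (is_deriveM hN IH2) (is_deriveZ l%:R IH1)).
Qed.

(** Order 0 is left out because the tail tends to 1 at minus infinity. *)
Lemma psi_poly_bound l : exists2 C : R, 0 <= C &
  forall t, `|psi l.+1 t| <= C * (1 + `|t|) ^+ l * gpdf t.
Proof.
suff [//] : (exists2 C : R, 0 <= C &
    forall t, `|psi l.+1 t| <= C * (1 + `|t|) ^+ l * gpdf t) /\
  (exists2 C : R, 0 <= C &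
    forall t, `|psi l.+2 t| <= C * (1 + `|t|) ^+ l.+1 * gpdf t).
elim: l => [|l [[C1 C10 h1] [C2 C20 h2]]].
  split; exists 1 => // t.
    by rewrite expr0 !mul1r /= normrN ger0_norm// ltW// gpdf_gt0.
  rewrite psiSS /= mul0r subr0 mulrNN normrM (ger0_norm (ltW (gpdf_gt0 t))).
  by rewrite expr1 mul1r ler_wpM2r ?(ltW (gpdf_gt0 t))// lerDr.
split; first by exists C2.
exists (C2 + l.+1%:R * C1); first by rewrite addr_ge0// mulr_ge0.
move=> t; rewrite psiSS; apply: (le_trans (ler_normB _ _)).
rewrite !normrM normrN normr_nat.
have g0 := ltW (gpdf_gt0 t).
have p1 : 1 <= 1 + `|t| by rewrite lerDl.
have p0 : 0 <= 1 + `|t| by rewrite (le_trans _ p1).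
rewrite 2!mulrDl; apply: lerD.
  have -> : C2 * (1 + `|t|) ^+ l.+2 * gpdf t =
     (1 + `|t|) * (C2 * (1 + `|t|) ^+ l.+1 * gpdf t) by rewrite (exprS _ l.+1); ring.
  by apply: ler_pM => //; rewrite lerDr.
have -> : l.+1%:R * C1 * (1 + `|t|) ^+ l.+2 * gpdf t =
   l.+1%:R * (C1 * (1 + `|t|) ^+ l.+2 * gpdf t) by ring.
apply: ler_wpM2l => //; apply: (le_trans (h1 t)).
apply: (ler_wpM2r g0); apply: (ler_wpM2l C10).
by rewrite ler_weXn2l// leqW.
Qed.

(** Once the power is bounded by an exponential, the exponents compare by [(u - 2) ^ 2 >= 0]. *)
Lemma poly_gauss_le_exp l (u : R) : 0 <= u ->
  (1 + u) ^+ l.+1 * expR (- (u ^+ 2 / 2)) <= l.+1`!%:R * expR 3 * expR (- u).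
Proof.
move=> u0.
have h : (1 + u) ^+ l.+1 <= l.+1`!%:R * expR (1 + u) by apply: expR_ge_pow; rewrite addr_ge0.
apply: (le_trans (ler_wpM2r (expR_ge0 _) h)).
rewrite -!mulrA; apply: ler_wpM2l => //; rewrite -!expRD ler_expR.
have := sqr_ge0 (u - 2); have -> : (u - 2) ^+ 2 = u ^+ 2 - 4 * u + 4 by ring.
by lra.
Qed.

Lemma gpdf_shift (t mu : R) :
  gpdf (t + mu) = gpdf t * expR (- (mu * t) - mu ^+ 2 / 2).
Proof. by rewrite /gpdf -[RHS]mulrA -expRD; congr (_ * expR _); field. Qed.

Lemma gpdf_ge (t : R) : `|t| <= 1 -> gpdf 1 <= gpdf t.
Proof.
move=> t1; apply: ler_wpM2l; first exact: normal_peak_ge0.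
rewrite ler_expR lerN2 ler_pM2r ?invr_gt0// -[t ^+ 2]real_normK ?num_real//.
by rewrite lerXn2r ?nnegrE.
Qed.

(** Tilting the Gaussian by [mu] produces the last factor. As [1 + |t + mu| <= (1 + mu) (1 + |t|)],
    the polynomial in [t] is absorbed by the remaining Gaussian; settling for the decay
    [exp (- |t|)] leaves a kernel that a shift changes only by a constant factor. *)
Lemma psi_tilt_bound l : exists2 C : R, 0 <= C &
  forall t mu, 0 <= mu -> `|psi l.+1 (t + mu)| <=
    C * (1 + mu) ^+ l * expR (- `|t|) * expR (- (mu * t) - mu ^+ 2 / 2).
Proof.
have [C C0 h] := psi_poly_bound l.
exists (C * (l.+1`!%:R * expR 3)); first by rewrite !mulr_ge0 ?expR_ge0.
move=> t mu mu0; apply: (le_trans (h _)); rewrite gpdf_shift (mulrA _ (gpdf t)).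
apply: ler_wpM2r; first exact: expR_ge0.
have m1 : 0 <= 1 + mu by rewrite addr_ge0.
have t1 : 0 <= 1 + `|t| by rewrite addr_ge0.
apply: (@le_trans _ _ (C * ((1 + mu) ^+ l * (1 + `|t|) ^+ l.+1) * expR (- (t ^+ 2 / 2)))).
  rewrite -(mulrA C _ (gpdf t)) -(mulrA C _ (expR _)); apply: (ler_wpM2l C0).
  apply: (@le_trans _ _ ((1 + `|t + mu|) ^+ l * expR (- (t ^+ 2 / 2)))).
    apply: ler_wpM2l; first by rewrite exprn_ge0// addr_ge0.
    by rewrite /gpdf ler_piMl ?expR_ge0// normal_peak1_le1.
  apply: ler_wpM2r; first exact: expR_ge0.
  apply: (@le_trans _ _ (((1 + mu) * (1 + `|t|)) ^+ l)).
    rewrite lerXn2r ?nnegrE ?addr_ge0 ?mulr_ge0//.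
    have h1 := ler_normD t mu; rewrite (ger0_norm mu0) in h1.
    by have := mulr_ge0 mu0 (normr_ge0 t); lra.
  rewrite exprMn; apply: ler_wpM2l; first exact: exprn_ge0.
  by rewrite ler_weXn2l// lerDl.
have h2 := poly_gauss_le_exp l (normr_ge0 t).
rewrite real_normK ?num_real// in h2.
have -> : C * ((l.+1)`!%:R * expR 3) * (1 + mu) ^+ l * expR (- `|t|) =
  C * (1 + mu) ^+ l * ((l.+1)`!%:R * expR 3 * expR (- `|t|)) by ring.
have -> : C * ((1 + mu) ^+ l * (1 + `|t|) ^+ l.+1) * expR (- (t ^+ 2 / 2)) =
  C * (1 + mu) ^+ l * ((1 + `|t|) ^+ l.+1 * expR (- (t ^+ 2 / 2))) by ring.
by apply: ler_wpM2l h2; rewrite mulr_ge0// exprn_ge0.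
Qed.

Definition rho (s : R) : R := (Num.sqrt s)^-1.

(* [dens l s] is the [l]-th derivative of [y |-> P(N(0, s) > y)]; in particular
   [- dens 1 s] is the density of [N(0, s)]. *)
Definition dens (l : nat) (s y : R) : R := rho s ^+ l * psi l (y * rho s).

Lemma rho_gt0 s : 0 < s -> 0 < rho s.
Proof. by move=> s0; rewrite invr_gt0 sqrtr_gt0. Qed.

Lemma rhoK s : 0 < s -> rho s ^+ 2 * s = 1.
Proof.
by move=> s0; rewrite exprVn sqr_sqrtr ?(ltW s0)// mulVf// gt_eqF.
Qed.

Lemma rho_le s s' : 0 < s -> s <= s' -> rho s' <= rho s.
Proof.
move=> s0 ss'; have s'0 := lt_le_trans s0 ss'.
by rewrite lef_pV2 ?posrE ?sqrtr_gt0// ler_wsqrtr.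
Qed.

Lemma is_derive_dens_space l s (y : R) :
  is_derive y 1 (dens l s) (dens l.+1 s y).
Proof.
have h1 : is_derive y 1 (fun y : R => y * rho s) (rho s).
  by apply: is_derive_eq; rewrite /GRing.scale /= mulr1 mulr0 ?addr0 ?add0r.
have h2 : is_derive y 1 (psi l \o (fun y : R => y * rho s)) (psi l.+1 (y * rho s) * rho s).
  by apply: is_derive1_comp; exact: is_derive_psi.
have -> : dens l.+1 s y = rho s ^+ l * (psi l.+1 (y * rho s) * rho s).
  by rewrite /dens exprS; ring.
exact: (is_deriveZ (rho s ^+ l) h2).
Qed.

Lemma is_derive_rho (s : R) : 0 < s -> is_derive s 1 rho (- 2^-1 * rho s ^+ 3).
Proof.
move=> s0; have q0 : Num.sqrt s != 0 by rewrite gt_eqF// sqrtr_gt0.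
have h := is_deriveV q0 (is_derive1_sqrt s0).
have -> : - 2^-1 * rho s ^+ 3 = - (Num.sqrt s) ^- 2 *: (2 * Num.sqrt s)^-1.
  by rewrite /rho /GRing.scale /=; field.
exact: h.
Qed.

(** The term with [dens l.+2] is the heat equation, by the Hermite recurrence. The slope is [- lam]
    because an exponential tilt [lam] shifts the mean of a Gaussian of variance [tau] by
    [lam tau]. *)
Lemma is_derive_dens_line l s y lam (tau : R) : 0 < s + tau ->
  is_derive tau 1 (fun tau : R => dens l (s + tau) (y - lam * tau))
   (2^-1 * dens l.+2 (s + tau) (y - lam * tau)
    - lam * dens l.+1 (s + tau) (y - lam * tau)).
Proof.
move=> st0.
have h0 : is_derive tau 1 (fun tau : R => s + tau) 1.
  by rewrite -[X in is_derive _ _ _ X]add0r; exact: is_deriveD.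
have hr : is_derive tau 1 (rho \o (fun tau : R => s + tau)) (- 2^-1 * rho (s + tau) ^+ 3 * 1).
  by apply: is_derive1_comp; exact: is_derive_rho.
have hl : is_derive tau 1 (fun tau : R => y - lam * tau) (- lam).
  apply: is_derive_eq; rewrite /GRing.scale /=; ring.
have ht := is_deriveM hl hr.
have hp := @is_derive1_comp _ (psi l) _ _ _ _ (is_derive_psi l _) ht.
have hx := is_deriveX l hr.
have H := is_deriveM hx hp.
have fE : (fun tau : R => dens l (s + tau) (y - lam * tau)) =
  ((rho \o (fun tau : R => s + tau)) ^+ l *
     (psi l \o ((fun tau : R => y - lam * tau) * (rho \o (fun tau : R => s + tau))))).
  by apply/funext => u; rewrite /= fctE exprfctE.
rewrite fE; apply: is_derive_eq.
rewrite /dens psiSS exprfctE /=.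
set r := rho (s + tau); set A := y - lam * tau.
rewrite -/(psi l.+1) [in LHS]fctE /= -/r -/A.
move: (psi l.+1 (A * r)) (psi l (A * r)) => p1 p0.
rewrite /GRing.scale /= !exprS.
(* The derivative of [rho ^+ l] has exponent [l.-1], so [l = 0] is separate. *)
by case: l {hx hp H fE} => [|l] /=; rewrite ?exprS; field.
Qed.

(** This is [psi_tilt_bound] at [mu = lam / rho s]; each further derivative costs a factor
    [rho s + lam]. *)
Lemma dens_tilt_bound l : exists2 C : R, 0 <= C &
  forall s z lam, 0 < s -> 0 <= lam -> `|dens l.+1 s (z + lam * s)| <=
    C * (rho s * (rho s + lam) ^+ l) * expR (- (`|z| * rho s)) *
    expR (- (lam * z) - lam ^+ 2 * s / 2).
Proof.
have [C C0 h] := psi_tilt_bound l.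
exists C => // s z lam s0 lam0.
have r0 := rho_gt0 s0; have rK := rhoK s0.
set r := rho s in r0 rK *.
have rs : s * r = r^-1.
  by apply: (mulfI (lt0r_neq0 r0)); rewrite mulfV ?gt_eqF// -rK; ring.
have := h (z * r) (lam * r^-1) (mulr_ge0 lam0 (ltW (eqbRL (invr_gt0 _) r0))).
have -> : (z * r + lam * r^-1) = (z + lam * s) * r by rewrite -rs; ring.
rewrite /dens -/r (normrM (r ^+ l.+1)) normrX (gtr0_norm r0) => {}h.
apply: (le_trans (ler_wpM2l (exprn_ge0 _ (ltW r0)) h)).
rewrite le_eqVlt; apply/orP; left; apply/eqP.
have lE : lam ^+ 2 * s = (lam * r^-1) ^+ 2.
  have -> : (lam * r^-1) ^+ 2 = lam ^+ 2 * s * (r ^+ 2 * s) by rewrite -rs; ring.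
  by rewrite rK mulr1.
rewrite normrM (gtr0_norm r0).
have -> : lam * r^-1 * (z * r) = lam * z by field; rewrite gt_eqF.
rewrite lE.
have -> : (r + lam) ^+ l = r ^+ l * (1 + lam * r^-1) ^+ l.
  by rewrite -exprMn; congr (_ ^+ _); field; rewrite gt_eqF.
by rewrite exprS; ring.
Qed.

End hermite.

(** * Local expansions of the kernels in space and time *)

Section local_expansion.
Context {R : realType}.
Implicit Types s z lam x v y : R.

(** A Laplace kernel of width [sqrt s]. Unlike a Gaussian, it grows by at most [exp (rho s |x|)]
    under a shift by [x], which the exponential moments of a step can pay for. *)
Definition kap s z : R := expR (- (`|z| * rho s)).

Lemma kap_ge0 s z : 0 <= kap s z.
Proof. exact: expR_ge0. Qed.

Lemma kap_shift s z x : 0 < s -> kap s (z - x) <= expR (rho s * `|x|) * kap s z.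
Proof.
move=> s0; rewrite /kap -expRD ler_expR.
have r0 := ltW (rho_gt0 s0).
have := ler_wpM2r r0 (lerB_dist z x); rewrite mulrBl; lra.
Qed.

Lemma kap_le s s' z : 0 < s -> s <= s' -> kap s z <= kap s' z.
Proof.
move=> s0 ss'; rewrite /kap ler_expR lerN2; apply: ler_wpM2l => //.
exact: rho_le.
Qed.

Lemma dens_tilt_bounds n : exists2 C : R, 0 < C &
  forall l s z lam, (l <= n)%N -> 0 < s -> 0 <= lam ->
   `|dens l.+1 s (z + lam * s)| <=
    C * (rho s * (rho s + lam) ^+ l) * kap s z *
    expR (- (lam * z) - lam ^+ 2 * s / 2).
Proof.
elim: n => [|n [C C0 IH]].
  have [C C0 h] := @dens_tilt_bound R 0.
  exists (C + 1) => [|l s z lam]; first by rewrite ltr_wpDl.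
  rewrite leqn0 => /eqP -> s0 lam0; apply: (le_trans (h _ _ _ s0 lam0)).
  apply: (ler_wpM2r (expR_ge0 _)); apply: (ler_wpM2r (expR_ge0 _)).
  apply: ler_wpM2r; last by rewrite lerDl.
  by rewrite expr0 mulr1 ltW// rho_gt0.
have [C' C'0 h] := @dens_tilt_bound R n.+1.
exists (C + C') => [|l s z lam]; first by rewrite ltr_wpDr.
move=> ln s0 lam0; have r0 := ltW (rho_gt0 s0).
have p0 : 0 <= rho s * (rho s + lam) ^+ l by rewrite mulr_ge0// exprn_ge0// addr_ge0.
move: ln; rewrite leq_eqVlt => /orP[/eqP lE|ln].
  rewrite lE in p0 *; apply: (le_trans (h _ _ _ s0 lam0)).
  apply: (ler_wpM2r (expR_ge0 _)); apply: (ler_wpM2r (expR_ge0 _)).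
  by apply: (ler_wpM2r p0); rewrite lerDr ltW.
apply: (le_trans (IH _ _ _ _ ln s0 lam0)).
apply: (ler_wpM2r (expR_ge0 _)); apply: (ler_wpM2r (expR_ge0 _)).
by apply: (ler_wpM2r p0); rewrite lerDl.
Qed.

Lemma expR_sub1 (u : R) : `|expR u - 1| <= `|u| * expR `|u|.
Proof.
have [c hc] := mvt0 u (@is_derive_expR R); rewrite expR0 => ->.
rewrite normrM mulrC ler_wpM2l// ger0_norm ?expR_ge0// ler_expR.
exact: le_trans (ler_norm _) hc.
Qed.

Lemma expR_sub1D (u : R) : `|expR u - 1 - u| <= `|u| ^+ 2 * expR `|u|.
Proof.
have [c hc] := mvt0 u (@is_derive_expR R); rewrite expR0 => ->.
rewrite -[X in _ - X]mul1r -mulrBl normrM mulrC expr2 -mulrA ler_wpM2l//.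
apply: (le_trans (expR_sub1 c)); apply: ler_pM => //.
by rewrite ler_expR.
Qed.

(** Every error term has order three in [x] and carries four factors among [rho s] and [lam], at
    least two of them [rho s]. The factor [exp (lam x)] stays whole at order 0. *)
Lemma dens_tilted_taylor : exists2 C : R, 0 < C & forall s lam z x, 0 < s -> 0 <= lam ->
  `|expR (lam * x) * - dens 1 s (z - x) -
    (- dens 1 s z * expR (lam * x) + dens 2 s z * x +
     (lam * dens 2 s z - 2^-1 * dens 3 s z) * x ^+ 2)| <=
  C * (rho s ^+ 4 + lam * rho s ^+ 3 + lam ^+ 2 * rho s ^+ 2) * kap s z *
  (`|x| ^+ 3 * expR ((lam + rho s) * `|x|)).
Proof.
have [C C0 hC] := dens_tilt_bounds 3.
have {}hC l s z : (l <= 3)%N -> 0 < s ->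
    `|dens l.+1 s z| <= C * rho s ^+ l.+1 * kap s z.
  move=> l3 s0; have := hC l s z 0 l3 s0 (lexx 0).
  by rewrite !mul0r !addr0 oppr0 expr0n !mul0r subr0 expR0 mulr1 -exprS.
exists C => // s lam z x s0 lam0.
set r := rho s; have r0 : 0 <= r by exact/ltW/rho_gt0.
set k := kap s z; have k0 : 0 <= k by exact: kap_ge0.
pose E := expR (r * `|x|).
have E1 : 1 <= E by rewrite /E -expR0 ler_expR mulr_ge0.
set F := expR (lam * `|x|).
have F0 : 0 <= F by exact: expR_ge0.
have T3 : `|- dens 1 s (z - x) - - dens 1 s z - dens 2 s z * x -
    2^-1 * - dens 3 s z * x ^+ 2| <= C * r ^+ 4 * k * E * `|x| ^+ 3.
  have := @taylor3_bound R (fun x => - dens 1 s (z - x)) (fun x => dens 2 s (z - x))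
    (fun x => - dens 3 s (z - x)) (fun x => dens 4 s (z - x)) x (C * r ^+ 4 * k * E).
  rewrite !subr0; apply.
  - move=> y; have h := is_derive_dens_space 1 s (z - y).
    have hz : is_derive y 1 (fun y : R => z - y) (-1).
      by rewrite -[X in is_derive _ _ _ X]add0r; exact: is_deriveB.
    have -> : dens 2 s (z - y) = - (dens 2 s (z - y) * -1) by ring.
    by apply: is_deriveN; exact: (@is_derive1_comp _ (dens 1 s) (fun y : R => z - y)).
  - move=> y; have h := is_derive_dens_space 2 s (z - y).
    have hz : is_derive y 1 (fun y : R => z - y) (-1).
      by rewrite -[X in is_derive _ _ _ X]add0r; exact: is_deriveB.
    have -> : - dens 3 s (z - y) = dens 3 s (z - y) * -1 by ring.
    exact: (@is_derive1_comp _ (dens 2 s) (fun y : R => z - y)).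
  - move=> y; have h := is_derive_dens_space 3 s (z - y).
    have hz : is_derive y 1 (fun y : R => z - y) (-1).
      by rewrite -[X in is_derive _ _ _ X]add0r; exact: is_deriveB.
    have -> : dens 4 s (z - y) = - (dens 4 s (z - y) * -1) by ring.
    by apply: is_deriveN; exact: (@is_derive1_comp _ (dens 3 s) (fun y : R => z - y)).
  - move=> y yx; apply: (le_trans (hC 3 _ _ _ s0)) => //.
    rewrite -/r -(mulrA _ k E); apply: ler_wpM2l.
      by rewrite mulr_ge0 ?exprn_ge0// ltW.
    apply: (le_trans (kap_shift z y s0)); rewrite mulrC ler_wpM2l ?kap_ge0//.
    by rewrite ler_expR ler_wpM2l.
have T1 := expR_sub1 (lam * x); have T2 := expR_sub1D (lam * x).
rewrite normrM (ger0_norm lam0) -/F in T1 T2.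
have D2 := hC 1%N s z isT s0; have D3 := hC 2%N s z isT s0.
rewrite -/r -/k in D2 D3.
have Fx : expR (lam * x) <= F by rewrite /F ler_expR ler_wpM2l// ler_norm.
have -> : expR ((lam + r) * `|x|) = F * E by rewrite /F /E mulrDl expRD.
set d1 := dens 1 s (z - x) in T3 *; set d10 := dens 1 s z in T3 *.
move: T3 D2 D3; set d2 := dens 2 s z; set d3 := dens 3 s z => T3 D2 D3.
set t := expR (lam * x) in T1 T2 Fx *.
have t0 : 0 <= t by exact: expR_ge0.
(* The Taylor error of the density keeps the full [exp (lam x)]; at orders 1 and 2 only remainders
   of the exponential are left. *)
have -> : t * - d1 - (- d10 * t + d2 * x + (lam * d2 - 2^-1 * d3) * x ^+ 2) =
  t * (- d1 - - d10 - d2 * x - 2^-1 * - d3 * x ^+ 2) +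
  (d2 * x * (t - 1 - lam * x) - 2^-1 * d3 * x ^+ 2 * (t - 1)) by ring.
have X0 : 0 <= `|x| by [].
set X := `|x| in T1 T2 T3 X0 *.
have xX : `|x ^+ 2| = X ^+ 2 by rewrite normrX.
apply: (le_trans (ler_normD _ _)).
have B1 : `|t * (- d1 - - d10 - d2 * x - 2^-1 * - d3 * x ^+ 2)| <=
    F * (C * r ^+ 4 * k * E * X ^+ 3).
  by rewrite normrM (ger0_norm t0); apply: ler_pM.
have B2 : `|d2 * x * (t - 1 - lam * x)| <=
    (C * r ^+ 2 * k) * X * ((lam * X) ^+ 2 * (F * E)).
  have a : `|d2 * x| <= C * r ^+ 2 * k * X by rewrite normrM; apply: ler_pM.
  rewrite normrM; apply: ler_pM => //.
  apply: (le_trans T2); apply: ler_wpM2l; first by rewrite exprn_ge0// mulr_ge0.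
  by rewrite ler_peMr.
have B3 : `|2^-1 * d3 * x ^+ 2 * (t - 1)| <=
    (C * r ^+ 3 * k) * X ^+ 2 * ((lam * X) * (F * E)).
  have a : `|2^-1 * d3| <= C * r ^+ 3 * k.
    rewrite normrM; apply: le_trans D3; apply: ler_piMl => //.
    by rewrite ger0_norm ?invr_ge0// invf_le1// ler1n.
  have b : `|2^-1 * d3 * x ^+ 2| <= C * r ^+ 3 * k * X ^+ 2.
    by rewrite normrM xX; apply: ler_wpM2r => //; rewrite exprn_ge0.
  rewrite normrM; apply: ler_pM => //.
  apply: (le_trans T1); apply: ler_wpM2l; first by rewrite mulr_ge0.
  by rewrite ler_peMr.
have B4 := ler_normB (d2 * x * (t - 1 - lam * x)) (2^-1 * d3 * x ^+ 2 * (t - 1)).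
apply: (le_trans (lerD B1 (le_trans B4 (lerD B2 B3)))).
rewrite le_eqVlt; apply/orP; left; apply/eqP; ring.
Qed.

Lemma kap_line s z lam tau v : 0 < s -> 0 <= lam -> 0 <= tau <= v ->
  kap (s + tau) (z - lam * tau) <= expR (lam * v * rho s) * kap (s + v) z.
Proof.
move=> s0 lam0 /andP[t0 tv]; have st0 : 0 < s + tau by rewrite ltr_wpDr.
have r1 : rho (s + v) <= rho (s + tau) by apply: rho_le => //; rewrite lerD2l.
have r2 : rho (s + tau) <= rho s by apply: rho_le => //; rewrite lerDl.
apply: (le_trans (kap_le _ st0 (_ : s + tau <= s + v))); first by rewrite lerD2l.
have sv0 : 0 < s + v by rewrite ltr_wpDr// (le_trans t0).
apply: (le_trans (kap_shift _ _ sv0)); apply: ler_wpM2r; first exact: kap_ge0.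
rewrite ler_expR mulrC ger0_norm ?mulr_ge0//; apply: ler_pM => //.
- by rewrite mulr_ge0.
- exact/ltW/rho_gt0.
- exact: ler_wpM2l.
- exact: le_trans r2.
Qed.

(** The coefficient of [v] is that of [x ^ 2] in [dens_tilted_taylor]: a step of conditional
    variance [v] and a Gaussian of that variance, drifted by [lam v], agree up to the remainders. *)
Lemma dens_line_taylor : exists2 C : R, 0 < C & forall s lam z v, 0 < s -> 0 <= lam -> 0 <= v ->
  `|- dens 1 (s + v) (z - lam * v) -
    (- dens 1 s z + v * (lam * dens 2 s z - 2^-1 * dens 3 s z))| <=
  C * (rho s ^+ 5 + lam * rho s ^+ 4 + lam ^+ 2 * rho s ^+ 3) *
  (expR (lam * v * rho s) * kap (s + v) z) * v ^+ 2.
Proof.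
have [C C0 hC] := dens_tilt_bounds 4.
have {}hC l s z : (l <= 4)%N -> 0 < s ->
    `|dens l.+1 s z| <= C * rho s ^+ l.+1 * kap s z.
  move=> l4 s0; have := hC l s z 0 l4 s0 (lexx 0).
  by rewrite !mul0r !addr0 oppr0 expr0n !mul0r subr0 expR0 mulr1 -exprS.
exists C => // s lam z v s0 lam0 v0.
set r := rho s; have r0 : 0 <= r by exact/ltW/rho_gt0.
set k := expR _ * _; have k0 : 0 <= k by rewrite mulr_ge0 ?expR_ge0.
pose L l tau := dens l (s + tau) (z - lam * tau).
have dL l (y : R) : 0 <= y <= v ->
    is_derive y 1 (L l) (2^-1 * L l.+2 y - lam * L l.+1 y).
  move=> /andP[y0 _]; apply: is_derive_dens_line.
  by rewrite ltr_wpDr.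
have Lb l tau : (l <= 4)%N -> 0 <= tau <= v -> `|L l.+1 tau| <= C * r ^+ l.+1 * k.
  move=> l4 tv; have /andP[t0 _] := tv.
  have st0 : 0 < s + tau by rewrite ltr_wpDr.
  apply: (le_trans (hC _ _ _ l4 st0)); apply: ler_pM.
  - by rewrite mulr_ge0 ?(ltW C0)// exprn_ge0// ltW// rho_gt0.
  - exact: kap_ge0.
  - apply: ler_wpM2l; first exact: ltW.
    rewrite lerXn2r ?nnegrE ?(ltW (rho_gt0 st0))//.
    by apply: rho_le => //; rewrite lerDl.
  - exact: kap_line.
have := @taylor2_bound R (fun tau => - L 1 tau)
  (fun tau => lam * L 2 tau - 2^-1 * L 3 tau)
  (fun tau => lam * (2^-1 * L 4 tau - lam * L 3 tau) -
     2^-1 * (2^-1 * L 5 tau - lam * L 4 tau)) 0 v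
  (C * (r ^+ 5 + lam * r ^+ 4 + lam ^+ 2 * r ^+ 3) * k) v0.
rewrite /L add0r !addr0 !mulr0 !subr0 -/(L _ _) opprD addrA; apply.
- move=> y hy; have h := dL 1 y hy.
  have -> : lam * L 2 y - 2^-1 * L 3 y = - (2^-1 * L 3 y - lam * L 2 y) by ring.
  exact: is_deriveN.
- move=> y hy; have h2 := dL 2 y hy; have h3 := dL 3 y hy.
  exact: (is_deriveB (is_deriveZ lam h2) (is_deriveZ 2^-1 h3)).
- move=> y hy; have b3 := Lb 2 y isT hy; have b4 := Lb 3 y isT hy.
  have b5 := Lb 4 y isT hy.
  move: b3 b4 b5; rewrite -/(L 3 y) -/(L 4 y) -/(L 5 y).
  move: (L 3 y) (L 4 y) (L 5 y) => d3 d4 d5 b3 b4 b5.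
  have -> : lam * (2^-1 * d4 - lam * d3) - 2^-1 * (2^-1 * d5 - lam * d4) =
    lam * d4 - (lam ^+ 2 * d3 + 4^-1 * d5) by field.
  apply: (le_trans (ler_normB _ _)).
  apply: (le_trans (lerD (lexx _) (ler_normD _ _))).
  rewrite (normrM (lam ^+ 2)) (ger0_norm (sqr_ge0 lam)) (normrM lam) (ger0_norm lam0) (normrM 4^-1).
  have -> : `|4^-1 : R| = 4^-1 by rewrite ger0_norm.
  have h4 := ler_wpM2l lam0 b4; have h3 := ler_wpM2l (sqr_ge0 lam) b3.
  have h5 : 4^-1 * `|d5| <= C * r ^+ 5 * k.
    by apply: le_trans b5; apply: ler_piMl => //; lra.
  apply: (le_trans (lerD h4 (lerD h3 h5))).
  rewrite le_eqVlt; apply/orP; left; apply/eqP; ring.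
Qed.

(** The expansion does not involve [lam]; the tilt only records the decay of the third derivative,
    in a form that recombines with the weight [exp (lam M)]. *)
Lemma tail_tilted_taylor : exists2 C : R, 0 < C & forall s lam y x, 0 < s -> 0 <= lam ->
  `|dens 0 s (y - x) - (dens 0 s y + - dens 1 s y * x + 2^-1 * dens 2 s y * x ^+ 2)| <=
  C * (rho s * (rho s + lam) ^+ 2) * kap s (y - lam * s) *
   expR (- (lam * y) + lam ^+ 2 * s / 2) *
  (`|x| ^+ 3 * expR ((lam + rho s) * `|x|)).
Proof.
have [C C0 hC] := dens_tilt_bounds 2.
exists C => // s lam y x s0 lam0.
set r := rho s; have r0 : 0 <= r by exact/ltW/rho_gt0.
have rl0 : 0 <= C * (r * (r + lam) ^+ 2).
  by rewrite mulr_ge0 ?(ltW C0)// mulr_ge0// exprn_ge0// addr_ge0.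
set A := C * _; set k := kap _ _; set e := expR (- (lam * y) + _).
have := @taylor3_bound R (fun x => dens 0 s (y - x)) (fun x => - dens 1 s (y - x))
    (fun x => dens 2 s (y - x)) (fun x => - dens 3 s (y - x)) x
    (A * k * e * expR ((lam + r) * `|x|)).
rewrite !subr0.
have -> : A * k * e * expR ((lam + r) * `|x|) * `|x| ^+ 3 =
  A * k * e * (`|x| ^+ 3 * expR ((lam + r) * `|x|)) by ring.
rewrite !opprD !addrA; apply.
- move=> u; have h := is_derive_dens_space 0 s (y - u).
  have hz : is_derive u 1 (fun u : R => y - u) (-1).
    by rewrite -[X in is_derive _ _ _ X]add0r; exact: is_deriveB.
  have -> : - dens 1 s (y - u) = dens 1 s (y - u) * -1 by ring.
  exact: (@is_derive1_comp _ (dens 0 s) (fun u : R => y - u)).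
- move=> u; have h := is_derive_dens_space 1 s (y - u).
  have hz : is_derive u 1 (fun u : R => y - u) (-1).
    by rewrite -[X in is_derive _ _ _ X]add0r; exact: is_deriveB.
  have -> : dens 2 s (y - u) = - (dens 2 s (y - u) * -1) by ring.
  by apply: is_deriveN; exact: (@is_derive1_comp _ (dens 1 s) (fun u : R => y - u)).
- move=> u; have h := is_derive_dens_space 2 s (y - u).
  have hz : is_derive u 1 (fun u : R => y - u) (-1).
    by rewrite -[X in is_derive _ _ _ X]add0r; exact: is_deriveB.
  have -> : - dens 3 s (y - u) = dens 3 s (y - u) * -1 by ring.
  exact: (@is_derive1_comp _ (dens 2 s) (fun u : R => y - u)).
- move=> u ux; rewrite normrN.
  have := hC 2%N s (y - u - lam * s) lam isT s0 lam0.
  rewrite subrK -/r => h; apply: (le_trans h).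
  have -> : y - u - lam * s = y - lam * s - u by ring.
  have h1 := kap_shift (y - lam * s) u s0; rewrite -/r -/k in h1.
  have h2 : expR (- (lam * (y - lam * s - u)) - lam ^+ 2 * s / 2) <= e * expR (lam * `|x|).
    rewrite -expRD ler_expR.
    have := ler_wpM2l lam0 (le_trans (ler_norm u) ux); lra.
  rewrite -/A -!(mulrA A); apply: ler_wpM2l => //.
  have -> : expR ((lam + r) * `|x|) = expR (lam * `|x|) * expR (r * `|x|).
    by rewrite -expRD mulrDl.
  have h3 : kap s (y - lam * s - u) <= k * expR (r * `|x|).
    apply: (le_trans h1); rewrite mulrC; apply: ler_wpM2l; first exact: kap_ge0.
    by rewrite ler_expR ler_wpM2l.
  apply: (le_trans (ler_pM (kap_ge0 _ _) (expR_ge0 _) h3 h2)).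
  rewrite le_eqVlt; apply/orP; left; apply/eqP; ring.
Qed.

(** By the heat equation the coefficient of [v] is that of [x ^ 2] in [tail_tilted_taylor], so the
    second-order terms cancel in the telescoping sum. *)
Lemma tail_time_taylor : exists2 C : R, 0 < C & forall s lam y v, 0 < s -> 0 <= lam -> 0 <= v ->
  `|dens 0 (s + v) y - (dens 0 s y + v * (2^-1 * dens 2 s y))| <=
  C * (rho s * (rho s + lam) ^+ 3) * (expR (lam * v * rho s) * kap (s + v) (y - lam * s)) *
   expR (- (lam * y) + lam ^+ 2 * (s + v) / 2) * v ^+ 2.
Proof.
have [C C0 hC] := dens_tilt_bounds 3.
exists C => // s lam y v s0 lam0 v0.
set r := rho s; have r0 : 0 <= r by exact/ltW/rho_gt0.
set A := C * _; set k := expR (lam * v * r) * _; set e := expR (- (lam * y) + _).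
have dL l (u : R) : 0 <= u <= v ->
    is_derive u 1 (fun u => dens l (s + u) y) (2^-1 * dens l.+2 (s + u) y).
  move=> /andP[u0 _].
  have := @is_derive_dens_line R l s y 0 u (ltr_wpDr u0 s0).
  rewrite !mul0r !subr0; under [in X in X -> _]eq_fun do rewrite mul0r subr0.
  by [].
have := @taylor2_bound R (fun u => dens 0 (s + u) y)
  (fun u => 2^-1 * dens 2 (s + u) y)
  (fun u => 2^-1 * (2^-1 * dens 4 (s + u) y)) 0 v (A * k * e) v0.
rewrite add0r !addr0 opprD addrA; apply.
- by move=> u hu; have h := dL 2 u hu; exact: (is_deriveZ 2^-1 h).
- move=> u hu; have /andP[u0 uv] := hu.
  have su0 : 0 < s + u by rewrite ltr_wpDr.
  rewrite mulrA normrM ger0_norm ?mulr_ge0 ?invr_ge0//.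
  apply: (le_trans (ler_piMl _ _)) => //; first by lra.
  have := hC 3%N (s + u) (y - lam * (s + u)) lam isT su0 lam0.
  rewrite subrK => h; apply: (le_trans h).
  have rr : rho (s + u) <= r by apply: rho_le => //; rewrite lerDl.
  have ru0 := ltW (rho_gt0 su0).
  have q1 : 0 <= C * (rho (s + u) * (rho (s + u) + lam) ^+ 3).
    apply: mulr_ge0; first exact: ltW.
    by apply: mulr_ge0 => //; rewrite exprn_ge0// addr_ge0.
  rewrite /A /k /e; apply: ler_pM.
  + by rewrite mulr_ge0 ?kap_ge0.
  + exact: expR_ge0.
  + apply: ler_pM.
    * exact: q1.
    * exact: kap_ge0.
    * apply: ler_wpM2l; first exact: ltW.
      apply: ler_pM => //; first by rewrite exprn_ge0// addr_ge0.
      by rewrite lerXn2r ?nnegrE ?addr_ge0// lerD2r.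
    * have -> : y - lam * (s + u) = (y - lam * s) - lam * u by ring.
      exact: kap_line.
  + rewrite ler_expR.
    have := ler_wpM2l (sqr_ge0 lam) uv; lra.
Qed.

End local_expansion.

Section measurability.
Context {R : realType}.

Lemma is_derive_measurable (f df : R -> R) : (forall x : R, is_derive x 1 f (df x)) ->
  measurable_fun setT f.
Proof.
move=> h; apply: continuous_measurable_fun => x.
by apply/differentiable_continuous/derivable1_diffP; case: (h x).
Qed.

Lemma measurable_dens l (s : R) : measurable_fun setT (dens l s).
Proof. exact: is_derive_measurable (is_derive_dens_space l s). Qed.

Lemma measurable_dens_shift l (s z : R) : measurable_fun setT (fun m : R => dens l s (z - m)).
Proof.
apply: measurableT_comp; first exact: measurable_dens.
exact: measurable_funB.
Qed.

Lemma measurable_kap_shift (s z : R) : measurable_fun setT (fun m : R => kap s (z - m)).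
Proof.
rewrite /kap; under eq_fun do rewrite -mulrN.
apply: measurableT_comp => //; apply: measurable_funM => //.
by apply: measurableT_comp => //; exact: measurable_funB.
Qed.

Lemma measurable_expRM (lam : R) : measurable_fun setT (fun m : R => expR (lam * m)).
Proof. by apply: measurableT_comp => //; exact: measurable_funM. Qed.

Lemma kap_le1 (s z : R) : 0 < s -> kap s z <= 1.
Proof. by move=> s0; rewrite /kap -expR0 ler_expR oppr_le0 mulr_ge0// ltW// rho_gt0. Qed.

End measurability.

(** * Propagation of the tilted density bound *)

Section kernel_domination.
Context {d : measure_display} {T : measurableType d} {R : realType}.
Variable P : probability T R.

Local Notation integ := (integ P).
Local Notation Ex := (Ex P).

Lemma integ_weight (W M : T -> R) (h : R -> R) (c : R) :
  integ W -> (forall w, 0 <= W w) -> measurable_fun setT M -> measurable_fun setT h ->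
  (forall m, `|h m| <= c) -> integ (fun w => W w * h (M w)).
Proof.
move=> iW W0 mM mh hc; apply: integ_dom (integ_scale c iW) _.
  by apply: measurable_funM; [exact: integ_mfun iW|exact: measurableT_comp].
by move=> w; rewrite normrM (ger0_norm (W0 w)) mulrC; apply: ler_wpM2r.
Qed.

Lemma integ_weight_kap (W M : T -> R) (s z : R) : 0 < s ->
  integ W -> (forall w, 0 <= W w) -> measurable_fun setT M ->
  integ (fun w => W w * kap s (z - M w)).
Proof.
move=> s0 iW W0 mM.
apply: (integ_weight (h := fun m => kap s (z - m)) (c := 1)) => //.
  exact: measurable_kap_shift.
by move=> m; rewrite ger0_norm ?kap_ge0// kap_le1.
Qed.

Lemma dens_bounded l (s : R) : 0 < s -> exists c, forall y, `|dens l.+1 s y| <= c.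
Proof.
move=> s0; have [C C0 h] := @dens_tilt_bounds R l.
exists (C * (rho s * rho s ^+ l)) => y.
have := h l s y 0 (leqnn l) s0 (lexx 0).
rewrite !mul0r !addr0 oppr0 expr0n !mul0r subr0 expR0 mulr1.
move=> /le_trans; apply; apply: ler_piMr (kap_le1 y s0).
apply: mulr_ge0; first exact: ltW.
by apply: mulr_ge0; [|apply: exprn_ge0]; exact/ltW/rho_gt0.
Qed.

Lemma integ_weight_dens (W M : T -> R) l (s z : R) : 0 < s ->
  integ W -> (forall w, 0 <= W w) -> measurable_fun setT M ->
  integ (fun w => W w * dens l.+1 s (z - M w)).
Proof.
move=> s0 iW W0 mM; have [c hc] := dens_bounded l s0.
apply: (integ_weight (h := fun m => dens l.+1 s (z - m)) (c := c)) => //.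
exact: measurable_dens_shift.
Qed.

Lemma integ_weight_densN (W M : T -> R) l (s z : R) : 0 < s ->
  integ W -> (forall w, 0 <= W w) -> measurable_fun setT M ->
  integ (fun w => W w * - dens l.+1 s (z - M w)).
Proof.
move=> s0 iW W0 mM.
by apply: integ_ext (integ_opp (integ_weight_dens l z s0 iW W0 mM)) => w; rewrite mulrN.
Qed.

Lemma dens1E (s y : R) : - dens 1 s y = rho s * gpdf (y * rho s).
Proof. by rewrite /dens expr1 /= mulrN opprK. Qed.

(* Outside of [|z| <= 1] (in units of the kernel width) the double exponential
   is dominated by e^-1 times the sum of its two translates, and 2/e < 1. *)
Lemma kap_domination (s z : R) : 0 < s ->
  kap s z <= (gpdf 1 * rho s)^-1 * - dens 1 s z +
    expR (- 1) * (kap s (z - (rho s)^-1) + kap s (z + (rho s)^-1)).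
Proof.
move=> s0; have r0 := rho_gt0 s0; have g0 := @gpdf_gt0 R 1.
rewrite dens1E.
have -> : (gpdf 1 * rho s)^-1 * (rho s * gpdf (z * rho s)) = gpdf (z * rho s) / gpdf 1.
  by field; rewrite !gt_eqF.
have E u : kap s u = expR (- `|u * rho s|) by rewrite /kap normrM (gtr0_norm r0).
rewrite !E; have -> : (z - (rho s)^-1) * rho s = z * rho s - 1 by field; rewrite gt_eqF.
have -> : (z + (rho s)^-1) * rho s = z * rho s + 1 by field; rewrite gt_eqF.
set t := z * rho s.
have q0 : 0 <= gpdf t / gpdf 1 by rewrite divr_ge0// ltW// gpdf_gt0.
have [t1|t1] := leP `|t| 1.
  apply: (@le_trans _ _ (gpdf t / gpdf 1)); last first.
    by rewrite lerDl mulr_ge0 ?addr_ge0 ?expR_ge0.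
  apply: (@le_trans _ _ 1); first by rewrite expR_le1 oppr_le0.
  by rewrite ler_pdivlMr// mul1r gpdf_ge.
apply: (@le_trans _ _ (expR (- 1) * (expR (- `|t - 1|) + expR (- `|t + 1|)))).
  rewrite mulrDr -!expRD; have [t0|t0] := ler0P t.
    apply: (@le_trans _ _ (expR (- 1 + - `|t + 1|))); last by rewrite lerDr expR_ge0.
    rewrite ler_expR (ler0_norm t0) in t1 *.
    by rewrite ler0_norm; lra.
  apply: (@le_trans _ _ (expR (- 1 + - `|t - 1|))); last by rewrite lerDl expR_ge0.
  rewrite ler_expR (gtr0_norm t0) in t1 *.
  by rewrite ger0_norm; lra.
by rewrite lerDr.
Qed.

Lemma expRN1_lt_half : expR (- 1) < 2^-1 :> R.
Proof.
rewrite expRN ltf_pV2 ?posrE ?expR_gt0//.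
by have := @expR_gt1Dx R 1 (oner_neq0 _); rewrite [1 + 1](_ : _ = 2).
Qed.

(* The supremum over [z] of the left-hand side is finite and, by
   [kap_domination], at most the wanted bound plus [2 / e < 1] times itself. *)
Lemma kap_of_dens (W M : T -> R) (s a : R) : 0 < s ->
  integ W -> (forall w, 0 <= W w) -> measurable_fun setT M ->
  (forall z : R, Ex (fun w => W w * - dens 1 s (z - M w)) <= a) ->
  forall z : R, Ex (fun w => W w * kap s (z - M w)) <=
    a / (gpdf 1 * (1 - 2 * expR (- 1))) / rho s.
Proof.
move=> s0 iW W0 mM ha.
have r0 := rho_gt0 s0; have g0 := @gpdf_gt0 R 1; have e1 := expRN1_lt_half.
pose F (z : R) := Ex (fun w => W w * kap s (z - M w)).
have ik (z : R) : integ (fun w => W w * kap s (z - M w)) by exact: integ_weight_kap.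
have FW (z : R) : F z <= Ex W.
  apply: Ex_le => // w; apply: ler_piMr => //; exact: kap_le1.
have hs : has_sup (range F).
  split; first by exists (F 0); exists 0.
  by exists (Ex W) => _ [z _ <-].
set S := sup (range F).
have FS (z : R) : F z <= S by apply: sup_upper_bound => //; exists z.
pose A := (gpdf 1 * rho s)^-1 * a.
have step (z : R) : F z <= A + 2 * expR (- 1) * S.
  have i0 := integ_weight_densN 0%N z s0 iW W0 mM.
  have i1 := integ_scale (gpdf 1 * rho s)^-1 i0.
  have i2 := integ_add (ik (z - (rho s)^-1)) (ik (z + (rho s)^-1)).
  have i23 := integ_scale (expR (- 1)) i2.
  apply: (@le_trans _ _ (Ex (fun w => (gpdf 1 * rho s)^-1 * (W w * - dens 1 s (z - M w)) +
     expR (- 1) * (W w * kap s (z - (rho s)^-1 - M w) +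
             W w * kap s (z + (rho s)^-1 - M w))))).
    apply: Ex_le => //; first exact: integ_add.
    move=> w; have := ler_wpM2l (W0 w) (kap_domination (z - M w) s0).
    have -> : z - M w - (rho s)^-1 = z - (rho s)^-1 - M w by ring.
    have -> : z - M w + (rho s)^-1 = z + (rho s)^-1 - M w by ring.
    by move=> /le_trans; apply; rewrite le_eqVlt; apply/orP; left; apply/eqP; ring.
  rewrite (Ex_add i1 i23) (Ex_scale _ i0) (Ex_scale _ i2) (Ex_add (ik _) (ik _)).
  apply: lerD.
    by apply: ler_wpM2l => //; rewrite invr_ge0 mulr_ge0// ltW.
  rewrite mulrAC (mulrC (2 * S)); apply: ler_wpM2l; first exact: expR_ge0.
  by rewrite mulr_natl mulr2n; apply: lerD; exact: FS.
have SA : S <= A + 2 * expR (- 1) * S.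
  by apply: ge_sup => [|_ [z _ <-]]; [case: hs|exact: step].
move=> z; apply: (le_trans (FS z)).
have c0 : 0 < 1 - 2 * expR (- 1) :> R by lra.
have -> : a / (gpdf 1 * (1 - 2 * expR (- 1))) / rho s = A / (1 - 2 * expR (- 1)).
  by rewrite /A; field; rewrite !gt_eqF.
by rewrite ler_pdivlMr//; lra.
Qed.

End kernel_domination.

(** * One step of the tilted density bound *)

Section density_step.
Context {R : realType}.

(* The Bernstein bound on the logarithmic moment generating function at [lam],
   per unit of conditional variance. *)
Definition tilt_exp (lam e : R) : R := lam ^+ 2 / (2 * (1 - lam * e)).

Lemma tilt_exp_bounds (lam e : R) : 0 <= lam -> 0 < e -> lam * e <= 8^-1 ->
  lam ^+ 2 / 2 <= tilt_exp lam e <= lam ^+ 2.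
Proof.
move=> lam0 e0 le8; have le0 : 0 <= lam * e by rewrite mulr_ge0// ltW.
have p0 : 0 < 2 * (1 - lam * e) by lra.
have l2 := sqr_ge0 lam.
rewrite /tilt_exp; apply/andP; split.
  by apply: ler_wpM2l => //; rewrite lef_pV2 ?posrE//; lra.
by rewrite ler_pdivrMr//; apply: ler_peMr => //; lra.
Qed.

Lemma rho_double (s v : R) : 0 < s -> 0 <= v <= 3 * s -> rho s <= 2 * rho (s + v).
Proof.
move=> s0 /andP[v0 vs]; have sv0 : 0 < s + v by rewrite ltr_wpDr.
have h : Num.sqrt (s + v) <= 2 * Num.sqrt s.
  have -> : 2 * Num.sqrt s = Num.sqrt (2 ^+ 2 * s).
    by rewrite sqrtrM ?sqr_ge0// sqrtr_sqr ger0_norm.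
  by apply: ler_wsqrtr; lra.
have q0 : 0 < Num.sqrt s by rewrite sqrtr_gt0.
have q1 : 0 < Num.sqrt (s + v) by rewrite sqrtr_gt0.
by rewrite /rho -[leLHS]mul1r ler_pdivrMr// mulrAC ler_pdivlMr// mul1r.
Qed.

(** The scalar core of [density_step] at a fixed value of [M]: [r] is [rho s], [E] the weight, [L]
    is [tilt_exp], [b] and [q] are the densities at variances [s] and [s + v], [d2] and [d3] space
    derivatives, [k] and [k'] Laplace kernels. Since [r v] and [lam v] are at most [2 e], every term
    of order two in [v] becomes a multiple of [e v]. *)
Lemma density_step_pointwise (c C1 C2 C3 r e v lam L E b q d2 d3 k k' : R) :
  let Q := r ^+ 4 + lam * r ^+ 3 + lam ^+ 2 * r ^+ 2 in
  0 < c -> 0 < C1 -> 0 < C2 -> 0 < C3 -> 0 <= r -> 0 < e -> 0 <= v -> 0 <= lam ->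
  v <= 12 * e ^+ 2 -> e * r <= 8^-1 -> lam * e <= 8^-1 ->
  0 <= L -> L <= lam ^+ 2 -> 0 <= E -> 0 <= k -> k <= k' ->
  `|q - (b + v * (lam * d2 - 2^-1 * d3))| <=
    C2 * (r ^+ 5 + lam * r ^+ 4 + lam ^+ 2 * r ^+ 3) *
    (expR (lam * v * r) * k') * v ^+ 2 ->
  `|d2| <= C3 * (r * r ^+ 1) * k -> `|d3| <= C3 * (r * r ^+ 2) * k ->
  (1 + L * v) * (E * b) + v * (E * (lam * d2 - 2^-1 * d3)) +
     c * e * v * (C1 * Q * (E * k)) <=
  (1 + L * v) * (E * q) + (4 * C2 * expR 1 + 2 * C3 + c * C1) * Q * (e * v) * (E * k').
Proof.
move=> Q cc0 C10 C20 C30 r_ge0 e0 v0 lam0 ve er le8 L0 L2 EE k0 hkk h2 hd2 hd3.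
have k'0 := le_trans k0 hkk; have e_ge0 := ltW e0.
have Q0 : 0 <= Q.
  rewrite /Q addr_ge0 ?addr_ge0 ?exprn_ge0// mulr_ge0 ?exprn_ge0//.
have ev0 : 0 <= e * v by rewrite mulr_ge0.
have rv : r * v <= 2 * e.
  apply: (le_trans (ler_wpM2l r_ge0 ve)).
  have -> : r * (12 * e ^+ 2) = 12 * (e * r) * e by ring.
  by apply: ler_wpM2r => //; lra.
have lv : lam * v <= 2 * e.
  apply: (le_trans (ler_wpM2l lam0 ve)).
  have -> : lam * (12 * e ^+ 2) = 12 * (lam * e) * e by ring.
  by apply: ler_wpM2r => //; lra.
have lvr : lam * v * r <= 1.
  apply: (le_trans (ler_wpM2r r_ge0 lv)); rewrite -mulrA; lra.
have Lv0 : 0 <= L * v by rewrite mulr_ge0.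
have Lv1 : L * v <= 1.
  apply: (le_trans (ler_wpM2r v0 L2)); rewrite expr2 -mulrA.
  apply: (le_trans (ler_wpM2l lam0 lv)).
  have -> : lam * (2 * e) = 2 * (lam * e) by ring.
  by lra.
have X1 : b + v * (lam * d2 - 2^-1 * d3) <= q + 2 * C2 * expR 1 * Q * (e * v) * k'.
  have {}h2 := le_trans (ler_norm _) (eq_ind _ (fun u => is_true (u <= _)) h2 _ (distrC _ _)).
  rewrite -lerBlDl; apply: (le_trans h2).
  have -> : C2 * (r ^+ 5 + lam * r ^+ 4 + lam ^+ 2 * r ^+ 3) *
    (expR (lam * v * r) * k') * v ^+ 2 =
    (C2 * Q * v * k') * ((r * v) * expR (lam * v * r)) by rewrite /Q; ring.
  have -> : 2 * C2 * expR 1 * Q * (e * v) * k' =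
    (C2 * Q * v * k') * ((2 * e) * expR 1) by ring.
  apply: ler_wpM2l.
    by apply: mulr_ge0 => //; apply: mulr_ge0 => //; apply: mulr_ge0 => //; exact: ltW.
  by apply: ler_pM; rewrite ?expR_ge0 ?mulr_ge0// ler_expR.
(* The cross term between [1 + L v] and the first-order part; [L <= lam ^ 2] supplies the factor
   [lam v <= 2 e]. *)
have X2 : L * v ^+ 2 * `|lam * d2 - 2^-1 * d3| <= 2 * C3 * Q * (e * v) * k'.
  have hF : `|lam * d2 - 2^-1 * d3| <= C3 * (lam * r ^+ 2 + r ^+ 3) * k'.
    apply: (le_trans (ler_normB _ _)).
    rewrite (normrM lam) (normrM 2^-1) (ger0_norm lam0) (ger0_norm (x := 2^-1))//.
    have b2 : `|d2| <= C3 * r ^+ 2 * k'.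
      apply: (le_trans hd2); rewrite expr1 -expr2.
      by apply: ler_wpM2l => //; rewrite mulr_ge0 ?exprn_ge0// ltW.
    have b3 : 2^-1 * `|d3| <= C3 * r ^+ 3 * k'.
      apply: (@le_trans _ _ `|d3|); first by apply: ler_piMl => //; lra.
      apply: (le_trans hd3); rewrite -exprS.
      by apply: ler_wpM2l => //; rewrite mulr_ge0 ?exprn_ge0// ltW.
    apply: (le_trans (lerD (ler_wpM2l lam0 b2) b3)).
    by rewrite le_eqVlt; apply/orP; left; apply/eqP; ring.
  have n0 : 0 <= C3 * (lam * r ^+ 2 + r ^+ 3) * k'.
    exact: le_trans (normr_ge0 _) hF.
  apply: (@le_trans _ _ (lam ^+ 2 * v ^+ 2 * (C3 * (lam * r ^+ 2 + r ^+ 3) * k'))).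
    by apply: ler_pM; rewrite ?mulr_ge0 ?sqr_ge0//; apply: ler_wpM2r; rewrite ?sqr_ge0.
  have -> : lam ^+ 2 * v ^+ 2 * (C3 * (lam * r ^+ 2 + r ^+ 3) * k') =
    (lam * v) * (C3 * v * k' * (lam ^+ 2 * r ^+ 2 + lam * r ^+ 3)) by ring.
  have -> : 2 * C3 * Q * (e * v) * k' = (2 * e) * (C3 * v * k' * Q) by ring.
  have c3 : 0 <= C3 * v * k' by rewrite mulr_ge0// mulr_ge0// ltW.
  apply: ler_pM => //.
  - by rewrite mulr_ge0.
  - by rewrite mulr_ge0// addr_ge0 ?mulr_ge0 ?sqr_ge0 ?exprn_ge0.
  - by apply: ler_wpM2l => //; rewrite /Q addrC lerD2r lerDr exprn_ge0.
have X3 : - (L * v ^+ 2 * (lam * d2 - 2^-1 * d3)) <= L * v ^+ 2 * `|lam * d2 - 2^-1 * d3|.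
  by rewrite -mulrN; apply: ler_wpM2l; [rewrite mulr_ge0 ?sqr_ge0|rewrite -normrN ler_norm].
have X4 : c * C1 * Q * (e * v) * k <= c * C1 * Q * (e * v) * k'.
  by apply: ler_wpM2l => //; apply: mulr_ge0 => //; apply: mulr_ge0 => //; rewrite mulr_ge0// ltW.
pose f := lam * d2 - 2^-1 * d3.
rewrite -/f in X1 X2 X3 *.
set t1 := 2 * C2 * expR 1 * Q * (e * v) * k' in X1.
have t10 : 0 <= t1.
  have h : 0 <= 2 * C2 * expR 1 by rewrite mulr_ge0 ?expR_ge0// mulr_ge0// ltW.
  by rewrite /t1 mulr_ge0// mulr_ge0// mulr_ge0.
have Y : (1 + L * v) * (b + v * f) <= (1 + L * v) * q + 2 * t1.
  have -> : (1 + L * v) * q + 2 * t1 = (1 + L * v) * (q + t1) + (1 - L * v) * t1 by ring.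
  apply: (@le_trans _ _ ((1 + L * v) * (q + t1))).
    by apply: ler_wpM2l => //; rewrite addr_ge0.
  by rewrite lerDl mulr_ge0// subr_ge0.
have -> : (1 + L * v) * (E * b) + v * (E * f) + c * e * v * (C1 * Q * (E * k)) =
  E * ((1 + L * v) * (b + v * f) + (- (L * v ^+ 2 * f)) + c * C1 * Q * (e * v) * k) by ring.
have -> : (1 + L * v) * (E * q) + (4 * C2 * expR 1 + 2 * C3 + c * C1) * Q * (e * v) * (E * k') =
  E * ((1 + L * v) * q + 2 * t1 + 2 * C3 * Q * (e * v) * k' + c * C1 * Q * (e * v) * k').
  by rewrite /t1; ring.
apply: ler_wpM2l => //; apply: lerD X4; apply: lerD Y _.
exact: le_trans X3 X2.
Qed.

(** Exchanging [X] for a drifted Gaussian of variance [v] leads back to the expectation bounded by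
    [a]. The remainder involves [kap], which [kap_of_dens] bounds by the same [a], so the loss is
    multiplicative. *)
Lemma density_step : exists2 C : R, 0 < C &
  forall (d : measure_display) (T : measurableType d) (P : probability T R)
    (M X : T -> R) (v e s lam a : R),
  bernstein_step P M X v e -> v <= 12 * e ^+ 2 -> 0 < s -> e * rho s <= 8^-1 ->
  0 <= lam -> lam * e <= 8^-1 -> integ P (fun w => expR (lam * M w)) ->
  (forall z : R, Ex P (fun w => expR (lam * M w) * - dens 1 (s + v) (z - M w)) <= a) ->
  forall z : R,
  Ex P (fun w => expR (lam * (M w + X w)) * - dens 1 s (z - (M w + X w))) <=
  expR (tilt_exp lam e * v) *
  (a * (1 + C * (e * v * (rho s ^+ 3 + lam * rho s ^+ 2 + lam ^+ 2 * rho s)))).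
Proof.
have [C1 C10 H1] := @dens_tilted_taylor R.
have [C2 C20 H2] := @dens_line_taylor R.
have [C3 C30 H3] := @dens_tilt_bounds R 2.
have g0 := @gpdf_gt0 R 1; have eN1 := @expRN1_lt_half R.
have c0 : 0 < 1 - 2 * expR (- 1) :> R by lra.
have cc0 := cube_cst_gt0 R.
pose C4 := 4 * C2 * expR 1 + 2 * C3 + cube_cst * C1.
have C40 : 0 < C4.
  by rewrite /C4 !addr_gt0// !mulr_gt0// expR_gt0.
pose K := (gpdf 1 * (1 - 2 * expR (- 1)))^-1 : R.
have K0 : 0 < K by rewrite invr_gt0 mulr_gt0.
exists (2 * C4 * K); first by rewrite !mulr_gt0.
move=> d T P M X v e s lam a step ve s0 er lam0 le8 iE ha z.
have mM := bs_M step; have mX := bs_X step; have v0 := bs_v step.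
have e0 := bs_e step; have e_ge0 := ltW e0.
have sv0 : 0 < s + v by rewrite ltr_wpDr.
have ssv : s <= s + v by rewrite lerDl.
have r0 := rho_gt0 s0; have r_ge0 := ltW r0.
have r'0 := rho_gt0 sv0.
have rK := rhoK s0.
have le0 : 0 <= lam * e by rewrite mulr_ge0.
have er0 : 0 <= e * rho s by rewrite mulr_ge0.
have E0 w : 0 <= expR (lam * M w) by exact: expR_ge0.
have /andP[L1 L2] := tilt_exp_bounds lam0 e0 le8.
set L := tilt_exp lam e in L1 L2 *.
have L0 : 0 <= L by apply: le_trans L1; rewrite divr_ge0 ?sqr_ge0.
set r := rho s in r0 r_ge0 rK er er0 *.
pose Q := r ^+ 4 + lam * r ^+ 3 + lam ^+ 2 * r ^+ 2.
have Q0 : 0 <= Q.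
  rewrite /Q addr_ge0 ?addr_ge0 ?exprn_ge0// mulr_ge0 ?exprn_ge0//.
(* From [e rho <= 1 / 8] and [rho ^ 2 s = 1] follows [e ^ 2 <= s / 64]; thus one step at most
   doubles the kernel width. *)
have vs : v <= 3 * s.
  have h : (e * r) ^+ 2 <= 8^-1 ^+ 2 by rewrite lerXn2r ?nnegrE.
  have : 12 * ((e * r) ^+ 2 * s) <= 12 * (8^-1 ^+ 2 * s).
    by apply: ler_wpM2l => //; apply: ler_wpM2r => //; exact: ltW.
  have -> : (e * r) ^+ 2 * s = e ^+ 2 * (r ^+ 2 * s) by ring.
  by rewrite rK mulr1 => h2; lra.
have rr' : (rho (s + v))^-1 <= 2 / r.
  have := rho_double s0 (introT andP (conj v0 vs)); rewrite -/r => h.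
  by rewrite -[leLHS]mul1r ler_pdivrMr// mulrAC ler_pdivlMr// mul1r.
have iZ l s' z' : 0 < s' -> integ P (fun w => expR (lam * M w) * dens l.+1 s' (z' - M w)).
  by move=> s'0; exact: integ_weight_dens.
have iZN l s' z' : 0 < s' -> integ P (fun w => expR (lam * M w) * - dens l.+1 s' (z' - M w)).
  by move=> s'0; exact: integ_weight_densN.
have ik s' z' : 0 < s' -> integ P (fun w => expR (lam * M w) * kap s' (z' - M w)).
  by move=> s'0; exact: integ_weight_kap.
pose f0 (m : R) := expR (lam * m) * - dens 1 s (z - m).
pose f1 (m : R) := expR (lam * m) * dens 2 s (z - m).
pose f2 (m : R) := expR (lam * m) * (lam * dens 2 s (z - m) - 2^-1 * dens 3 s (z - m)).
pose B (m : R) := C1 * Q * (expR (lam * m) * kap s (z - m)).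
have i0 : integ P (fun w => f0 (M w)) := iZN 0%N s z s0.
have i1 : integ P (fun w => f1 (M w)) := iZ 1%N s z s0.
have i2 : integ P (fun w => f2 (M w)).
  apply: integ_ext (integ_add (integ_scale lam i1) (integ_scale (- 2^-1) (iZ 2%N s z s0))).
  by move=> w; rewrite /f1 /f2; ring.
have iB : integ P (fun w => B (M w)) := integ_scale (C1 * Q) (ik s z s0).
have mE := @measurable_expRM R lam.
have md l := @measurable_dens_shift R l s z.
pose G w := expR (lam * (M w + X w)) * - dens 1 s (z - (M w + X w)).
have le1 : `|lam| * e < 1 by rewrite ger0_norm//; lra.
have mf0 : measurable_fun setT f0.
  by apply: measurable_funM => //; apply: measurableT_comp => //; exact: md.
have f00 m : 0 <= f0 m.
  by rewrite mulr_ge0 ?expR_ge0// dens1E mulr_ge0// ltW// gpdf_gt0.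
have mf1 : measurable_fun setT f1 by apply: measurable_funM => //; exact: md.
have mf2 : measurable_fun setT f2.
  apply: measurable_funM => //; apply: measurable_funB; apply: measurable_funM => //; exact: md.
have mB : measurable_fun setT B.
  apply: measurable_funM => //; apply: measurable_funM => //.
  exact: measurable_kap_shift.
have B0 m : 0 <= B m.
  rewrite /B mulr_ge0//; first by rewrite mulr_ge0// ltW.
  by rewrite mulr_ge0 ?expR_ge0.
have mMX : measurable_fun setT (fun w => M w + X w) by exact: measurable_funD.
have mG : measurable_fun setT G.
  apply: measurable_funM; first exact: (measurableT_comp mE mMX).
  by apply: measurableT_comp => //; exact: (measurableT_comp (md 1%N) mMX).
have GB w : `|G w - (f0 (M w) * expR (lam * X w) + f1 (M w) * X w + f2 (M w) * X w ^+ 2)| <=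
    B (M w) * (`|X w| ^+ 3 * expR (`|X w| / (4 * e))).
  have := H1 s lam (z - M w) (X w) s0 lam0; rewrite -/r -/Q.
  move=> /(ler_wpM2l (expR_ge0 (lam * M w))); rewrite -{1}(ger0_norm (expR_ge0 (lam * M w))) -normrM.
  have -> : G w -
     (f0 (M w) * expR (lam * X w) + f1 (M w) * X w + f2 (M w) * X w ^+ 2) =
     expR (lam * M w) * (expR (lam * X w) * - dens 1 s (z - M w - X w) -
      (- dens 1 s (z - M w) * expR (lam * X w) + dens 2 s (z - M w) * X w +
       (lam * dens 2 s (z - M w) - 2^-1 * dens 3 s (z - M w)) * X w ^+ 2)).
    by rewrite /G /f0 /f1 /f2 mulrDr expRD opprD addrA; ring.
  move=> /le_trans; apply.
  have h : expR ((lam + r) * `|X w|) <= expR (`|X w| / (4 * e)).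
    rewrite ler_expR mulrC; apply: ler_wpM2l => //.
    rewrite -[leRHS]mul1r ler_pdivlMr ?mulr_gt0//.
    have -> : (lam + r) * (4 * e) = 4 * (lam * e + e * r) by ring.
    by lra.
  rewrite /B.
  have -> : C1 * Q * (expR (lam * M w) * kap s (z - M w)) *
    (`|X w| ^+ 3 * expR (`|X w| / (4 * e))) =
    expR (lam * M w) * (C1 * Q * kap s (z - M w) * (`|X w| ^+ 3 * expR (`|X w| / (4 * e)))) by ring.
  apply: ler_wpM2l => //; apply: ler_wpM2l.
    by rewrite mulr_ge0 ?kap_ge0// mulr_ge0// ltW.
  by apply: ler_wpM2l => //; rewrite exprn_ge0.
have [iG hG] := bs_tilted_expansion step le1 mf0 f00 i0 mf1 i1 mf2 i2 mB B0 iB mG GB.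
rewrite ger0_norm// -/(tilt_exp lam e) -/L in hG.
apply: (le_trans hG) => {hG}.
(* The target of the exchange, with drift [lam v]. The drift is harmless because [ha] holds at every
   [z]. *)
pose q' (m : R) := expR (lam * m) * - dens 1 (s + v) (z - lam * v - m).
have iq' : integ P (fun w => q' (M w)) := iZN 0%N (s + v) (z - lam * v) sv0.
have ik' := ik (s + v) z sv0.
have hk := kap_of_dens sv0 iE E0 mM ha z.
have a0 : 0 <= a.
  apply: le_trans (ha z); apply: Ex_ge0 => w.
  by rewrite mulr_ge0 ?expR_ge0// dens1E mulr_ge0 ?(ltW r'0)// ltW// gpdf_gt0.
have {hk} hk : Ex P (fun w => expR (lam * M w) * kap (s + v) (z - M w)) <= a * K * (2 / r).
  apply: (le_trans hk); rewrite -/K; apply: ler_wpM2l => //.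
  by rewrite mulr_ge0// ltW.
have key : (1 + L * v) * Ex P (fun w => f0 (M w)) + v * Ex P (fun w => f2 (M w)) +
   cube_cst * e * v * Ex P (fun w => B (M w)) <=
   (1 + L * v) * Ex P (fun w => q' (M w)) +
   C4 * Q * (e * v) * Ex P (fun w => expR (lam * M w) * kap (s + v) (z - M w)).
  have j0 := integ_scale (1 + L * v) i0; have j2 := integ_scale v i2.
  have jB := integ_scale (cube_cst * e * v) iB.
  have jq := integ_scale (1 + L * v) iq'.
  have jk := integ_scale (C4 * Q * (e * v)) ik'.
  have j02 := integ_add j0 j2.
  have := Ex_le (integ_add j02 jB) (integ_add jq jk).
  rewrite (Ex_add j02 jB) (Ex_add j0 j2) (Ex_add jq jk).
  rewrite (Ex_scale _ i0) (Ex_scale _ i2) (Ex_scale _ iB) (Ex_scale _ iq') (Ex_scale _ ik').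
  apply => w.
  rewrite /f0 /f2 /B /q'.
  set E := expR (lam * M w); have EE : 0 <= E by exact: E0.
  have h2 := H2 s lam (z - M w) v s0 lam0 v0.
  have hd l : (l <= 2)%N -> `|dens l.+1 s (z - M w)| <= C3 * (r * r ^+ l) * kap s (z - M w).
    move=> l2; have := H3 l s (z - M w) 0 l2 s0 (lexx 0).
    by rewrite !mul0r !addr0 oppr0 expr0n !mul0r subr0 expR0 mulr1.
  have hd2 := hd 1%N isT; have hd3 := hd 2%N isT.
  have hkk := kap_le (z - M w) s0 ssv.
  have -> : z - lam * v - M w = z - M w - lam * v by ring.
  rewrite -/r in h2.
  move: h2 hd2 hd3 hkk.
  set b := - dens 1 s (z - M w); set q := - dens 1 (s + v) _.
  set d2 := dens 2 s _; set d3 := dens 3 s _; set k := kap s _; set k' := kap (s + v) _.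
  move=> h2 hd2 hd3 hkk.
  have Hp := (@density_step_pointwise cube_cst C1 C2 C3 r e v lam L E b q d2 d3 k k' cc0
    C10 C20 C30 r_ge0 e0 v0 lam0 ve er le8 L0 L2 EE (kap_ge0 _ _) hkk h2 hd2 hd3).
  exact: Hp.
apply: (le_trans key).
have hq : Ex P (fun w => q' (M w)) <= a by exact: ha.
have Lv0 : 0 <= L * v by rewrite mulr_ge0.
have Lve := expR_ge1Dx (L * v).
have Lv1 : 1 <= expR (L * v) by apply: le_trans Lve; rewrite lerDl.
(* The width [1 / r] from the kernel integral lowers each monomial of [Q] by one power of [r]. *)
have hQ : Q * (2 / r) = 2 * (r ^+ 3 + lam * r ^+ 2 + lam ^+ 2 * r).
  by rewrite /Q; field; rewrite gt_eqF.
set U := r ^+ 3 + _ + _ in hQ *.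
have U0 : 0 <= U.
  by rewrite /U addr_ge0 ?addr_ge0 ?exprn_ge0// mulr_ge0// exprn_ge0.
have -> : expR (L * v) * (a * (1 + 2 * C4 * K * (e * v * U))) =
  expR (L * v) * a + expR (L * v) * (a * (2 * C4 * K * (e * v * U))) by ring.
apply: lerD.
  apply: ler_pM => //; first by rewrite addr_ge0.
  apply: Ex_ge0 => w; rewrite mulr_ge0 ?expR_ge0// dens1E.
  by rewrite mulr_ge0 ?(ltW r'0)// ltW// gpdf_gt0.
apply: (@le_trans _ _ (a * (2 * C4 * K * (e * v * U)))); last first.
  apply: ler_peMl => //; apply: mulr_ge0 => //; apply: mulr_ge0.
    by rewrite mulr_ge0 ?(ltW K0)// mulr_ge0// ltW.
  by rewrite mulr_ge0// mulr_ge0.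
apply: (le_trans (ler_wpM2l _ hk)).
  by apply: mulr_ge0; [rewrite mulr_ge0// ltW|rewrite mulr_ge0].
rewrite le_eqVlt; apply/orP; left; apply/eqP.
transitivity (C4 * (e * v) * a * K * (Q * (2 / r))); first by ring.
by rewrite hQ; ring.
Qed.

End density_step.

(** * Chains of steps and their conditional variances *)

Section chain.
Context {d : measure_display} {T : measurableType d} {R : realType}.
Variable P : probability T R.

Local Notation integ := (integ P).
Local Notation Ex := (Ex P).

(** With unit weight, the expectation of [(X ^ 2 - v) ^ 2] being nonnegative gives
    [v ^ 2 <= Ex (X ^ 4)]; the fourth moment is at most [12 e ^ 2 v], where 12 is half of 4!. *)
Lemma bernstein_step_variance (M X : T -> R) (v e : R) :
  bernstein_step P M X v e -> v <= 12 * e ^+ 2.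
Proof.
move=> st.
have i1 : integ (fun w => (cst 1 : R -> R) (M w)).
  by apply: (@integ_bdd _ _ _ P _ (1)) => // w; rewrite normr1.
have mom := bs_mom st (@measurable_cst _ _ _ _ setT (1 : R)) (fun _ => ler01) i1.
have E1 : Ex (fun w => (cst 1 : R -> R) (M w)) = 1 by exact: Ex_cst.
have i2 := bm_int mom 2; have i4 := bm_int mom 4.
have := bm_2 mom; have := bm_l mom (isT : 2 <= 4)%N; rewrite E1 !mulr1 => h4 h2.
have iv : integ (fun=> v ^+ 2).
  by apply: (@integ_bdd _ _ _ P _ (`|v ^+ 2|)).
have isq := integ_scale (- 2 * v) i2.
have : 0 <= Ex (fun w => (cst 1 (M w) * X w ^+ 4 + - 2 * v * (cst 1 (M w) * X w ^+ 2)) + v ^+ 2).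
  apply: Ex_ge0 => w.
  have -> : cst 1 (M w) * X w ^+ 4 + -2 * v * (cst 1 (M w) * X w ^+ 2) + v ^+ 2 =
    (X w ^+ 2 - v) ^+ 2 by rewrite /cst; ring.
  exact: sqr_ge0.
rewrite (Ex_add (integ_add i4 isq) iv) (Ex_add i4 isq) (Ex_scale _ i2) h2 Ex_cst => h.
have {}h4 := le_trans (ler_norm _) h4.
have e24 : (4`!)%:R = 24 :> R by [].
rewrite e24 subn2 /= in h4.
have v0 := bs_v st.
move: v0; rewrite le_eqVlt => /orP[/eqP <-|v0].
  by rewrite mulr_ge0// sqr_ge0.
rewrite -(ler_pM2r v0).
have -> : 12 * e ^+ 2 * v = 2^-1 * 24 * e ^+ 2 * v by field.
by move: h h4; rewrite -expr2; lra.
Qed.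

(** The variances [v k] are numbers, so the kernel attached to step [k] is deterministic. *)
Record bernstein_chain (M X : nat -> T -> R) (v : nat -> R) (e : R) (N : nat) : Prop :=
  BernsteinChain {
  bc_e : 0 < e ;
  bc_0 : forall w, M 0%N w = 0 ;
  bc_S : forall k w, (k < N)%N -> M k.+1 w = M k w + X k w ;
  bc_step : forall k, (k < N)%N -> bernstein_step P (M k) (X k) (v k) e }.

Variables (M X : nat -> T -> R) (v : nat -> R) (e : R) (N : nat).
Hypothesis ch : bernstein_chain M X v e N.

Let e0 := bc_e ch.

Definition cumvar (k : nat) : R := \sum_(j < k) v j.

Lemma cumvarS k : cumvar k.+1 = cumvar k + v k.
Proof. by rewrite /cumvar big_ord_recr. Qed.

Lemma cumvar0 : cumvar 0 = 0.
Proof. by rewrite /cumvar big_ord0. Qed.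

Lemma bc_v k : (k < N)%N -> 0 <= v k <= 12 * e ^+ 2.
Proof.
move=> kN; rewrite (bs_v (bc_step ch kN)) /=.
exact: bernstein_step_variance (bc_step ch kN).
Qed.

Lemma bc_M k : (k <= N)%N -> measurable_fun setT (M k).
Proof.
case: k => [_|k kN].
  by have -> : M 0%N = cst 0 by apply/funext => w; rewrite (bc_0 ch).
have -> : M k.+1 = (fun w => M k w + X k w) by apply/funext => w; exact: (bc_S ch).
have st := bc_step ch kN.
by apply: measurable_funD; [exact: bs_M st|exact: bs_X st].
Qed.

Lemma chain_mass (lam : R) k : 0 <= lam -> lam * e < 1 -> (k <= N)%N ->
  integ (fun w => expR (lam * M k w)) /\
  Ex (fun w => expR (lam * M k w)) <= expR (tilt_exp lam e * cumvar k).
Proof.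
move=> lam0 le1; elim: k => [_|k IH kN].
  have -> : (fun w => expR (lam * M 0%N w)) = (fun=> 1).
    by apply/funext => w; rewrite (bc_0 ch) mulr0 expR0.
  split; first by apply: (@integ_bdd _ _ _ P _ (1)) => // w; rewrite normr1.
  by rewrite Ex_cst cumvar0 mulr0 expR0.
have [i1 h1] := IH (ltnW kN).
have st := bc_step ch kN; have v0 := bs_v st.
have mom := bs_mom st (measurable_expRM lam) (fun _ => expR_ge0 _) i1.
have le1' : `|lam| * e < 1 by rewrite ger0_norm.
have E : (fun w => expR (lam * M k.+1 w)) = (fun w => expR (lam * M k w) * expR (lam * X k w)).
  by apply/funext => w; rewrite (bc_S ch)// mulrDr expRD.
rewrite E; split; first exact: (integ_Zexp v0 e0 mom le1').
apply: (le_trans (Ex_Zexp_le v0 e0 mom le1')).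
rewrite (ger0_norm lam0) -/(tilt_exp lam e) cumvarS mulrDr expRD mulrC.
apply: ler_pM => //; first by apply: Ex_ge0 => w; exact: expR_ge0.
  rewrite addr_ge0// mulr_ge0// /tilt_exp divr_ge0 ?sqr_ge0// mulr_ge0// subr_ge0 ltW//.
exact: expR_ge1Dx.
Qed.

(* The conditional variance still to come after step [k], plus the smoothing
   variance [delta ^ 2]. *)
Definition srem (delta : R) (k : nat) : R := delta ^+ 2 + (cumvar N - cumvar k).

Lemma sremS delta k : srem delta k = srem delta k.+1 + v k.
Proof. by rewrite /srem cumvarS; ring. Qed.

Lemma srem_ge delta k : (k <= N)%N -> delta ^+ 2 <= srem delta k.
Proof.
move=> kN; rewrite /srem lerDl subr_ge0.
have h m : (k + m <= N)%N -> cumvar k <= cumvar (k + m).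
  elim: m => [|m IH]; first by rewrite addn0.
  rewrite addnS => kmN; rewrite cumvarS (le_trans (IH (ltnW kmN)))// lerDl.
  by have /andP[] := bc_v kmN.
by rewrite -(subnKC kN); apply: h; rewrite subnKC.
Qed.

Lemma erho_srem delta k : 8 * e <= delta -> (k <= N)%N ->
  0 < srem delta k /\ e * rho (srem delta k) <= 8^-1.
Proof.
move=> ed kN; have d0 : 0 < delta by apply: lt_le_trans ed; rewrite mulr_gt0.
have d20 : 0 < delta ^+ 2 by rewrite exprn_gt0.
have sd := srem_ge delta kN; have s0 := lt_le_trans d20 sd.
split => //.
have -> : 8^-1 = e * (8 * e)^-1 by field; rewrite gt_eqF.
apply: ler_wpM2l; first exact: ltW.
apply: (le_trans (rho_le d20 sd)).
by rewrite /rho sqrtr_sqr gtr0_norm// lef_pV2 ?posrE// mulr_gt0.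
Qed.

Lemma vsrem delta k : 8 * e <= delta -> (k < N)%N -> v k <= 3 * srem delta k.+1.
Proof.
move=> ed kN; have /andP[v0 ve] := bc_v kN.
have d0 : 0 <= delta by apply: le_trans ed; rewrite mulr_ge0// ltW.
have sd := srem_ge delta kN.
have : (8 * e) ^+ 2 <= delta ^+ 2 by rewrite lerXn2r ?nnegrE// mulr_ge0// ltW.
have -> : (8 * e) ^+ 2 = 64 * e ^+ 2 by ring.
by have := sqr_ge0 e; lra.
Qed.

End chain.

(** * Gronwall bound for the tilted densities *)

Section density_bound.
Context {R : realType}.

(** Discrete integrals of [s ^ (-3/2)] and [s ^ (-1/2)], through [v = (q - p) (q + p)] for the
    square roots [p] and [q] of [s] and [s + v]; as [q <= 2 p], taking the integrand at an endpoint
    costs only a constant. *)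
Lemma rho_increment (s v : R) : 0 < s -> 0 <= v <= 3 * s ->
  v * rho s ^+ 3 <= 6 * (rho s - rho (s + v)) /\
  v * rho s <= 3 * (Num.sqrt (s + v) - Num.sqrt s).
Proof.
move=> s0 /andP[v0 v3]; have sv0 : 0 < s + v by rewrite ltr_wpDr.
have q0 : 0 < Num.sqrt s by rewrite sqrtr_gt0.
have q1 : 0 < Num.sqrt (s + v) by rewrite sqrtr_gt0.
have h := rho_double s0 (introT andP (conj v0 v3)); rewrite /rho in h *.
have E1 : Num.sqrt s ^+ 2 = s by rewrite sqr_sqrtr// ltW.
have E2 : Num.sqrt (s + v) ^+ 2 = s + v by rewrite sqr_sqrtr// ltW.
have pq : Num.sqrt s <= Num.sqrt (s + v) by rewrite ler_wsqrtr// lerDl.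
move: q0 q1 h E1 E2 pq; set p := Num.sqrt s; set q := Num.sqrt (s + v) => p0 q0 h E1 E2 pq.
have {}h : q <= 2 * p.
  by move: h; rewrite -[leLHS]mul1r ler_pdivrMr// mulrAC ler_pdivlMr// mul1r.
have -> : v = (q - p) * (q + p) by rewrite -subr_sqr E1 E2; ring.
have qp0 : 0 <= q - p by rewrite subr_ge0.
split.
  have -> : (q - p) * (q + p) * p^-1 ^+ 3 = (q - p) / (p ^+ 3 * q) * ((q + p) * q).
    by field; rewrite !gt_eqF.
  have -> : 6 * (p^-1 - q^-1) = (q - p) / (p ^+ 3 * q) * (6 * p ^+ 2).
    by field; rewrite !gt_eqF.
  apply: ler_wpM2l; first by rewrite divr_ge0// mulr_ge0 ?exprn_ge0// ltW.
  have : (q + p) * q <= (3 * p) * (2 * p) by apply: ler_pM; lra.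
  by move/le_trans; apply; rewrite le_eqVlt; apply/orP; left; apply/eqP; ring.
have -> : (q - p) * (q + p) / p = (q - p) * ((q + p) / p) by ring.
rewrite mulrC; apply: ler_wpM2r => //.
by rewrite ler_pdivrMr//; lra.
Qed.

(** The step losses are dominated by increments of a potential [G] of bounded growth:
    [e rho <= 1 / 8] since [delta >= 8 e], and [lam ^ 2 e sqrt s <= 2], together below the 3 of the
    constant. At step 0 the expectation is a Gaussian density of variance at least 1. *)
Lemma density_bound : exists2 A : R, 0 < A &
  forall (d : measure_display) (T : measurableType d) (P : probability T R)
    (M X : nat -> T -> R) (v : nat -> R) (e lam delta : R) (N : nat),
  bernstein_chain P M X v e N -> cumvar v N = 1 -> 0 <= lam -> lam * e <= 8^-1 ->
  lam ^+ 2 * e <= 1 -> 8 * e <= delta -> delta <= 1 ->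
  forall k, (k <= N)%N -> forall z : R,
  Ex P (fun w => expR (lam * M k w) * - dens 1 (srem v N delta k) (z - M k w)) <=
  A * expR (tilt_exp lam e * cumvar v k).
Proof.
have [C C0 HC] := @density_step R.
exists (expR (12 * C * 3)); first exact: expR_gt0.
move=> d T P M X v e lam delta N ch VN lam0 le8 l2e ed d1.
have e0 := bc_e ch; have le1 : lam * e < 1 by lra.
have d0 : 0 < delta by apply: lt_le_trans ed; rewrite mulr_gt0.
pose s := srem v N delta.
(* Of the 12, a factor 6 is that of [rho_increment] and 2 absorbs the mixed term [lam rho ^ 2]. *)
pose G k := 12 * C * e * (rho (s k) - lam ^+ 2 * Num.sqrt (s k)).
have s0E : s 0%N = delta ^+ 2 + 1 by rewrite /s /srem VN cumvar0 subr0.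
have claim k : (k <= N)%N -> forall z : R,
  Ex P (fun w => expR (lam * M k w) * - dens 1 (s k) (z - M k w)) <=
  expR (tilt_exp lam e * cumvar v k) * expR (G k - G 0%N).
  elim: k => [_ z|k IH kN z].
    rewrite cumvar0 mulr0 subrr expR0 mulr1.
    have s1 : 1 <= s 0%N by rewrite s0E lerDr sqr_ge0.
    have -> : (fun w => expR (lam * M 0%N w) * - dens 1 (s 0%N) (z - M 0%N w)) =
        (fun=> - dens 1 (s 0%N) z).
      by apply/funext => w; rewrite (bc_0 ch) mulr0 expR0 mul1r subr0.
    rewrite Ex_cst dens1E.
    have r1 : rho (s 0%N) <= 1.
      have -> : 1 = rho 1 :> R by rewrite /rho sqrtr1 invr1.
      exact: rho_le.
    have r0 : 0 <= rho (s 0%N) by rewrite ltW// rho_gt0// (lt_le_trans _ s1).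
    rewrite mulr_ile1//; first exact: ltW (gpdf_gt0 _).
    rewrite /gpdf mulr_ile1 ?normal_peak_ge0 ?expR_ge0 ?normal_peak1_le1//.
    by rewrite -expR0 ler_expR oppr_le0 divr_ge0 ?sqr_ge0.
  have IHk := IH (ltnW kN).
  have /andP[v0 ve] := bc_v ch kN.
  have [sp er] := erho_srem ch ed kN.
  have v3 := vsrem ch ed kN.
  have [iE _] := chain_mass ch lam0 le1 (ltnW kN).
  rewrite /s sremS -/(s k.+1) in IHk.
  have h := HC d T P (M k) (X k) (v k) e (s k.+1) lam _ (bc_step ch kN) ve sp er lam0 le8 iE IHk z.
  have -> : (fun w => expR (lam * M k.+1 w) * - dens 1 (s k.+1) (z - M k.+1 w)) =
   (fun w => expR (lam * (M k w + X k w)) * - dens 1 (s k.+1) (z - (M k w + X k w))).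
    by apply/funext => w; rewrite (bc_S ch).
  apply: (le_trans h).
  have -> : expR (tilt_exp lam e * cumvar v k.+1) = expR (tilt_exp lam e * v k) * expR (tilt_exp lam e * cumvar v k).
    by rewrite cumvarS -expRD; congr expR; ring.
  rewrite -(mulrA (expR (tilt_exp lam e * v k))); apply: ler_wpM2l; first exact: expR_ge0.
  rewrite -(mulrA (expR (tilt_exp lam e * cumvar v k))); apply: ler_wpM2l; first exact: expR_ge0.
  have -> : expR (G k.+1 - G 0%N) = expR (G k - G 0%N) * expR (G k.+1 - G k).
    by rewrite -expRD; congr expR; ring.
  apply: ler_wpM2l; first exact: expR_ge0.
  apply: le_trans (expR_ge1Dx _); rewrite lerD2l.
  have [h1 h2] := rho_increment sp (introT andP (conj v0 v3)).
  have r0 := ltW (rho_gt0 sp).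
  rewrite -sremS -/(s k) -/(s k.+1) in h1 h2 r0 *.
  have -> : G k.+1 - G k = C * e * (2 * (6 * (rho (s k.+1) - rho (s k)) +
     lam ^+ 2 * (6 * (Num.sqrt (s k) - Num.sqrt (s k.+1))))) by rewrite /G; ring.
  rewrite -!(mulrA C); apply: ler_wpM2l; first exact: ltW.
  rewrite -mulrA; apply: ler_wpM2l; first exact: ltW.
  set r := rho (s k.+1) in h1 h2 r0 *.
  have q : lam * r ^+ 2 <= r ^+ 3 + lam ^+ 2 * r.
    have := mulr_ge0 r0 (sqr_ge0 (r - lam)); have := mulr_ge0 r0 (sqr_ge0 lam).
    have := mulr_ge0 r0 (sqr_ge0 r).
    have -> : r * (r - lam) ^+ 2 = r ^+ 3 - 2 * (lam * r ^+ 2) + lam ^+ 2 * r by ring.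
    have -> : r * r ^+ 2 = r ^+ 3 by ring.
    have -> : r * lam ^+ 2 = lam ^+ 2 * r by ring.
    by lra.
  apply: (@le_trans _ _ (v k * (2 * (r ^+ 3 + lam ^+ 2 * r)))).
    by apply: ler_wpM2l => //; lra.
  have -> : v k * (2 * (r ^+ 3 + lam ^+ 2 * r)) = 2 * (v k * r ^+ 3 + lam ^+ 2 * (v k * r)) by ring.
  apply: ler_wpM2l => //; apply: lerD => //; apply: ler_wpM2l; first exact: sqr_ge0.
  have : 0 <= v k * r by rewrite mulr_ge0.
  by lra.
move=> k kN z; apply: (le_trans (claim k kN z)).
rewrite mulrC; apply: ler_wpM2r; first exact: expR_ge0.
rewrite ler_expR /G.
have [sp er] := erho_srem ch ed kN; rewrite -/(s k) in sp er.
have [sp0 _] := erho_srem ch ed (leq0n N); rewrite -/(s 0%N) in sp0.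
have q0 : Num.sqrt (s 0%N) <= 2.
  rewrite -[2]ger0_norm// -sqrtr_sqr; apply: ler_wsqrtr; rewrite s0E.
  have : delta ^+ 2 <= 1 by rewrite exprn_ile1// ltW.
  by rewrite expr2; lra.
have a1 : lam ^+ 2 * e * Num.sqrt (s 0%N) <= 1 * 2.
  by apply: ler_pM => //; rewrite ?sqrtr_ge0// mulr_ge0 ?sqr_ge0// ltW.
have a2 : 0 <= lam ^+ 2 * e * Num.sqrt (s k).
  by rewrite mulr_ge0 ?sqrtr_ge0// mulr_ge0 ?sqr_ge0// ltW.
have a3 : 0 <= e * rho (s 0%N) by rewrite mulr_ge0// ltW// rho_gt0.
have -> : 12 * C * e * (rho (s k) - lam ^+ 2 * Num.sqrt (s k)) -
  12 * C * e * (rho (s 0%N) - lam ^+ 2 * Num.sqrt (s 0%N)) =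
  12 * C * (e * rho (s k) - lam ^+ 2 * e * Num.sqrt (s k) - e * rho (s 0%N) +
     lam ^+ 2 * e * Num.sqrt (s 0%N)) by ring.
by apply: ler_wpM2l; [rewrite mulr_ge0// ltW|lra].
Qed.

End density_bound.

(** * Tails of Bernstein martingales *)

Section tail_bound.
Context {R : realType}.

Lemma dens1_tilt (lam s y : R) : 0 < s ->
  - dens 1 s y = expR (- (lam * y) + lam ^+ 2 * s / 2) * - dens 1 s (y - lam * s).
Proof.
move=> s0; have r0 := rho_gt0 s0; have rK := rhoK s0.
rewrite !dens1E [RHS]mulrCA; congr (_ * _).
have -> : y * rho s = (y - lam * s) * rho s + lam * s * rho s by ring.
rewrite gpdf_shift mulrC; congr (expR _ * _).
set r := rho s in rK *.
have -> : lam * s * r * ((y - lam * s) * r) = lam * (y - lam * s) * (r ^+ 2 * s) by ring.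
have -> : (lam * s * r) ^+ 2 = lam ^+ 2 * s * (r ^+ 2 * s) by ring.
by rewrite rK; field.
Qed.

(** A discrete integral of [1 / s]; summed over the steps it yields the logarithm of the final
    rate. *)
Lemma ln_increment (s v : R) : 0 < s -> 0 <= v <= 3 * s ->
  v * rho s ^+ 2 <= 4 * (ln (s + v) - ln s).
Proof.
move=> s0 /andP[v0 v3]; have sv0 : 0 < s + v by rewrite ltr_wpDr.
have h : ln (1 + - (v / (s + v))) <= - (v / (s + v)).
  by apply: le_ln1Dx; rewrite ltrN2 ltr_pdivrMr// mul1r ltrDr.
have E : 1 + - (v / (s + v)) = s / (s + v) by field; rewrite gt_eqF.
rewrite E ln_div ?posrE// in h.
have -> : v * rho s ^+ 2 = v / s.
  by rewrite -[RHS]mulr1 -(rhoK s0); field; rewrite gt_eqF.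
apply: (@le_trans _ _ (4 * (v / (s + v)))); last by lra.
have -> : 4 * (v / (s + v)) = v * (4 / (s + v)) by ring.
apply: ler_wpM2l => //; rewrite ler_pdivlMr// mulrC ler_pdivrMr//; lra.
Qed.

(** One exchange of the telescoping sum. Both sides are compared with the second-order expansion of
    the tail at [M]; the remainders carry the weight [exp (lam M)] and the kernel [kap], ready for
    the density bound. *)
Lemma tail_step : exists2 C : R, 0 < C &
  forall (d : measure_display) (T : measurableType d) (P : probability T R)
    (M X : T -> R) (v e s lam : R),
  bernstein_step P M X v e -> v <= 12 * e ^+ 2 -> 0 < s -> e * rho s <= 8^-1 ->
  0 <= lam -> lam * e <= 8^-1 -> integ P (fun w => expR (lam * M w)) ->
  forall x : R,
  `|Ex P (fun w => dens 0 s (x - (M w + X w))) - Ex P (fun w => dens 0 (s + v) (x - M w))|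
  <= C * (e * v) * (rho s * (rho s + lam) ^+ 2) *
     expR (- (lam * x) + lam ^+ 2 * (s + v) / 2) *
     Ex P (fun w => expR (lam * M w) * kap (s + v) (x - lam * s - M w)).
Proof.
have [C1 C10 H1] := @tail_tilted_taylor R.
have [C2 C20 H2] := @tail_time_taylor R.
have cc0 := cube_cst_gt0 R.
exists (cube_cst * C1 + 3 * expR 1 * C2).
  by rewrite addr_gt0// mulr_gt0// mulr_gt0// expR_gt0.
move=> d T P M X v e s lam step ve s0 er lam0 le8 iE x.
have mM := bs_M step; have mX := bs_X step; have v0 := bs_v step.
have e0 := bs_e step; have e_ge0 := ltW e0.
have sv0 : 0 < s + v by rewrite ltr_wpDr.
have ssv : s <= s + v by rewrite lerDl.
have r0 := rho_gt0 s0; have r_ge0 := ltW r0.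
have E0 w : 0 <= expR (lam * M w) by exact: expR_ge0.
have er0 : 0 <= e * rho s by rewrite mulr_ge0.
have le0 : 0 <= lam * e by rewrite mulr_ge0.
set r := rho s in r0 r_ge0 er er0 *.
have iD l s' : 0 < s' -> integ P (fun w => dens l s' (x - M w)).
  move=> s'0; have md : measurable_fun setT (fun w => dens l s' (x - M w)).
    by apply: (measurableT_comp (measurable_dens_shift l s' x)).
  case: l md => [|l] md.
    apply: (@integ_bdd _ _ _ P _ 1) => // w.
    by rewrite /dens expr0 mul1r /= ger0_norm ?gtail_ge0// gtail_le1.
  have [c hc] := dens_bounded l s'0.
  exact: (@integ_bdd _ _ _ P _ c).
pose F := expR (- (lam * x) + lam ^+ 2 * (s + v) / 2).
have F0 : 0 <= F by exact: expR_ge0.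
pose Q := r * (r + lam) ^+ 2.
have Q0 : 0 <= Q by rewrite mulr_ge0// exprn_ge0// addr_ge0.
pose B (m : R) := C1 * Q * F * (expR (lam * m) * kap (s + v) (x - lam * s - m)).
have ik : integ P (fun w => expR (lam * M w) * kap (s + v) (x - lam * s - M w)).
  exact: integ_weight_kap.
have iB : integ P (fun w => B (M w)) := integ_scale (C1 * Q * F) ik.
have B0 m : 0 <= B m.
  rewrite /B; apply: mulr_ge0; last by rewrite mulr_ge0 ?expR_ge0.
  by rewrite mulr_ge0// mulr_ge0// ltW.
have mB : measurable_fun setT B.
  apply: measurable_funM => //; apply: measurable_funM; first exact: measurable_expRM.
  exact: measurable_kap_shift.
pose f0 (m : R) := dens 0 s (x - m).
pose f1 (m : R) := - dens 1 s (x - m).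
pose f2 (m : R) := 2^-1 * dens 2 s (x - m).
have md l := @measurable_dens_shift R l s x.
have mf0 : measurable_fun setT f0 by exact: md.
have mf1 : measurable_fun setT f1 by apply: measurableT_comp => //; exact: md.
have mf2 : measurable_fun setT f2 by apply: measurable_funM => //; exact: md.
have i0 : integ P (fun w => f0 (M w)) := iD 0%N s s0.
have i1 : integ P (fun w => f1 (M w)) := integ_opp (iD 1%N s s0).
have i2 : integ P (fun w => f2 (M w)) := integ_scale 2^-1 (iD 2%N s s0).
have mMX : measurable_fun setT (fun w => M w + X w) by exact: measurable_funD.
pose G w := dens 0 s (x - (M w + X w)).
have mG : measurable_fun setT G by exact: (measurableT_comp (md 0%N) mMX).
have shiftE w s' : expR (- (lam * (x - M w)) + lam ^+ 2 * s' / 2) =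
    expR (- (lam * x) + lam ^+ 2 * s' / 2) * expR (lam * M w).
  by rewrite -expRD; congr expR; ring.
have Fle : expR (- (lam * x) + lam ^+ 2 * s / 2) <= F.
  by rewrite ler_expR; have := mulr_ge0 (sqr_ge0 lam) v0; lra.
have GB w : `|G w - (f0 (M w) + f1 (M w) * X w + f2 (M w) * X w ^+ 2)| <=
    B (M w) * (`|X w| ^+ 3 * expR (`|X w| / (4 * e))).
  have := H1 s lam (x - M w) (X w) s0 lam0; rewrite -/r -/Q shiftE => h.
  rewrite /G /f0 /f1 /f2 opprD addrA; apply: (le_trans h).
  have hx : expR ((lam + r) * `|X w|) <= expR (`|X w| / (4 * e)).
    rewrite ler_expR mulrC; apply: ler_wpM2l => //.
    rewrite -[leRHS]mul1r ler_pdivlMr ?mulr_gt0//.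
    have -> : (lam + r) * (4 * e) = 4 * (lam * e + e * r) by ring.
    by lra.
  have hkk : kap s (x - M w - lam * s) <= kap (s + v) (x - lam * s - M w).
    have -> : x - M w - lam * s = x - lam * s - M w by ring.
    exact: kap_le.
  have b3 : 0 <= `|X w| ^+ 3 by rewrite exprn_ge0.
  apply: ler_pM.
  - apply: mulr_ge0; last by rewrite mulr_ge0 ?expR_ge0.
    by rewrite mulr_ge0 ?kap_ge0// mulr_ge0// ltW.
  - by rewrite mulr_ge0 ?expR_ge0.
  - rewrite /B.
    have -> : C1 * Q * F * (expR (lam * M w) * kap (s + v) (x - lam * s - M w)) =
      (C1 * Q) * kap (s + v) (x - lam * s - M w) * (F * expR (lam * M w)) by ring.
    apply: ler_pM.
    + by rewrite mulr_ge0 ?kap_ge0// mulr_ge0// ltW.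
    + by rewrite mulr_ge0 ?expR_ge0.
    + by apply: ler_wpM2l => //; rewrite mulr_ge0// ltW.
    + by apply: ler_wpM2r.
  - by apply: ler_wpM2l.
have [iG hG] := bs_expansion step mf0 i0 mf1 i1 mf2 i2 mB B0 iB mG GB.
have iS := iD 0%N (s + v) sv0.
pose B2 w := 3 * expR 1 * C2 * (e * v) * Q * F * (expR (lam * M w) * kap (s + v) (x - lam * s - M w)).
have iB2 : integ P B2 := integ_scale (3 * expR 1 * C2 * (e * v) * Q * F) ik.
(* The Gaussian side: [v (rho + lam) <= 3 e] turns the [v ^ 2] of the time expansion into [e v]. *)
have hT w : `|(f0 (M w) + v * f2 (M w)) + - dens 0 (s + v) (x - M w)| <= B2 w.
  have := H2 s lam (x - M w) v s0 lam0 v0; rewrite distrC -/r shiftE -/F => h.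
  apply: (le_trans h).
  have -> : x - M w - lam * s = x - lam * s - M w by ring.
  set k := kap _ _; set E := expR (lam * M w).
  have k0 : 0 <= k by exact: kap_ge0.
  have EE : 0 <= E by exact: E0.
  have lvr : lam * v * r <= 1.
    apply: (le_trans (ler_wpM2r r_ge0 (ler_wpM2l lam0 ve))).
    have -> : lam * (12 * e ^+ 2) * r = 12 * ((lam * e) * (e * r)) by ring.
    have : (lam * e) * (e * r) <= 8^-1 * 8^-1 by apply: ler_pM.
    by lra.
  have vr : v * (r + lam) <= 3 * e.
    apply: (le_trans (ler_wpM2r (addr_ge0 r_ge0 lam0) ve)).
    have -> : 12 * e ^+ 2 * (r + lam) = 12 * (e * r + lam * e) * e by ring.
    by apply: ler_wpM2r => //; lra.
  rewrite /B2.
  have -> : C2 * (r * (r + lam) ^+ 3) * (expR (lam * v * r) * k) * (F * E) * v ^+ 2 =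
    (C2 * v * Q * F * (E * k)) * ((v * (r + lam)) * expR (lam * v * r)) by rewrite /Q; ring.
  have -> : 3 * expR 1 * C2 * (e * v) * Q * F * (E * k) =
    (C2 * v * Q * F * (E * k)) * ((3 * e) * expR 1) by ring.
  apply: ler_wpM2l.
    apply: mulr_ge0; last exact: mulr_ge0.
    by rewrite mulr_ge0// mulr_ge0// mulr_ge0// ltW.
  by apply: ler_pM; rewrite ?expR_ge0 ?mulr_ge0 ?addr_ge0// ler_expR.
have iv2 := integ_scale v i2.
have i02 := integ_add i0 iv2.
have iSN := integ_opp iS.
have iT := integ_add i02 iSN.
have hT2 : `|Ex P (fun w => f0 (M w)) + v * Ex P (fun w => f2 (M w)) -
    Ex P (fun w => dens 0 (s + v) (x - M w))| <= Ex P B2.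
  have := Ex_norm iT; rewrite (Ex_add i02 iSN) (Ex_add i0 iv2) (Ex_scale _ i2) (Ex_opp iS).
  move=> /le_trans; apply; apply: Ex_le => //; exact: integ_norm.
apply: (le_trans (ler_distD (Ex P (fun w => f0 (M w)) + v * Ex P (fun w => f2 (M w))) _ _)).
apply: (le_trans (lerD hG hT2)).
rewrite /B2 (Ex_scale _ ik) /B (Ex_scale _ ik) -/F -/Q.
move: (Ex P _) => I; clearbody Q F; clear.
by rewrite le_eqVlt; apply/orP; left; apply/eqP; ring.
Qed.

End tail_bound.

(** * Tail estimates for chains of total variance one *)

Section chain_tails.
Context {R : realType}.

Definition chernoff (x lam e : R) : R := expR (- (lam * x) + tilt_exp lam e).

Lemma chain_markov (d : measure_display) (T : measurableType d) (P : probability T R)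
    (M X : nat -> T -> R) (v : nat -> R) (e lam : R) (N : nat) :
  bernstein_chain P M X v e N -> cumvar v N = 1 -> 0 <= lam -> lam * e < 1 ->
  forall x (A : set T), measurable A -> (forall w, A w -> x <= M N w) ->
  fine (P A) <= chernoff x lam e.
Proof.
move=> ch VN lam0 le1 x A mA hA.
have [iE hE] := chain_mass ch lam0 le1 (leqnn N).
rewrite VN mulr1 in hE.
rewrite -Ex_indic//; apply: (@le_trans _ _ (Ex P (fun w => expR (- (lam * x)) * expR (lam * M N w)))).
  apply: Ex_le.
  - by apply: (@integ_bdd _ _ _ P _ 1) => // w; rewrite ger0_norm// indicE; case: (_ \in _).
  - exact: integ_scale.
  - move=> w; rewrite indicE; case: (boolP (w \in A)) => [|_]; last by rewrite mulr_ge0 ?expR_ge0.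
    rewrite inE => /hA h; rewrite -expRD -expR0 ler_expR.
    by have := ler_wpM2l lam0 h; rewrite /=; lra.
rewrite (Ex_scale _ iE) /chernoff expRD; apply: ler_wpM2l => //; exact: expR_ge0.
Qed.

(* Here the smoothing scale is [1 / lam], the width over which [exp (lam M)]
   varies by a constant factor. *)
Lemma chain_tail_upper : exists2 C : R, 0 < C &
  forall (d : measure_display) (T : measurableType d) (P : probability T R)
    (M X : nat -> T -> R) (v : nat -> R) (e lam : R) (N : nat),
  bernstein_chain P M X v e N -> cumvar v N = 1 -> 1 <= lam -> lam * e <= 8^-1 ->
  lam ^+ 2 * e <= 1 ->
  forall x (A : set T), measurable A -> (forall w, A w -> x <= M N w) ->
  fine (P A) <= C / lam * chernoff x lam e.
Proof.
have [A A0 hA] := @density_bound R.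
have g0 := @gpdf_gt0 R 1; have eN1 := @expRN1_lt_half R.
have c0 : 0 < 1 - 2 * expR (- 1) :> R by lra.
exists (A / (gpdf 1 * (1 - 2 * expR (- 1)))); first by rewrite divr_gt0// mulr_gt0.
move=> d T P M X v e lam N ch VN lam1 le8 l2e x B mB hB.
have lam_gt0 : 0 < lam by apply: lt_le_trans lam1.
have lam0 := ltW lam_gt0.
have le1 : lam * e < 1 by lra.
have [iE _] := chain_mass ch lam0 le1 (leqnn N).
have ed : 8 * e <= lam^-1 by rewrite -[leRHS]mul1r ler_pdivlMr// mulrAC -mulrA; lra.
have d1 : lam^-1 <= 1 by rewrite invf_le1.
have hD := hA d T P M X v e lam lam^-1 N ch VN lam0 le8 l2e ed d1 N (leqnn N).
have [s0 _] := erho_srem ch ed (leqnn N).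
have sE : srem v N lam^-1 N = lam^-1 ^+ 2 by rewrite /srem subrr addr0.
rewrite sE in s0 hD.
have rE : rho (lam^-1 ^+ 2) = lam by rewrite /rho sqrtr_sqr ger0_norm ?invr_ge0// invrK.
have mM := bc_M ch (leqnn N).
have hk := kap_of_dens s0 iE (fun w => expR_ge0 _) mM hD x.
rewrite VN mulr1 rE in hk.
have ik := integ_weight_kap x s0 iE (fun w => expR_ge0 _) mM.
rewrite -Ex_indic//.
apply: (@le_trans _ _ (Ex P (fun w => expR (- (lam * x)) *
   (expR (lam * M N w) * kap (lam^-1 ^+ 2) (x - M N w))))).
  apply: Ex_le.
  - by apply: (@integ_bdd _ _ _ P _ 1) => // w; rewrite ger0_norm// indicE; case: (_ \in _).
  - exact: integ_scale.
  - move=> w; rewrite indicE; case: (boolP (w \in B)) => [|_]; last first.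
      by rewrite mulr_ge0 ?expR_ge0// mulr_ge0 ?expR_ge0.
    (* On the event [x <= M], the kernel of width [1 / lam] exactly cancels the growth of the tilt
       beyond [x]. *)
    rewrite inE => /hB h; rewrite /kap rE -!expRD -expR0 ler_expR.
    by rewrite ler0_norm ?subr_le0//=; lra.
rewrite (Ex_scale _ ik).
apply: (le_trans (ler_wpM2l (expR_ge0 _) hk)).
rewrite /chernoff expRD le_eqVlt; apply/orP; left; apply/eqP.
by field; rewrite !gt_eqF.
Qed.

Lemma gtail_abs_le (t : R) : gtail `|t| <= 2 * expR (- (t ^+ 2 / 2)).
Proof. by have := gtail_le (normr_ge0 t); rewrite real_normK ?num_real. Qed.

(** Indicator and smoothed indicator differ by at most [2 exp (- t ^ 2 / 2)] at
    [t = (x - M) / delta], a multiple of [delta] times the Gaussian density of variance [delta ^ 2],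
    to which the density bound applies. The event is left open on [M = x], so strict and weak
    inequalities are both covered. *)
Lemma smoothing_error : exists2 C : R, 0 < C &
  forall (d : measure_display) (T : measurableType d) (P : probability T R)
    (M X : nat -> T -> R) (v : nat -> R) (e lam delta : R) (N : nat),
  bernstein_chain P M X v e N -> cumvar v N = 1 -> 0 <= lam -> lam * e <= 8^-1 ->
  lam ^+ 2 * e <= 1 -> 8 * e <= delta -> delta <= 1 -> lam * delta <= 1 ->
  forall x (A : set T), measurable A -> (forall w, A w -> x <= M N w) ->
  (forall w, x < M N w -> A w) ->
  `|fine (P A) - Ex P (fun w => dens 0 (delta ^+ 2) (x - M N w))| <=
    C * delta * chernoff x lam e.
Proof.
have [A A0 hA] := @density_bound R.
have p0 : 0 < normal_peak 1 :> R by rewrite normal_peak_gt0 ?oner_neq0.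
exists (2 / normal_peak 1 * expR 1 * A); first by rewrite mulr_gt0// mulr_gt0 ?expR_gt0// divr_gt0.
move=> d T P M X v e lam delta N ch VN lam0 le8 l2e ed d1 ld1 x B mB hB1 hB2.
have le1 : lam * e < 1 by lra.
have e0 := bc_e ch.
have d0 : 0 < delta by apply: lt_le_trans ed; rewrite mulr_gt0.
have [iE _] := chain_mass ch lam0 le1 (leqnn N).
have hD := hA d T P M X v e lam delta N ch VN lam0 le8 l2e ed d1 N (leqnn N).
have [s0 _] := erho_srem ch ed (leqnn N).
have sE : srem v N delta N = delta ^+ 2 by rewrite /srem subrr addr0.
rewrite sE in s0 hD.
have rE : rho (delta ^+ 2) = delta^-1 by rewrite /rho sqrtr_sqr gtr0_norm.
have mM := bc_M ch (leqnn N).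
rewrite VN mulr1 in hD.
have iI : integ P (\1_B).
  by apply: (@integ_bdd _ _ _ P _ 1) => // w; rewrite ger0_norm// indicE; case: (_ \in _).
have iU : integ P (fun w => dens 0 (delta ^+ 2) (x - M N w)).
  apply: (@integ_bdd _ _ _ P _ 1) => [|w].
    by apply: (measurableT_comp (measurable_dens_shift 0 _ x)).
  by rewrite /dens expr0 mul1r /= ger0_norm ?gtail_ge0// gtail_le1.
have iUN := integ_opp iU.
set F := expR (- (lam * x) + lam ^+ 2 * delta ^+ 2 / 2).
have iq := integ_weight_densN 0%N (x - lam * delta ^+ 2) s0 iE (fun w => expR_ge0 _) mM.
have iq2 := integ_scale (2 / normal_peak 1 * delta * F) iq.
have pw w : `|\1_B w + - dens 0 (delta ^+ 2) (x - M N w)| <=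
   2 / normal_peak 1 * delta * F *
   (expR (lam * M N w) * - dens 1 (delta ^+ 2) (x - lam * delta ^+ 2 - M N w)).
  have -> : 2 / normal_peak 1 * delta * F *
   (expR (lam * M N w) * - dens 1 (delta ^+ 2) (x - lam * delta ^+ 2 - M N w)) =
   2 / normal_peak 1 * delta * - dens 1 (delta ^+ 2) (x - M N w).
    rewrite (dens1_tilt lam (x - M N w) s0).
    have -> : x - M N w - lam * delta ^+ 2 = x - lam * delta ^+ 2 - M N w by ring.
    have -> : expR (- (lam * (x - M N w)) + lam ^+ 2 * delta ^+ 2 / 2) = F * expR (lam * M N w).
      by rewrite /F -expRD; congr expR; ring.
    by ring.
  rewrite dens1E rE /gpdf.
  have -> : dens 0 (delta ^+ 2) (x - M N w) = gtail ((x - M N w) / delta).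
    by rewrite /dens expr0 mul1r rE.
  set t := (x - M N w) / delta.
  have -> : 2 / normal_peak 1 * delta * (delta^-1 * (normal_peak 1 * expR (- (t ^+ 2 / 2)))) =
    2 * expR (- (t ^+ 2 / 2)) by field; rewrite !gt_eqF.
  have := gtail_abs_le t; rewrite indicE.
  case: (boolP (w \in B)) => [|/negP]; rewrite inE => hw.
    have t0 : t <= 0 by rewrite pmulr_lle0 ?invr_gt0// subr_le0 hB1.
    have := gtailN t; rewrite (ler0_norm t0) => ->.
    by rewrite ger0_norm// subr_ge0 gtail_le1.
  have t0 : 0 <= t.
    by rewrite divr_ge0 ?(ltW d0)// subr_ge0 leNgt; apply/negP => h; exact: hw (hB2 _ h).
  by rewrite add0r normrN (ger0_norm (gtail_ge0 t)) ger0_norm.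
rewrite -Ex_indic// -(Ex_opp iU) -(Ex_add iI iUN).
have iS := integ_add iI iUN.
apply: (le_trans (Ex_norm iS)); apply: (le_trans (Ex_le (integ_norm iS) iq2 pw)).
rewrite (Ex_scale _ iq).
have hF : F <= expR (- (lam * x)) * expR 1.
  rewrite -expRD ler_expR lerD2l.
  have -> : lam ^+ 2 * delta ^+ 2 = (lam * delta) ^+ 2 by ring.
  have : (lam * delta) ^+ 2 <= 1 by rewrite exprn_ile1// mulr_ge0// ltW.
  by lra.
have F0 : 0 <= F by exact: expR_ge0.
have c0 : 0 <= 2 / normal_peak 1 * delta by rewrite mulr_ge0 ?(ltW d0)// divr_ge0// ltW.
apply: (le_trans (ler_wpM2l (mulr_ge0 c0 F0) (hD _))).
have -> : 2 / normal_peak 1 * expR 1 * A * delta * chernoff x lam e =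
  2 / normal_peak 1 * delta * (expR (- (lam * x)) * expR 1) * (A * expR (tilt_exp lam e)).
  by rewrite /chernoff expRD; ring.
apply: ler_wpM2r; first by rewrite mulr_ge0 ?expR_ge0// ltW.
exact: ler_wpM2l.
Qed.

(** An exchange costs [e v rho (rho + lam) ^ 2], and the density bound contributes a factor of order
    [1 / rho] through the kernel. The resulting [e v (rho ^ 2 + lam ^ 2)], up to a constant, sums to
    a logarithm and to [lam ^ 2]. *)
Lemma lindeberg_sum : exists2 C : R, 0 < C &
  forall (d : measure_display) (T : measurableType d) (P : probability T R)
    (M X : nat -> T -> R) (v : nat -> R) (e lam delta : R) (N : nat),
  bernstein_chain P M X v e N -> cumvar v N = 1 -> 0 <= lam -> lam * e <= 8^-1 ->
  lam ^+ 2 * e <= 1 -> 8 * e <= delta -> delta <= 1 -> lam * delta <= 1 ->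
  forall x : R,
  `|Ex P (fun w => dens 0 (delta ^+ 2) (x - M N w)) - dens 0 (delta ^+ 2 + 1) x| <=
    C * e * (ln (delta ^+ 2 + 1) - ln (delta ^+ 2) + lam ^+ 2) * chernoff x lam e.
Proof.
have [A A0 hA] := @density_bound R.
have [C C0 hC] := @tail_step R.
have g0 := @gpdf_gt0 R 1; have eN1 := @expRN1_lt_half R.
have c0 : 0 < 1 - 2 * expR (- 1) :> R by lra.
pose K := (gpdf 1 * (1 - 2 * expR (- 1)))^-1 : R.
have K0 : 0 < K by rewrite invr_gt0 mulr_gt0.
pose D := C * A * K * 2 * expR 1.
have D0 : 0 < D by rewrite /D !mulr_gt0// expR_gt0.
exists (8 * D); first by rewrite mulr_gt0.
move=> d T P M X v e lam delta N ch VN lam0 le8 l2e ed d1 ld1 x.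
have e0 := bc_e ch; have le1 : lam * e < 1 by lra.
have d0 : 0 < delta by apply: lt_le_trans ed; rewrite mulr_gt0.
pose s := srem v N delta.
have s0E : s 0%N = delta ^+ 2 + 1 by rewrite /s /srem VN cumvar0 subr0.
have sNE : s N = delta ^+ 2 by rewrite /s /srem subrr addr0.
have H0 : 0 <= chernoff x lam e by exact: expR_ge0.
have /andP[L1 L2] := tilt_exp_bounds lam0 e0 le8.
have claim k : (k <= N)%N ->
  `|Ex P (fun w => dens 0 (s k) (x - M k w)) - dens 0 (s 0%N) x| <=
    D * e * (8 * (ln (s 0%N) - ln (s k)) + 2 * lam ^+ 2 * cumvar v k) * chernoff x lam e.
  elim: k => [_|k IH kN].
    have -> : (fun w => dens 0 (s 0%N) (x - M 0%N w)) = (fun=> dens 0 (s 0%N) x).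
      by apply/funext => w; rewrite (bc_0 ch) subr0.
    by rewrite Ex_cst !subrr cumvar0 !mulr0 addr0 mulr0 mul0r normr0.
  have /andP[v0 ve] := bc_v ch kN.
  have [sp er] := erho_srem ch ed kN.
  have v3 := vsrem ch ed kN.
  have [iE _] := chain_mass ch lam0 le1 (ltnW kN).
  have mM := bc_M ch (ltnW kN).
  have h := hC d T P (M k) (X k) (v k) e (s k.+1) lam (bc_step ch kN) ve sp er lam0 le8 iE x.
  have [sk0 _] := erho_srem ch ed (ltnW kN).
  have hD := hA d T P M X v e lam delta N ch VN lam0 le8 l2e ed d1 k (ltnW kN).
  have hk := kap_of_dens sk0 iE (fun w => expR_ge0 _) mM hD (x - lam * s k.+1).
  have E1 : (fun w => dens 0 (s k.+1) (x - M k.+1 w)) =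
     (fun w => dens 0 (s k.+1) (x - (M k w + X k w))).
    by apply/funext => w; rewrite (bc_S ch).
  rewrite E1.
  apply: (le_trans (ler_distD (Ex P (fun w => dens 0 (s k) (x - M k w))) _ _)).
  have skE : s k.+1 + v k = s k by rewrite /s [RHS]sremS.
  rewrite skE in h.
  rewrite -/(s k) in hk sk0; rewrite -/(s k.+1) in sp er v3.
  move: hk; set I := Ex P _ => hk.
  have {}h := le_trans h (ler_wpM2l _ hk).
  have r0 := rho_gt0 sp; have rk0 := rho_gt0 sk0.
  have rr : (rho (s k))^-1 <= 2 / rho (s k.+1).
    have := rho_double sp (introT andP (conj v0 v3)); rewrite skE => hr.
    by rewrite -[leLHS]mul1r ler_pdivrMr// mulrAC ler_pdivlMr// mul1r.
  have hln := ln_increment sp (introT andP (conj v0 v3)); rewrite skE in hln.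
  have VS1 : cumvar v k.+1 = cumvar v k + v k by exact: cumvarS.
  have V1 : cumvar v k <= 1.
    have := srem_ge ch delta (ltnW kN); rewrite /srem VN lerDl subr_ge0.
    exact.
  have sk : s k = delta ^+ 2 + (1 - cumvar v k) by rewrite /s /srem VN.
  (* The spent variance pays [tilt_exp] and the remaining one only [lam ^ 2 / 2], which is smaller,
     so the exponents add up to at most the Chernoff exponent plus [(lam delta) ^ 2 / 2 <= 1]. *)
  have hexp : expR (- (lam * x) + lam ^+ 2 * s k / 2) * expR (tilt_exp lam e * cumvar v k) <=
      expR 1 * chernoff x lam e.
    rewrite /chernoff -!expRD ler_expR sk.
    have : (lam * delta) ^+ 2 <= 1 by rewrite exprn_ile1// mulr_ge0// ltW.
    have -> : (lam * delta) ^+ 2 = lam ^+ 2 * delta ^+ 2 by ring.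
    have V10 : 0 <= 1 - cumvar v k by rewrite subr_ge0.
    have := ler_wpM2r V10 L1.
    by lra.
  set r := rho (s k.+1) in h r0 rr hln er.
  have {}h : `|Ex P (fun w => dens 0 (s k.+1) (x - (M k w + X k w))) -
       Ex P (fun w => dens 0 (s k) (x - M k w))| <=
     D * e * (8 * (ln (s k) - ln (s k.+1)) + 2 * lam ^+ 2 * v k) * chernoff x lam e.
    apply: (le_trans (h _)).
      apply: mulr_ge0; last exact: expR_ge0.
      apply: mulr_ge0; first by rewrite mulr_ge0 ?(ltW C0)// mulr_ge0// ltW.
      by rewrite mulr_ge0 ?(ltW r0)// sqr_ge0.
    set F := expR (- (lam * x) + lam ^+ 2 * s k / 2) in hexp *.
    set EV := expR (tilt_exp lam e * cumvar v k) in hexp *.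
    have -> : C * (e * v k) * (r * (r + lam) ^+ 2) * F *
        (A * EV / (gpdf 1 * (1 - 2 * expR (-1))) / rho (s k)) =
      (C * A * K * e) * (v k * (r + lam) ^+ 2) * (F * EV) * (r * (rho (s k))^-1).
      rewrite /K; move: (gpdf 1) (1 - _) ((rho (s k))^-1) (v k) => a b c f.
      by rewrite invfM; clear; ring.
    have -> : D * e * (8 * (ln (s k) - ln (s k.+1)) + 2 * lam ^+ 2 * v k) * chernoff x lam e =
      (C * A * K * e) * (8 * (ln (s k) - ln (s k.+1)) + 2 * lam ^+ 2 * v k) *
        (expR 1 * chernoff x lam e) * 2.
      by rewrite /D; ring.
    have cc : 0 <= C * A * K * e by rewrite !mulr_ge0// ltW.
    apply: ler_pM.
    - apply: mulr_ge0; last by rewrite mulr_ge0 ?expR_ge0.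
      by rewrite mulr_ge0// mulr_ge0// sqr_ge0.
    - by rewrite mulr_ge0 ?(ltW r0)// invr_ge0 ltW.
    - apply: ler_pM => //.
      + by rewrite mulr_ge0// mulr_ge0// sqr_ge0.
      + by rewrite mulr_ge0 ?expR_ge0.
      + apply: ler_wpM2l => //.
        apply: (@le_trans _ _ (v k * (2 * r ^+ 2 + 2 * lam ^+ 2))).
          apply: ler_wpM2l => //; have := sqr_ge0 (r - lam).
          have -> : (r - lam) ^+ 2 = r ^+ 2 - 2 * (r * lam) + lam ^+ 2 by ring.
          have -> : (r + lam) ^+ 2 = r ^+ 2 + 2 * (r * lam) + lam ^+ 2 by ring.
          by lra.
        by move: hln; move: (r ^+ 2) => r2; lra.
    - have := ler_wpM2l (ltW r0) rr.
      have -> : r * (2 / r) = 2 by field; rewrite gt_eqF.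
      by [].
  apply: (le_trans (lerD h (IH (ltnW kN)))).
  rewrite VS1; set a := ln (s k); set b := ln (s k.+1); set c := ln (s 0%N).
  move: (cumvar v k) (v k) (chernoff x lam e) => V' v' H'; clearbody D a b c; clear.
  by rewrite le_eqVlt; apply/orP; left; apply/eqP; ring.
have := claim N (leqnn N); rewrite VN sNE s0E mulr1 => /le_trans; apply.
have -> : 8 * D * e * (ln (delta ^+ 2 + 1) - ln (delta ^+ 2) + lam ^+ 2) * chernoff x lam e =
  D * e * (8 * (ln (delta ^+ 2 + 1) - ln (delta ^+ 2)) + 8 * lam ^+ 2) * chernoff x lam e by ring.
apply: ler_wpM2r => //; apply: ler_wpM2l; first by rewrite mulr_ge0// ltW.
by have := sqr_ge0 lam; lra.
Qed.

End chain_tails.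

(** * The optimal tilt *)

Section optimal_tilt.
Context {R : realType}.

(* The maximizer of [lam x - tilt_exp lam e], i.e. [(r - 1) / (r e)] with
   [r = sqrt (1 + 2 x e)]; the maximum is [x_breve e x ^ 2 / 2]. *)
Definition lamopt (e x : R) : R :=
  2 * x / (Num.sqrt (1 + 2 * x * e) * (1 + Num.sqrt (1 + 2 * x * e))).

Lemma sqrt_opt (e x : R) : 0 < e -> 0 <= x ->
  let r := Num.sqrt (1 + 2 * x * e) in [/\ 1 <= r, r <= 1 + x * e & r ^+ 2 = 1 + 2 * x * e].
Proof.
move=> e0 x0 r; have xe0 : 0 <= x * e by rewrite mulr_ge0// ltW.
have r2 : r ^+ 2 = 1 + 2 * x * e by rewrite sqr_sqrtr// -mulrA; lra.
split => //.
  by rewrite /r -[X in X <= _]sqrtr1; apply: ler_wsqrtr; rewrite -mulrA; lra.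
rewrite -(@ler_pXn2r _ 2) ?nnegrE ?sqrtr_ge0//; last by lra.
rewrite r2; have -> : (1 + x * e) ^+ 2 = 1 + 2 * x * e + (x * e) ^+ 2 by ring.
by rewrite lerDl sqr_ge0.
Qed.

Lemma lamopt_bounds (e x : R) : 0 < e -> 0 <= x ->
  [/\ 0 <= lamopt e x, lamopt e x <= x & lamopt e x * e < 1].
Proof.
move=> e0 x0; have [r1 _ r2] := sqrt_opt e0 x0; rewrite /lamopt.
set r := Num.sqrt _ in r1 r2 *.
have r0 : 0 < r by apply: lt_le_trans r1.
have p0 : 0 < r * (1 + r) by rewrite mulr_gt0// addr_gt0.
split.
- by apply: divr_ge0; [rewrite mulr_ge0|exact: ltW].
- rewrite ler_pdivrMr// mulrC; apply: ler_wpM2l => //.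
  have : 1 * 2 <= r * (1 + r) by apply: ler_pM => //; lra.
  by rewrite mul1r.
- rewrite mulrAC ltr_pdivrMr// mul1r.
  have -> : 2 * x * e = r ^+ 2 - 1 by rewrite r2; ring.
  have -> : r * (1 + r) = r ^+ 2 + r by ring.
  by lra.
Qed.

Lemma lamopt_ge (e x : R) : 0 < e -> 0 <= x -> x * e <= 8^-1 -> x / 2 <= lamopt e x.
Proof.
move=> e0 x0 xe; have [r1 r3 r2] := sqrt_opt e0 x0; rewrite /lamopt.
set r := Num.sqrt _ in r1 r2 r3 *.
have r0 : 0 < r by apply: lt_le_trans r1.
have p0 : 0 < r * (1 + r) by rewrite mulr_gt0// addr_gt0.
rewrite ler_pdivlMr//.
have : r * (1 + r) <= 3 / 2 * (5 / 2) by apply: ler_pM; lra.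
move=> /(ler_wpM2l (_ : 0 <= x / 2)) h.
apply: (le_trans (h _)); first by rewrite divr_ge0.
by lra.
Qed.

(** Through [x = (r ^ 2 - 1) / (2 e)] everything is rational in [r]; in particular
    [1 - lam e = 1 / r]. *)
Lemma chernoff_lamopt (e x : R) : 0 < e -> 0 <= x ->
  chernoff x (lamopt e x) e = expR (- (x_breve e x ^+ 2 / 2)).
Proof.
move=> e0 x0; have [r1 r3 r2] := sqrt_opt e0 x0.
rewrite /chernoff /tilt_exp /x_breve /lamopt (ger0_norm x0).
set r := Num.sqrt _ in r1 r2 r3 *.
have r0 : 0 < r by apply: lt_le_trans r1.
have xE : x = (r ^+ 2 - 1) / (2 * e) by rewrite r2; field; rewrite gt_eqF.
have r10 : 0 < 1 + r by rewrite addr_gt0.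
congr expR.
have -> : 2 * x / (r * (1 + r)) = (r - 1) / (r * e).
  by rewrite xE; field; rewrite !gt_eqF.
have -> : 2 * x / (1 + r) = (r - 1) / e.
  by rewrite xE; field; rewrite !gt_eqF.
have -> : 1 - (r - 1) / (r * e) * e = r^-1 by field; rewrite !gt_eqF.
by rewrite xE; field; rewrite !gt_eqF.
Qed.

(** Since [x_breve ^ 2 >= x ^ 2 (1 - x e)], the Chernoff factor is Gaussian up to
    [exp (x ^ 3 e / 2)], which stays bounded exactly in the range of (iii). *)
Lemma x_breve_bounds (e x : R) : 0 < e -> 0 <= x ->
  expR (- (x ^+ 2 / 2)) <= expR (- (x_breve e x ^+ 2 / 2)) /\
  expR (- (x_breve e x ^+ 2 / 2)) <= expR (x ^+ 3 * e / 2) * expR (- (x ^+ 2 / 2)).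
Proof.
move=> e0 x0; have [r1 r3 r2] := sqrt_opt e0 x0.
rewrite /x_breve (ger0_norm x0).
set r := Num.sqrt _ in r1 r2 r3 *.
have r0 : 0 < r by apply: lt_le_trans r1.
have r10 : 0 < 1 + r by rewrite addr_gt0.
set y := 2 * x / (1 + r).
have y0 : 0 <= y by apply: divr_ge0; [rewrite mulr_ge0|exact: ltW].
have yx : y <= x by rewrite /y ler_pdivrMr// mulrC; apply: ler_wpM2l => //; lra.
rewrite -expRD !ler_expR; split.
  have : y ^+ 2 <= x ^+ 2 by rewrite lerXn2r ?nnegrE.
  by lra.
have xe0 : 0 <= x * e by rewrite mulr_ge0// ltW.
have h : x * (1 - x * e / 2) <= y.
  rewrite /y ler_pdivlMr//.
  have h1 : (1 - x * e / 2) * (1 + r) <= 2.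
    have [h2|h2] := leP 0 (1 - x * e / 2).
      apply: (@le_trans _ _ ((1 - x * e / 2) * (2 + x * e))).
        by apply: ler_wpM2l => //; lra.
      have -> : (1 - x * e / 2) * (2 + x * e) = 2 - (x * e) ^+ 2 / 2 by field.
      by have := sqr_ge0 (x * e); lra.
    apply: (@le_trans _ _ 0); last exact: ler0n.
    by apply: mulr_le0_ge0; lra.
  have -> : x * (1 - x * e / 2) * (1 + r) = x * ((1 - x * e / 2) * (1 + r)) by ring.
  by rewrite [2 * x]mulrC; apply: ler_wpM2l.
have : x ^+ 2 * (1 - x * e) <= y ^+ 2.
  have [h2|h2] := leP 0 (1 - x * e / 2).
    apply: (@le_trans _ _ ((x * (1 - x * e / 2)) ^+ 2)).
      have -> : (x * (1 - x * e / 2)) ^+ 2 = x ^+ 2 * (1 - x * e) + (x * (x * e)) ^+ 2 / 4 by field.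
      by rewrite lerDl divr_ge0// sqr_ge0.
    by apply: lerXn2r h; rewrite nnegrE//; apply: mulr_ge0.
  apply: (@le_trans _ _ 0); last exact: sqr_ge0.
  by rewrite mulr_ge0_le0 ?sqr_ge0//; lra.
have -> : x ^+ 2 * (1 - x * e) = x ^+ 2 - x ^+ 3 * e by ring.
by lra.
Qed.

End optimal_tilt.

(** * Nonuniform and upper tail bounds for chains *)

Section chain_estimates.
Context {R : realType}.

Lemma ln_abs_ge (e : R) : 0 < e -> e <= 2^-1 -> `|ln e| = - ln e /\ 2^-1 <= `|ln e|.
Proof.
move=> e0 e2.
have h : ln (1 + (e - 1)) <= e - 1 by apply: le_ln1Dx; lra.
rewrite (_ : 1 + (e - 1) = e) in h; last by ring.
have l0 : ln e <= 0 by lra.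
by rewrite ler0_norm//; split => //; lra.
Qed.

(** Smoothing raises the Gaussian variance to [1 + delta ^ 2]. The mean value theorem between
    [x rho] and [x] undoes this, and [x delta <= 1] keeps the density in between comparable to that
    at [x]. *)
Lemma gtail_rescale (delta x : R) : 0 <= x -> x * delta <= 1 -> 0 <= delta ->
  `|dens 0 (delta ^+ 2 + 1) x - gtail x| <=
    x * delta ^+ 2 * expR 1 * expR (- (x ^+ 2 / 2)).
Proof.
move=> x0 xd d0.
have s0 : 0 < delta ^+ 2 + 1 by rewrite ltr_wpDl// sqr_ge0.
have s1 : 1 <= delta ^+ 2 + 1 by rewrite lerDr sqr_ge0.
have r0 := rho_gt0 s0; have rK := rhoK s0.
set r := rho (delta ^+ 2 + 1) in r0 rK.
have r1 : r <= 1.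
  have -> : 1 = rho 1 :> R by rewrite /rho sqrtr1 invr1.
  exact: rho_le.
rewrite /dens expr0 mul1r /= -/r.
have xr : x * r <= x by apply: ler_piMr.
have [c /andP[c1 c2] E] := mvt_le xr (fun y _ => is_derive_gtail y).
have r2 : r ^+ 2 <= r by rewrite expr2; apply: ler_piMr => //; exact: ltW.
have rd : 1 - r ^+ 2 = r ^+ 2 * delta ^+ 2 by rewrite -[X in X - _]rK; ring.
have h1 : 1 - r <= delta ^+ 2.
  apply: (@le_trans _ _ (1 - r ^+ 2)); first by lra.
  rewrite rd; apply: ler_piMl; first exact: sqr_ge0.
  by rewrite exprn_ile1// ltW.
rewrite distrC E normrM normrN.
rewrite (ger0_norm (ltW (gpdf_gt0 c))) (ger0_norm (x := x - x * r)) ?subr_ge0//.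
rewrite mulrC -mulrA; apply: ler_pM.
- by rewrite subr_ge0.
- exact/ltW/gpdf_gt0.
- have -> : x - x * r = x * (1 - r) by ring.
  exact: ler_wpM2l.
rewrite /gpdf; apply: (@le_trans _ _ (expR (- (c ^+ 2 / 2)))).
  by apply: ler_piMl; [exact: expR_ge0|exact: normal_peak1_le1].
rewrite -expRD ler_expR.
have xr0 : 0 <= x * r by rewrite mulr_ge0// ltW.
have : (x * r) ^+ 2 <= c ^+ 2 by rewrite lerXn2r ?nnegrE// (le_trans xr0).
have : x ^+ 2 * (1 - r ^+ 2) <= 1.
  rewrite rd; have -> : x ^+ 2 * (r ^+ 2 * delta ^+ 2) = (x * delta) ^+ 2 * r ^+ 2 by ring.
  apply: mulr_ile1; rewrite ?sqr_ge0//; apply: exprn_ile1 => //.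
    by rewrite mulr_ge0.
  exact: ltW.
have -> : x ^+ 2 * (1 - r ^+ 2) = x ^+ 2 - (x * r) ^+ 2 by ring.
by lra.
Qed.

(* Smoothing at scale [delta = 8 e]; outside of [e <= 1 / 64], [x ^ 2 e <= 1] the
   right-hand side already dominates both probabilities. *)
Lemma chain_nonuniform : exists2 C : R, 0 < C &
  forall (d : measure_display) (T : measurableType d) (P : probability T R)
    (M X : nat -> T -> R) (v : nat -> R) (e : R) (N : nat),
  bernstein_chain P M X v e N -> cumvar v N = 1 -> e <= 2^-1 ->
  forall x (A : set T), 0 <= x -> measurable A -> (forall w, A w -> x <= M N w) ->
  (forall w, x < M N w -> A w) ->
  `|fine (P A) - gtail x| <=
    C * (1 + x ^+ 2) * (e * `|ln e|) * expR (- (x_breve e x ^+ 2 / 2)).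
Proof.
have [C1 C10 H1] := @smoothing_error R.
have [C2 C20 H2] := @lindeberg_sum R.
(* The first three terms are the smoothing, telescoping and rescaling errors. In the trivial regime
   the difference is at most 3 Chernoff factors while [(1 + x ^ 2) e |ln e| >= 1 / 128], whence
   384. *)
exists (16 * C1 + 4 * C2 + 2 * expR 1 + 384).
  by have := expR_gt0 (1 : R); lra.
move=> d T P M X v e N ch VN e2 x A x0 mA hA1 hA2.
have e0 := bc_e ch; have e_ge0 := ltW e0.
have [lE l2] := ln_abs_ge e0 e2.
set L := `|ln e| in lE l2 *.
have L0 : 0 <= L by rewrite /L.
have [lam0 lamx lame] := lamopt_bounds e0 x0.
have cE := chernoff_lamopt e0 x0.
have [xb1 _] := x_breve_bounds e0 x0.
set H := expR (- (x_breve e x ^+ 2 / 2)) in cE xb1 *.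
have H0 : 0 <= H by exact: expR_ge0.
set lam := lamopt e x in lam0 lamx lame cE.
have x2 := sqr_ge0 x; have ex1 := expR_ge0 (1 : R).
have eL0 : 0 <= e * L by rewrite mulr_ge0.
have [/andP[e64 xe1]|bad] := boolP ((e <= 64^-1) && (x ^+ 2 * e <= 1)); last first.
  have hP := chain_markov ch VN lam0 lame mA hA1; rewrite cE in hP.
  have hg := gtail_le x0; have g0 := gtail_ge0 x.
  have P0 : 0 <= fine (P A) by exact: fine_ge0.
  have : `|fine (P A) - gtail x| <= 3 * H.
    by rewrite ler_norml; apply/andP; split; lra.
  move=> /le_trans; apply; apply: ler_wpM2r => //.
  have big : 128^-1 <= (1 + x ^+ 2) * (e * L).
    move: bad; rewrite negb_and -!ltNge => /orP[h|h].
      have a : 64^-1 * 2^-1 <= e * L by apply: ler_pM => //; exact: ltW.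
      by have := mulr_ge0 x2 eL0; lra.
    have a : 1 * 2^-1 <= (x ^+ 2 * e) * L by apply: ler_pM => //; exact: ltW.
    have -> : (1 + x ^+ 2) * (e * L) = e * L + x ^+ 2 * e * L by ring.
    by lra.
  rewrite -mulrA; apply: (@le_trans _ _ (384 * ((1 + x ^+ 2) * (e * L)))); first by lra.
  apply: ler_wpM2r; first by rewrite mulr_ge0// addr_ge0.
  by lra.
have xe : x * e <= 8^-1.
  rewrite -(@ler_pXn2r _ 2) ?nnegrE ?mulr_ge0//.
  have -> : (x * e) ^+ 2 = (x ^+ 2 * e) * e by ring.
  apply: (@le_trans _ _ (1 * 64^-1)); last by rewrite mul1r expr2; lra.
  by apply: ler_pM => //; rewrite mulr_ge0.
have le8 : lam * e <= 8^-1 by apply: le_trans xe; apply: ler_wpM2r.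
have lam2 : lam ^+ 2 <= x ^+ 2 by rewrite lerXn2r ?nnegrE.
have l2e : lam ^+ 2 * e <= 1 by apply: le_trans xe1; apply: ler_wpM2r.
pose delta := 8 * e.
have d1 : delta <= 1 by rewrite /delta; lra.
have d0 : 0 < delta by rewrite mulr_gt0.
have ld1 : lam * delta <= 1.
  have -> : lam * delta = 8 * (lam * e) by rewrite /delta; ring.
  by lra.
have h1 := H1 d T P M X v e lam delta N ch VN lam0 le8 l2e (lexx _) d1 ld1 x A mA hA1 hA2.
have h2 := H2 d T P M X v e lam delta N ch VN lam0 le8 l2e (lexx _) d1 ld1 x.
have xd : x * delta <= 1.
  have -> : x * delta = 8 * (x * e) by rewrite /delta; ring.
  by lra.
have h3 := gtail_rescale x0 xd (ltW d0).
rewrite cE in h1 h2.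
apply: (le_trans (ler_distD (Ex P (fun w => dens 0 (delta ^+ 2) (x - M N w))) _ _)).
apply: (le_trans (lerD h1 (ler_distD (dens 0 (delta ^+ 2 + 1) x) _ _))).
apply: (le_trans (lerD (lexx _) (lerD h2 h3))).
have dd0 : 0 < delta ^+ 2 by rewrite exprn_gt0.
have hl1 : ln (delta ^+ 2 + 1) <= 1.
  rewrite addrC; apply: (le_trans (le_ln1Dx _)); first by lra.
  by rewrite exprn_ile1// ltW.
have hl2 : - ln (delta ^+ 2) <= 2 * L.
  rewrite lnXn// mulr2n lE.
  have : ln e <= ln delta by rewrite ler_ln ?posrE// /delta; lra.
  by lra.
have B2 : C2 * e * (ln (delta ^+ 2 + 1) - ln (delta ^+ 2) + lam ^+ 2) * H <=
    4 * C2 * ((1 + x ^+ 2) * (e * L) * H).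
  have -> : 4 * C2 * ((1 + x ^+ 2) * (e * L) * H) = C2 * e * (4 * (1 + x ^+ 2) * L) * H by ring.
  apply: ler_wpM2r => //; apply: ler_wpM2l; first by rewrite mulr_ge0// ltW.
  have := ler_wpM2l x2 l2.
  have -> : 4 * (1 + x ^+ 2) * L = 4 * L + 4 * (x ^+ 2 * L) by ring.
  by lra.
have eLx : e <= 2 * ((1 + x ^+ 2) * (e * L)).
  have -> : 2 * ((1 + x ^+ 2) * (e * L)) = e * (2 * L) + 2 * (x ^+ 2 * (e * L)) by ring.
  have a : 0 <= x ^+ 2 * (e * L) by rewrite mulr_ge0.
  have b : e * 1 <= e * (2 * L) by apply: ler_wpM2l => //; lra.
  by lra.
have B1 : C1 * delta * H <= 16 * C1 * ((1 + x ^+ 2) * (e * L) * H).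
  have -> : C1 * delta * H = 8 * C1 * H * e by rewrite /delta; ring.
  have -> : 16 * C1 * ((1 + x ^+ 2) * (e * L) * H) = 8 * C1 * H * (2 * ((1 + x ^+ 2) * (e * L))) by ring.
  by apply: ler_wpM2l => //; rewrite mulr_ge0// mulr_ge0// ltW.
have B3 : x * delta ^+ 2 * expR 1 * expR (- (x ^+ 2 / 2)) <=
    2 * expR 1 * ((1 + x ^+ 2) * (e * L) * H).
  have xx : x <= 1 + x ^+ 2.
    have := sqr_ge0 (x - 1); have -> : (x - 1) ^+ 2 = x ^+ 2 - 2 * x + 1 by ring.
    by lra.
  have de : delta ^+ 2 <= e.
    have -> : delta ^+ 2 = 64 * e * e by rewrite /delta; ring.
    by rewrite -[leRHS]mul1r; apply: ler_wpM2r => //; lra.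
  have p1 : x * delta ^+ 2 <= (1 + x ^+ 2) * e by apply: ler_pM => //; exact: ltW.
  have p2 : (1 + x ^+ 2) * e <= 2 * ((1 + x ^+ 2) * (e * L)).
    have -> : 2 * ((1 + x ^+ 2) * (e * L)) = (1 + x ^+ 2) * e * (2 * L) by ring.
    by apply: ler_peMr; [rewrite mulr_ge0// addr_ge0|lra].
  have -> : 2 * expR 1 * ((1 + x ^+ 2) * (e * L) * H) =
     2 * ((1 + x ^+ 2) * (e * L)) * expR 1 * H by ring.
  apply: ler_pM => //.
  - by rewrite mulr_ge0// mulr_ge0// ltW.
  - by apply: ler_wpM2r => //; exact: le_trans p1 p2.
apply: (le_trans (lerD B1 (lerD B2 B3))).
rewrite -[leRHS]mulrA -[leRHS]mulrA.
have : 0 <= (1 + x ^+ 2) * (e * L * H) by rewrite mulr_ge0 ?addr_ge0// mulr_ge0.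
rewrite -(mulrA (1 + x ^+ 2)); move: ((1 + x ^+ 2) * _) => Y Y0.
clear -Y0; move: (expR 1) => E.
have -> : 16 * C1 * Y + (4 * C2 * Y + 2 * E * Y) = (16 * C1 + 4 * C2 + 2 * E) * Y by ring.
by apply: ler_wpM2r; [exact: Y0|rewrite lerDl ler0n].
Qed.

(** The optimal tilt is at least [x / 2], so the [1 / lam] of [chain_tail_upper] becomes the factor
    [1 / x] that the Gaussian tail also has; a plain Chernoff bound would lose it. *)
Lemma chain_upper : exists2 C : R, 0 < C &
  forall (d : measure_display) (T : measurableType d) (P : probability T R)
    (M X : nat -> T -> R) (v : nat -> R) (e : R) (N : nat),
  bernstein_chain P M X v e N -> cumvar v N = 1 -> e <= 64^-1 ->
  forall x (A : set T), 2 <= x -> x ^+ 2 * e <= 1 -> measurable A ->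
  (forall w, A w -> x <= M N w) ->
  fine (P A) <= C / x * expR (- (x_breve e x ^+ 2 / 2)).
Proof.
have [C C0 HC] := @chain_tail_upper R.
exists (2 * C); first by rewrite mulr_gt0.
move=> d T P M X v e N ch VN e64 x A x2 xe1 mA hA.
have e0 := bc_e ch; have e_ge0 := ltW e0.
have x0 : 0 <= x by lra.
have [lam0 lamx lame] := lamopt_bounds e0 x0.
have cE := chernoff_lamopt e0 x0.
have xe : x * e <= 8^-1.
  rewrite -(@ler_pXn2r _ 2) ?nnegrE ?mulr_ge0//.
  have -> : (x * e) ^+ 2 = (x ^+ 2 * e) * e by ring.
  apply: (@le_trans _ _ (1 * 64^-1)); last by rewrite mul1r expr2; lra.
  by apply: ler_pM => //; rewrite mulr_ge0 ?sqr_ge0.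
have lg := lamopt_ge e0 x0 xe.
set lam := lamopt e x in lam0 lamx lame cE lg.
have le8 : lam * e <= 8^-1 by apply: le_trans xe; apply: ler_wpM2r.
have lam2 : lam ^+ 2 <= x ^+ 2 by rewrite lerXn2r ?nnegrE.
have l2e : lam ^+ 2 * e <= 1 by apply: le_trans xe1; apply: ler_wpM2r.
have lam1 : 1 <= lam by lra.
have h := HC d T P M X v e lam N ch VN lam1 le8 l2e x A mA hA.
rewrite cE in h; apply: (le_trans h); apply: ler_wpM2r; first exact: expR_ge0.
have x_gt0 : 0 < x by lra.
have l_gt0 : 0 < lam by lra.
rewrite ler_pdivrMr// mulrAC ler_pdivlMr//.
have -> : 2 * C * lam = C * (2 * lam) by ring.
by apply: ler_wpM2l; [exact: ltW|lra].
Qed.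

End chain_estimates.

(** * The regression model *)

Section conditional_bounds.
Context {d : measure_display} {T : measurableType d} {R : realType}.
Variable P : probability T R.

Local Notation integ := (integ P).
Local Notation Ex := (Ex P).

Lemma integ_indic (A : set T) : measurable A -> integ \1_A.
Proof.
move=> mA; apply: (@integ_bdd _ _ _ P _ 1) => // w.
by rewrite ger0_norm// indicE; case: (_ \in _).
Qed.

Lemma staircase_full (u : R) m : m%:R <= u ->
  \sum_(i < m) ((i.+1%:R <= u)%R%:R : R) = m%:R.
Proof.
move=> mu; rewrite (eq_bigr (fun=> 1)) ?big_const_ord ?iter_addr_0//.
by move=> i _; rewrite (le_trans _ mu)// ler_nat.
Qed.

(** The sum counts the integers from 1 to [m] that do not exceed [u]; even at [u = m.+1] only 1 is
    lost. *)
Lemma staircase_bound (u : R) m : 0 <= u -> u <= m.+1%:R ->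
  u - 1 <= \sum_(i < m) ((i.+1%:R <= u)%R%:R : R) <= u.
Proof.
move=> u0; elim: m => [|m IH] um.
  by rewrite big_ord0 u0 andbT subr_le0.
rewrite big_ord_recr /=; have [h|h] := leP m.+1%:R u.
  rewrite staircase_full; last by rewrite (le_trans _ h)// ler_nat.
  by rewrite natr1 h andbT lerBlDr natr1.
by rewrite addr0; apply: IH; exact: ltW.
Qed.

Variables (F : set (set T)) (M : T -> R).
Hypothesis F_measurable : forall A, F A -> measurable A.
Hypothesis M_F : forall B : set R, measurable B -> F (M @^-1` B).

Variables (X : T -> R) (c : R).
Hypothesis c0 : 0 <= c.
Hypothesis iX : integ X.
Hypothesis hX : forall A, F A -> `|Ex (fun w => \1_A w * X w)| <= c * fine (P A).

Let mX := integ_mfun iX.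

Lemma past_measurable : measurable_fun setT M.
Proof. by move=> _ B mB; rewrite setTI; exact/F_measurable/M_F. Qed.

Let mM := past_measurable.

(** Layer-cake argument: [f] is within [1 / (n + 1)] of a nonnegative combination of indicators of
    level sets, which pull back to events of [F], so that the bounds add up. The error, the
    expectation of [|X|] over [n + 1], vanishes in the limit. *)
Lemma cond_bound_bounded (f : R -> R) (K : nat) : measurable_fun setT f ->
  (forall m, 0 <= f m <= K%:R) ->
  `|Ex (fun w => f (M w) * X w)| <= c * Ex (fun w => f (M w)).
Proof.
move=> mf fK.
have mfM : measurable_fun setT (fun w => f (M w)) by exact: measurableT_comp.
have if_ : integ (fun w => f (M w)).
  by apply: (@integ_bdd _ _ _ P _ K%:R) => // w; have /andP[h1 h2] := fK (M w); rewrite ger0_norm.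
have iN := integ_norm iX.
have ifX : integ (fun w => f (M w) * X w).
  apply: integ_dom (integ_scale K%:R iN) _; first exact: measurable_funM.
  move=> w; have /andP[h1 h2] := fK (M w); rewrite normrM (ger0_norm h1).
  exact: ler_wpM2r.
suff key (n : nat) : `|Ex (fun w => f (M w) * X w)| <=
    c * Ex (fun w => f (M w)) + Ex (fun w => `|X w|) * n.+1%:R^-1.
  have cv : c * Ex (fun w => f (M w)) + Ex (fun w => `|X w|) * n.+1%:R^-1 @[n --> \oo] -->
      c * Ex (fun w => f (M w)) + Ex (fun w => `|X w|) * 0.
    apply: cvgD; first exact: cvg_cst.
    apply: cvgM; first exact: cvg_cst.
    exact: cvg_harmonic.
  rewrite mulr0 addr0 in cv.
  by apply: (cvgr_to_ge cv); exact: nearW.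
pose A (i : nat) : set T := M @^-1` (f @^-1` [set y | i.+1%:R / n.+1%:R <= y]).
have FA i : F (A i).
  apply: M_F; rewrite -[X in measurable X]setTI; apply: mf => //.
  have -> : [set y : R | i.+1%:R / n.+1%:R <= y] = `[i.+1%:R / n.+1%:R, +oo[%classic.
    by apply/seteqP; split => y /=; rewrite in_itv/= andbT.
  exact: measurable_itv.
have mA i := F_measurable (FA i).
(* As [f <= K], this many levels of height [1 / (n + 1)] suffice. *)
pose N := (K * n.+1)%N.
pose g w : R := \sum_(i < N) (n.+1%:R^-1 * \1_(A i) w).
have n0 : 0 < n.+1%:R :> R by rewrite ltr0n.
have gE w : g w = n.+1%:R^-1 * \sum_(i < N) ((i.+1%:R <= n.+1%:R * f (M w))%R%:R : R).
  rewrite /g mulr_sumr; apply: eq_bigr => i _; congr (_ * _); rewrite indicE.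
  have -> // : (w \in A i) = (i.+1%:R <= n.+1%:R * f (M w))%R.
  by apply/idP/idP; rewrite inE /A /= ler_pdivrMr// mulrC.
have gf w : f (M w) - n.+1%:R^-1 <= g w <= f (M w).
  have /andP[h1 h2] := fK (M w).
  have hu0 : 0 <= n.+1%:R * f (M w) by rewrite mulr_ge0.
  have hu : n.+1%:R * f (M w) <= N.+1%:R.
    apply: (@le_trans _ _ (n.+1%:R * K%:R)); first by rewrite ler_pM2l.
    by rewrite -natrM ler_nat /N mulnC leqnSn.
  have /andP[s1 s2] := staircase_bound hu0 hu; rewrite gE.
  set S := \sum_(_ < _) _ in s1 s2 *.
  apply/andP; split.
    by rewrite mulrC ler_pdivlMr// mulrBl mulVf ?gt_eqF// mulrC.
  by rewrite mulrC ler_pdivrMr// mulrC.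
have ig : integ g by apply: integ_sum => i; apply: integ_scale; exact: integ_indic.
have igX i : integ (fun w => \1_(A i) w * X w).
  apply: integ_dom iN _; first by apply: measurable_funM => //; exact: measurable_indic.
  move=> w; rewrite normrM; apply: ler_piMl => //.
  by rewrite ger0_norm// indicE; case: (_ \in _).
have gXE : (fun w => g w * X w) = (fun w => \sum_(i < N) (n.+1%:R^-1 * (\1_(A i) w * X w))).
  by apply/funext => w; rewrite /g mulr_suml; apply: eq_bigr => i _; rewrite mulrA.
have igXs i : integ (fun w => n.+1%:R^-1 * (\1_(A i) w * X w)) by exact: integ_scale.
have iGX : integ (fun w => g w * X w) by rewrite gXE; exact: integ_sum.
have hg : `|Ex (fun w => g w * X w)| <= c * Ex g.
  rewrite gXE Ex_sum// (_ : Ex g = \sum_(i < N) (n.+1%:R^-1 * fine (P (A i)))); last first.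
    rewrite /g Ex_sum; last by move=> i; apply: integ_scale; exact: integ_indic.
    apply: eq_bigr => i _; rewrite Ex_scale; last exact: integ_indic.
    by rewrite Ex_indic.
  apply: (le_trans (ler_norm_sum _ _ _)); rewrite mulr_sumr; apply: ler_sum => i _.
  rewrite Ex_scale// normrM ger0_norm ?invr_ge0// mulrCA.
  by apply: ler_wpM2l; rewrite ?invr_ge0//; exact: hX.
have h2 : `|Ex (fun w => f (M w) * X w) - Ex (fun w => g w * X w)| <=
    Ex (fun w => `|X w|) * n.+1%:R^-1.
  have iD := integ_add ifX (integ_opp iGX).
  rewrite -(Ex_opp iGX) -(Ex_add ifX (integ_opp iGX)).
  apply: (le_trans (Ex_norm iD)); rewrite mulrC -(Ex_scale _ iN).
  apply: Ex_le; [exact: integ_norm|exact: integ_scale|move=> w].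
  rewrite -mulrBl normrM; apply: ler_wpM2r => //.
  by have /andP[a1 a2] := gf w; rewrite ger0_norm ?subr_ge0// lerBlDr addrC -lerBlDr.
have h3 : c * Ex g <= c * Ex (fun w => f (M w)).
  by apply: ler_wpM2l => //; apply: Ex_le => // w; have /andP[] := gf w.
have := ler_distD 0 (Ex (fun w => f (M w) * X w)) 0; rewrite !subr0.
have := ler_normD (Ex (fun w => f (M w) * X w) - Ex (fun w => g w * X w)) (Ex (fun w => g w * X w)).
rewrite subrK => h4 _; apply: (le_trans h4); rewrite addrC; apply: lerD => //.
exact: le_trans hg h3.
Qed.

Let trunc (f : R -> R) (k : nat) (m : R) := Num.min (f m) k%:R.

Let trunc_measurable f k : measurable_fun setT f -> measurable_fun setT (trunc f k).
Proof. by move=> mf; apply: measurable_minr. Qed.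

Let trunc_bounds (f : R -> R) k : (forall m, 0 <= f m) ->
  forall m, 0 <= trunc f k m <= k%:R.
Proof. by move=> f0 m; rewrite /trunc ge_min lexx orbT andbT le_min f0 /=. Qed.

Let trunc_le (f : R -> R) k m : trunc f k m <= f m.
Proof. by rewrite /trunc ge_min lexx. Qed.

Let trunc_cvg (f : R -> R) (m y : R) : trunc f k m * y @[k --> \oo] --> f m * y.
Proof.
apply: cvg_near_cst; near=> k; rewrite /trunc min_l//.
by near: k; exact: nbhs_infty_ger.
Unshelve. all: end_near. Qed.

(** Truncated weights give uniformly bounded expectations, and Fatou, for which [X] must be
    nonnegative, concludes. It is applied to even powers of the noise. *)
Lemma cond_integ_nonneg (f : R -> R) : measurable_fun setT f -> (forall m, 0 <= f m) ->
  integ (fun w => f (M w)) -> (forall w, 0 <= X w) -> integ (fun w => f (M w) * X w).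
Proof.
move=> mf f0 i_f X0.
have mt k : measurable_fun setT (fun w => trunc f k (M w)).
  by apply: (measurableT_comp (trunc_measurable k mf)).
have itX k : integ (fun w => trunc f k (M w) * X w).
  apply: integ_dom (integ_scale k%:R iX) _; first exact: measurable_funM.
  move=> w; have /andP[h1 h2] := trunc_bounds k f0 (M w).
  by rewrite ger0_norm ?mulr_ge0//; apply: ler_wpM2r.
have it k : integ (fun w => trunc f k (M w)).
  apply: (@integ_bdd _ _ _ P _ k%:R) => // w.
  by have /andP[h1 h2] := trunc_bounds k f0 (M w); rewrite ger0_norm.
have [] // := @Ex_fatou_bound _ _ _ P (fun k w => trunc f k (M w) * X w)
  (fun w => f (M w) * X w) (c * Ex (fun w => f (M w))) itX.
- by move=> k w; rewrite mulr_ge0//; have /andP[] := trunc_bounds k f0 (M w).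
- by apply: measurable_funM => //; exact: measurableT_comp.
move=> k.
have h := cond_bound_bounded (trunc_measurable k mf) (trunc_bounds k f0).
apply: (le_trans (ler_norm _)); apply: (le_trans h); apply: ler_wpM2l => //.
by apply: Ex_le.
Qed.

Lemma cond_bound (f : R -> R) : measurable_fun setT f -> (forall m, 0 <= f m) ->
  integ (fun w => f (M w)) -> integ (fun w => f (M w) * X w) ->
  `|Ex (fun w => f (M w) * X w)| <= c * Ex (fun w => f (M w)).
Proof.
move=> mf f0 i_f ifX.
have mt k : measurable_fun setT (fun w => trunc f k (M w)).
  by apply: (measurableT_comp (trunc_measurable k mf)).
have it k : integ (fun w => trunc f k (M w)).
  apply: (@integ_bdd _ _ _ P _ k%:R) => // w.
  by have /andP[h1 h2] := trunc_bounds k f0 (M w); rewrite ger0_norm.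
have [] // := @Ex_dominated_cvg _ _ _ P (fun k w => trunc f k (M w) * X w)
  (fun w => f (M w) * X w) (fun w => `|f (M w) * X w|).
- by move=> k; exact: measurable_funM.
- exact: integ_mfun ifX.
- exact: integ_norm.
- move=> k w; rewrite !normrM; apply: ler_wpM2r => //.
  have /andP[h1 h2] := trunc_bounds k f0 (M w).
  by rewrite (ger0_norm h1) (ger0_norm (f0 _)).
move=> _ cv.
have {}cv : `|Ex (fun w => trunc f k (M w) * X w)| @[k --> \oo] -->
    `|Ex (fun w => f (M w) * X w)| by exact: cvg_norm.
apply: (cvgr_to_le cv); apply: nearW => k.
have h := cond_bound_bounded (trunc_measurable k mf) (trunc_bounds k f0).
apply: (le_trans h); apply: ler_wpM2l => //.
by apply: Ex_le.
Qed.

End conditional_bounds.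

Section generated_measurability.
Context {d : measure_display} {T : measurableType d} {R : realType} {n : nat}.

(** Indices with coefficient 0 are exempt: they are the future variables in a sum that formally runs
    over all indices. *)
Lemma generated_combination_measurable (G : set (set T)) (X : 'I_n -> T -> R)
    (b : 'I_n -> R) :
  (forall j (B : set R), b j != 0 -> measurable B -> G (X j @^-1` B)) ->
  forall B : set R, measurable B -> <<s G >> ((fun w => \sum_(j < n) b j * X j w) @^-1` B).
Proof.
move=> hX B mB.
suff : measurable_fun (setT : set (g_sigma_algebraType G))
    (fun w : g_sigma_algebraType G => \sum_(j < n) b j * X j w).
  by move=> /(_ measurableT B mB); rewrite setTI.
apply: measurable_sum => j.
have [->|b0] := eqVneq (b j) 0.
  by under eq_fun do rewrite mul0r; exact: measurable_cst.
apply: measurable_funM => //.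
move=> _ B' mB'; rewrite setTI; apply: sub_sigma_algebra; exact: hX.
Qed.

End generated_measurability.

(** * The chain attached to a deterministic unit vector *)

Section model_chain.
Context {d : measure_display} {T : measurableType d} {R : realType}.
Variables (P : probability T R) (n : nat).
Variables (phi eps : 'I_n -> {RV P >-> R}) (sigma e1 e2 : R).
Hypothesis model : regression_model phi eps sigma e1 e2.

Local Notation integ := (integ P).
Local Notation Ex := (Ex P).

Let s0 := sigma_gt0 model.

Lemma Ex_indicM (X : T -> R) (A : set T) : measurable A -> integ X ->
  (Ex (fun w => \1_A w * X w))%:E = (\int[P]_(w in A) (X w)%:E)%E.
Proof.
move=> mA iX; rewrite Ex_EFin.
  rewrite [RHS]integral_mkcond; apply: eq_integral => w _.
  by rewrite /= patchE indicE; case: (w \in A); rewrite ?mul1r ?mul0r.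
apply: integ_dom (integ_norm iX) _.
  by apply: measurable_funM; [exact: measurable_indic|exact: integ_mfun iX].
move=> w; rewrite normrM; apply: ler_piMl => //.
by rewrite ger0_norm// indicE; case: (_ \in _).
Qed.

Lemma natural_filtration_measurable k A : natural_filtration eps k A -> measurable A.
Proof.
apply: smallest_sub; first exact: sigma_algebra_measurable.
move=> B [i _ [C mC <-]]; rewrite setTI.
rewrite -[X in measurable X]setTI; exact: measurable_funP.
Qed.

Lemma partial_sum_past (a : 'I_n -> R) (k : nat) (B : set R) : measurable B ->
  natural_filtration eps k
   ((fun w => \sum_(j < n) (if (j < k)%N then a j else 0) * eps j w) @^-1` B).
Proof.
apply: (generated_combination_measurable (X := fun j => eps j : T -> R)
  (b := fun j : 'I_n => if (j < k)%N then a j else 0)) => j C.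
case: ifPn => [jk _ mC|]; last by rewrite eqxx.
by exists j => //; exists C => //; rewrite setTI.
Qed.

Lemma eps_pow_integ (k : 'I_n) l : integ (fun w => eps k w ^+ l).
Proof.
case: l => [|[|l]].
- by apply: (@integ_bdd _ _ _ P _ 1) => // w; rewrite expr0 normr1.
- by have [h _ _ _] := noise_martingale_differences model k.
- by have [Y [h _ _ _] _] := noise_bernstein model k (isT : (2 <= l.+2)%N).
Qed.

(** The factor 0 puts a vanishing conditional mean in the form expected by [cond_bound]; the
    centered square is treated alike. *)
Lemma eps_cond1 (k : 'I_n) A : natural_filtration eps k A ->
  `|Ex (fun w => \1_A w * eps k w)| <= 0 * fine (P A).
Proof.
move=> FA; have mA := natural_filtration_measurable FA.
have [h1 _ _ h2] := noise_martingale_differences model k.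
rewrite mul0r normr_le0; apply/eqP/EFin_inj.
rewrite (Ex_indicM mA h1) -(h2 _ FA).
by rewrite integral0_eq.
Qed.

Lemma eps_cond2 (k : 'I_n) A : natural_filtration eps k A ->
  `|Ex (fun w => \1_A w * (eps k w ^+ 2 - sigma ^+ 2))| <= 0 * fine (P A).
Proof.
move=> FA; have mA := natural_filtration_measurable FA.
have [h1 h3 _ h2] := noise_cond_variance model k.
have ic : integ (fun=> sigma ^+ 2) by exact: h3.
have iD := integ_add (eps_pow_integ k 2) (integ_opp ic).
have mI : measurable_fun setT (\1_A : T -> R) by exact: measurable_indic.
have i1 X : integ X -> integ (fun w => \1_A w * X w).
  move=> iX; apply: integ_dom (integ_norm iX) _.
    by apply: measurable_funM => //; exact: integ_mfun iX.
  move=> w; rewrite normrM; apply: ler_piMl => //.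
  by rewrite ger0_norm// indicE; case: (_ \in _).
have -> : (fun w => \1_A w * (eps k w ^+ 2 - sigma ^+ 2)) =
    (fun w => \1_A w * eps k w ^+ 2 + - (\1_A w * sigma ^+ 2)).
  by apply/funext => w; rewrite mulrBr.
have j1 := i1 _ (eps_pow_integ k 2); have j2 := i1 _ ic.
rewrite (Ex_add j1 (integ_opp j2)) (Ex_opp j2) mul0r normr_le0 subr_eq0; apply/eqP/EFin_inj.
rewrite (Ex_indicM mA (eps_pow_integ k 2)) (Ex_indicM mA ic).
by rewrite -(h2 _ FA).
Qed.

Definition moment_cst l : R := 2^-1 * l`!%:R * e2 ^+ (l - 2) * sigma ^+ 2.

Lemma moment_cst_ge0 l : 0 <= moment_cst l.
Proof.
have e20 := ltW (e2_gt0 model).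
by rewrite /moment_cst mulr_ge0 ?sqr_ge0// mulr_ge0 ?exprn_ge0// mulr_ge0.
Qed.

Lemma eps_cond_l (k : 'I_n) l A : (2 <= l)%N -> natural_filtration eps k A ->
  `|Ex (fun w => \1_A w * eps k w ^+ l)| <= moment_cst l * fine (P A).
Proof.
move=> l2 FA; have mA := natural_filtration_measurable FA.
have [Y [h1 h3 _ h2] hY] := noise_bernstein model k l2.
have iY : integ Y by exact: h3.
have iX := eps_pow_integ k l.
rewrite -lee_fin -abse_EFin (Ex_indicM mA iX) -(h2 _ FA).
have mY := integ_mfun iY.
have mYA : measurable_fun A (EFin \o Y).
  by apply: measurable_funTS; exact/measurable_EFinP.
apply: (le_trans (le_abse_integral _ mA mYA)).
apply: (@le_trans _ _ (\int[P]_(w in A) (moment_cst l)%:E)%E).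
  apply: ae_ge0_le_integral => //.
  - by apply: measurableT_comp.
  - by move=> w _; rewrite lee_fin moment_cst_ge0.
  - by apply: filterS hY => w hw _; rewrite /= lee_fin.
rewrite integral_cst// [leRHS]EFinM fineK//; exact: fin_num_measure.
Qed.

Variable a : 'I_n -> R.
Hypothesis a1 : \sum_(k < n) a k ^+ 2 = 1.
Hypothesis ae1 : forall k, `|a k| <= e1.

Let e := e1 * e2 / sigma.

(* The sums over [j < k] and [j = k] run over all of ['I_n] with zero
   coefficients, so that they are defined for every natural number [k]. *)
Definition chainM (k : nat) (w : T) : R :=
  \sum_(j < n) (if (j < k)%N then a j / sigma else 0) * eps j w.

Definition chainX (k : nat) (w : T) : R :=
  \sum_(j < n) (if (j == k :> nat) then a j / sigma else 0) * eps j w.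

Definition chainv (k : nat) : R :=
  \sum_(j < n) (if (j == k :> nat) then a j ^+ 2 else 0).

Lemma chainXE (i : 'I_n) w : chainX i w = a i / sigma * eps i w.
Proof.
rewrite /chainX (bigD1 i)//= eqxx big1 ?addr0// => j ji.
by rewrite ifN ?mul0r.
Qed.

Lemma chainvE (i : 'I_n) : chainv i = a i ^+ 2.
Proof.
rewrite /chainv (bigD1 i)//= eqxx big1 ?addr0// => j ji.
by rewrite ifN.
Qed.

(** Scaling by [a / sigma] turns the scale [e2] into [|a| e2 / sigma <= e] and the variance into
    [a ^ 2]. Integrability is proved first for even powers, which are nonnegative, and passes to odd
    ones by [y <= 1 + y ^ 2]. *)
Lemma chain_of_model_step (i : 'I_n) :
  bernstein_step P (chainM i) (chainX i) (chainv i) e.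
Proof.
have e10 := e1_gt0 model; have e20 := e2_gt0 model.
have sn0 : sigma != 0 by rewrite gt_eqF.
have e0 : 0 < e by rewrite divr_gt0// mulr_gt0.
have mX : measurable_fun setT (chainX i).
  have -> : chainX i = (fun w => a i / sigma * eps i w) by apply/funext => w; rewrite chainXE.
  exact: measurable_funM.
pose F := natural_filtration eps i.
have FM : forall A, F A -> measurable A by move=> A; exact: natural_filtration_measurable.
have MF : forall B : set R, measurable B -> F (chainM i @^-1` B).
  exact: (partial_sum_past (fun j => a j / sigma)).
split => //.
- exact: past_measurable FM MF.
- by rewrite chainvE sqr_ge0.
move=> f mf f0 if_.
pose Z w := f (chainM i w).
have Z0 w : 0 <= Z w by exact: f0.
have mZ : measurable_fun setT Z by exact: integ_mfun if_.
have ieven l : ~~ odd l -> integ (fun w => Z w * eps i w ^+ l).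
  case: l => [_|[//|l lo]].
    by apply: integ_ext if_ => w; rewrite expr0 mulr1.
  apply: (cond_integ_nonneg FM MF (moment_cst_ge0 l.+2) (eps_pow_integ i l.+2) _ mf f0 if_).
    by move=> A FA; exact: eps_cond_l.
  by move=> w; rewrite exprn_even_ge0.
have iall l : integ (fun w => Z w * eps i w ^+ l).
  have [lo|] := boolP (odd l); last exact: ieven.
  case: l lo => // l /= lo.
  have h1 : ~~ odd l by [].
  have h2 : ~~ odd l.+2 by rewrite /= negbK.
  apply: integ_dom (integ_add (ieven _ h1) (ieven _ h2)) _.
    by apply: measurable_funM => //; exact: measurable_funX.
  move=> w; rewrite normrM (ger0_norm (Z0 w)) -mulrDr; apply: ler_wpM2l => //.
  rewrite normrX.
  have E1 : eps i w ^+ l = `|eps i w| ^+ l by rewrite -normrX ger0_norm// exprn_even_ge0.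
  have E2 : eps i w ^+ l.+2 = `|eps i w| ^+ l.+2 by rewrite -normrX ger0_norm// exprn_even_ge0.
  rewrite E1 E2; set y := `|eps i w|.
  have y0 : 0 <= y by rewrite /y.
  have yl : 0 <= y ^+ l by exact: exprn_ge0.
  have -> : y ^+ l.+1 = y ^+ l * y by rewrite exprSr.
  have -> : y ^+ l + y ^+ l.+2 = y ^+ l * (1 + y ^+ 2) by rewrite -addn2 exprD; ring.
  apply: ler_wpM2l => //; have := sqr_ge0 (y - 1).
  have -> : (y - 1) ^+ 2 = y ^+ 2 - 2 * y + 1 by ring.
  by lra.
have XE l : (fun w => Z w * chainX i w ^+ l) =
    (fun w => (a i / sigma) ^+ l * (Z w * eps i w ^+ l)).
  by apply/funext => w; rewrite chainXE exprMn; ring.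
split => //.
- by move=> l; rewrite XE; exact: integ_scale.
- have i1 : integ (fun w => Z w * eps i w).
    by apply: integ_ext (iall 1%N) => w; rewrite expr1.
  have -> : (fun w => Z w * chainX i w) = (fun w => a i / sigma * (Z w * eps i w)).
    by apply/funext => w; rewrite chainXE; ring.
  have ie : integ (fun w => eps i w).
    by apply: integ_ext (eps_pow_integ i 1) => w; rewrite expr1.
  have h := cond_bound FM MF (lexx 0) ie (@eps_cond1 i) mf f0 if_ i1.
  rewrite mul0r normr_le0 in h; rewrite (Ex_scale _ i1) (eqP h) mulr0 //.
- rewrite XE (Ex_scale _ (iall 2%N)).
  have ic : integ (fun=> sigma ^+ 2 : R) by apply: (@integ_bdd _ _ _ P _ `|sigma ^+ 2|).
  have iD : integ (fun w => eps i w ^+ 2 - sigma ^+ 2).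
    exact: (integ_add (eps_pow_integ i 2) (integ_opp ic)).
  have isZ := integ_scale (sigma ^+ 2) if_.
  have E : (fun w => Z w * (eps i w ^+ 2 - sigma ^+ 2)) =
      (fun w => Z w * eps i w ^+ 2 + - (sigma ^+ 2 * Z w)).
    by apply/funext => w; ring.
  have iZD : integ (fun w => Z w * (eps i w ^+ 2 - sigma ^+ 2)).
    rewrite E; exact: (integ_add (iall 2%N) (integ_opp isZ)).
  have h := cond_bound FM MF (lexx 0) iD (@eps_cond2 i) mf f0 if_ iZD.
  rewrite mul0r normr_le0 -/(Z _) in h; move/eqP: h.
  have -> : Ex (fun w => f (chainM i w) * (eps i w ^+ 2 - sigma ^+ 2)) =
     Ex (fun w => Z w * (eps i w ^+ 2 - sigma ^+ 2)) by [].
  rewrite E (Ex_add (iall 2%N) (integ_opp isZ)) (Ex_opp isZ) (Ex_scale _ if_).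
  move/eqP; rewrite subr_eq0 => /eqP ->.
  by rewrite chainvE expr_div_n mulrA divfK// expf_neq0.
- move=> l l2; rewrite XE (Ex_scale _ (iall l)) normrM.
  have h := cond_bound FM MF (moment_cst_ge0 l) (eps_pow_integ i l)
    (fun A FA => eps_cond_l l2 FA) mf f0 if_ (iall l).
  apply: (le_trans (ler_wpM2l (normr_ge0 _) h)).
  have I0 : 0 <= Ex Z by exact: Ex_ge0.
  rewrite -/Z; move: (Ex Z) I0 => I I0.
  rewrite normrX normf_div (gtr0_norm s0) expr_div_n chainvE /moment_cst /e.
  set m := (l - 2)%N.
  have El (y : R) : y ^+ l = y ^+ 2 * y ^+ m by rewrite -exprD subnKC.
  rewrite 2!El real_normK ?num_real//.
  have -> : a i ^+ 2 * `|a i| ^+ m / (sigma ^+ 2 * sigma ^+ m) *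
     (2^-1 * l`!%:R * e2 ^+ m * sigma ^+ 2 * I) =
     `|a i| ^+ m * (a i ^+ 2 * (2^-1 * l`!%:R * e2 ^+ m * I) / sigma ^+ m).
    by field; rewrite expf_neq0.
  have -> : 2^-1 * l`!%:R * (e1 * e2 / sigma) ^+ m * a i ^+ 2 * I =
     e1 ^+ m * (a i ^+ 2 * (2^-1 * l`!%:R * e2 ^+ m * I) / sigma ^+ m).
    by rewrite expr_div_n exprMn; field; rewrite expf_neq0.
  apply: ler_wpM2r.
    rewrite divr_ge0 ?exprn_ge0 ?(ltW s0)// mulr_ge0 ?sqr_ge0// mulr_ge0//.
    by rewrite mulr_ge0 ?exprn_ge0 ?(ltW e20)// mulr_ge0.
  by rewrite lerXn2r ?nnegrE// ltW.
Qed.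

Lemma chain_of_model : bernstein_chain P chainM chainX chainv e n.
Proof.
have e0 : 0 < e by rewrite divr_gt0// mulr_gt0//; [exact: e1_gt0 model|exact: e2_gt0 model].
split => //.
- by move=> w; rewrite /chainM big1// => j _; rewrite ltn0 mul0r.
- move=> k w kn; rewrite /chainM /chainX -big_split /=; apply: eq_bigr => j _.
  rewrite -mulrDl; congr (_ * _); rewrite ltnS leq_eqVlt.
  by have [->|jk] := eqVneq (j : nat) k; rewrite ?ltnn ?add0r ?addr0.
- by move=> k kn; exact: (chain_of_model_step (Ordinal kn)).
Qed.

Lemma chain_of_model_var : cumvar chainv n = 1.
Proof.
rewrite -a1 /cumvar; apply: eq_bigr => j _; exact: chainvE.
Qed.

Lemma chain_of_model_sum w : chainM n w = \sum_(j < n) a j / sigma * eps j w.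
Proof. by rewrite /chainM; apply: eq_bigr => j _; rewrite ltn_ord. Qed.

End model_chain.

(** * Independence and Fubini *)

Section fubini_independent.
Context {d d1 d2 : measure_display} {T : measurableType d} {T1 : measurableType d1}
  {T2 : measurableType d2} {R : realType}.
Variables (P : probability T R) (X : {mfun T >-> T1}) (Y : {mfun T >-> T2}).

(** Independence on rectangles makes the joint law the product of the laws, by uniqueness of the
    product measure; integrating sections then stands in for conditioning on [X]. *)
Lemma fubini_independent (E : set (T1 * T2)) :
  (forall A B, measurable A -> measurable B ->
     (P (X @^-1` A `&` Y @^-1` B) = P (X @^-1` A) * P (Y @^-1` B))%E) ->
  measurable E ->
  measurable_fun setT (fun w => P [set w' | E (X w, Y w')]) /\
  P [set w | E (X w, Y w)] = (\int[P]_w P [set w' | E (X w, Y w')])%E.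
Proof.
move=> ind mE.
pose m1 : probability T1 R := distribution P X.
pose m2 : probability T2 R := distribution P Y.
have mXY : measurable_fun setT (fun w => (X w, Y w)) by exact: measurable_fun_pair.
pose XY : {mfun T >-> (T1 * T2)%type} := mfun_Sub (mem_set mXY).
have prodE : ((m1 \x m2) E = distribution P XY E)%E.
  by apply: product_measure_unique => // A B mA mB; exact: ind.
have sectionE x : (m2 \o xsection E) x = P [set w' | E (x, Y w')].
  by rewrite /= /m2 /distribution /pushforward; congr (P _); apply/seteqP; split => w /=; rewrite /xsection/= inE.
have msec := measurable_fun_xsection m2 mE.
split.
  have := measurableT_comp msec (measurable_funPT X).
  by apply: eq_measurable_fun => w _; rewrite -sectionE.
transitivity (distribution P XY E) => //.
rewrite -prodE /product_measure1 /m1 ge0_integral_pushforward//.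
by apply: eq_integral => w _ ; rewrite [LHS]sectionE.
Qed.

End fubini_independent.

(** * Freezing the regressors *)

Section conditioning.
Context {d : measure_display} {T : measurableType d} {R : realType}.
Variables (P : probability T R) (n : nat).
Variables (phi eps : 'I_n -> {RV P >-> R}) (theta sigma e1 e2 : R).
Hypothesis model : regression_model phi eps sigma e1 e2.

(** The sigma-algebra generated by this class is the one of the independence hypothesis. With it,
    [T] itself serves as space of values and the identity as random variable, so no space of vectors
    is needed. *)
Let generators (X : 'I_n -> {RV P >-> R}) : set (set T) :=
  \big[setU/set0]_(i < n) preimage_set_system setT (X i : T -> R) measurable.

Lemma generated_coordinate (X : 'I_n -> {RV P >-> R}) i :
  measurable_fun setT (X i : g_sigma_algebraType (generators X) -> R).
Proof.
move=> _ B mB; apply: sub_sigma_algebra.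
by rewrite /generators (bigD1 i)//=; left; exists B.
Qed.

Lemma generated_identity (X : 'I_n -> {RV P >-> R}) :
  measurable_fun setT (id : T -> g_sigma_algebraType (generators X)).
Proof.
move=> _ B mB; rewrite setTI preimage_id.
move: B mB; apply: smallest_sub; first exact: sigma_algebra_measurable.
rewrite /generators => B; elim/big_ind: _ => [//|F G hF hG [/hF//|/hG//]|i _ [C mC <-]].
exact: measurable_funPT.
Qed.

Lemma normalized_error_combination w : 0 < sum_sq phi w ->
  normalized_error phi eps theta w / sigma =
  \sum_(k < n) phi k w / Num.sqrt (sum_sq phi w) / sigma * eps k w.
Proof.
move=> s0; rewrite /normalized_error /least_squares.
have s1 : sum_sq phi w != 0 by rewrite gt_eqF.
have q0 : Num.sqrt (sum_sq phi w) != 0 by rewrite gt_eqF// sqrtr_gt0.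
have -> : \sum_(k < n) phi k w * observation phi eps theta k w =
   theta * sum_sq phi w + \sum_(k < n) phi k w * eps k w.
  rewrite /sum_sq mulr_sumr -big_split /=; apply: eq_bigr => k _.
  by rewrite /observation; ring.
rewrite [(_ + _) / sum_sq _ _]mulrDl mulfK// addrAC subrr add0r.
have {1}-> : sum_sq phi w = Num.sqrt (sum_sq phi w) ^+ 2 by rewrite sqr_sqrtr// ltW.
set q := Num.sqrt _ in q0 *; rewrite !mulr_suml; apply: eq_bigr => k _.
rewrite expr2 invfM; move: (phi k w) (eps k w) (sigma^-1) => x y z.
by field.
Qed.

Lemma sum_sq_ge0 w : 0 <= sum_sq phi w.
Proof. by apply: sumr_ge0 => k _; exact: sqr_ge0. Qed.

Lemma measurable_powR_comp d' (S : measurableType d') (f : S -> R) p :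
  measurable_fun setT f -> measurable_fun setT (fun x => f x `^ p).
Proof. by move=> mf; exact: (measurableT_comp (measurable_powR p) mf). Qed.

Lemma measurable_normalized_error :
  measurable_fun setT (normalized_error phi eps theta).
Proof.
have mS : measurable_fun setT (sum_sq phi).
  by apply: measurable_sum => k; exact: measurable_funX.
(* Inverse and square root become real powers; at [sum_sq = 0] the identity persists, the inverse
   and the power -1 of 0 both being 0. *)
have -> : normalized_error phi eps theta = fun w =>
    ((\sum_(k < n) phi k w * observation phi eps theta k w) * sum_sq phi w `^ (-1) - theta)
      * sum_sq phi w `^ 2^-1.
  apply/funext => w; rewrite /normalized_error /least_squares.
  by rewrite powR_inv1 ?powR12_sqrt ?sum_sq_ge0.
apply: measurable_funM; last exact: measurable_powR_comp.
apply: measurable_funB => //; apply: measurable_funM; last exact: measurable_powR_comp.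
apply: measurable_sum => k; apply: measurable_funM => //.
by apply: measurable_funD => //; apply: measurable_funM.
Qed.

Lemma conditioning (J : set R) (b1 b2 : R) : measurable J -> 0 <= b2 ->
  (forall a : 'I_n -> R, \sum_(k < n) a k ^+ 2 = 1 -> (forall k, `|a k| <= e1) ->
     b1 <= fine (P [set w | J (\sum_(k < n) a k / sigma * eps k w)]) <= b2) ->
  b1 <= fine (P [set w | J (normalized_error phi eps theta w / sigma)]) <= b2.
Proof.
move=> mJ b20 hJ.
pose T1 := g_sigma_algebraType (generators phi).
pose T2 := g_sigma_algebraType (generators eps).
pose i1 : {mfun T >-> T1} := mfun_Sub (mem_set (@generated_identity phi)).
pose i2 : {mfun T >-> T2} := mfun_Sub (mem_set (@generated_identity eps)).
pose a (w : T) k : R := phi k w / Num.sqrt (sum_sq phi w).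
pose h (z : T1 * T2) : R := \sum_(k < n) a z.1 k / sigma * eps k z.2.
have mphi k : measurable_fun setT (phi k : T1 -> R) by exact: generated_coordinate.
have meps k : measurable_fun setT (eps k : T2 -> R) by exact: generated_coordinate.
have msum : measurable_fun setT (sum_sq phi : T1 -> R).
  by apply: measurable_sum => k; exact: measurable_funX.
have ma k : measurable_fun setT ((fun w => a w k / sigma) : T1 -> R).
  apply: measurable_funM => //.
  have -> : a ^~ k = fun w => phi k w * sum_sq phi w `^ (- 2^-1).
    by apply/funext => w; rewrite /a powRN powR12_sqrt ?sum_sq_ge0.
  by apply: measurable_funM => //; exact: measurable_powR_comp.
have mh : measurable_fun setT h.
  apply: measurable_sum => k; apply: measurable_funM.
    exact: (measurableT_comp (ma k) measurable_fst).
  exact: (measurableT_comp (meps k) measurable_snd).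
have mE : measurable (h @^-1` J) by rewrite -[X in measurable X]setTI; exact: mh.
have ind (A : set T1) (B : set T2) : measurable A -> measurable B ->
     (P (i1 @^-1` A `&` i2 @^-1` B) = P (i1 @^-1` A) * P (i2 @^-1` B))%E.
  exact: (regressors_noise_independent model).
have [mS PE] := fubini_independent ind mE.
have section_bounds : {ae P, forall w : T, (b1%:E <= P [set w' | J (h (w, w'))] <= b2%:E)%E}.
  have hall : {ae P, forall w, forall k, `|phi k w| / Num.sqrt (sum_sq phi w) <= e1}.
    (* A single null set for all [k] comes from a countable intersection over [nat], void beyond
       [n]. *)
    have h0 (m : nat) : {ae P, forall w, forall k : 'I_n, k = m :> nat ->
        `|phi k w| / Num.sqrt (sum_sq phi w) <= e1}.
      have [mn|mn] := ltnP m n.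
        apply: filterS (regressors_bound model (Ordinal mn)) => w hw k km.
        by rewrite (_ : k = Ordinal mn)//; exact: val_inj.
      by apply: aeW => w k km; move: (ltn_ord k); rewrite km ltnNge mn.
    by apply: filterS (ae_foralln h0) => w hw k; exact: (hw k).
  apply: filterS2 (sum_sq_gt0 model) hall => w s0 hk.
  have /andP[] : b1 <= fine (P [set w' | J (h (w, w'))]) <= b2.
    apply: (hJ (a w)) => [|k]; last by rewrite /= normf_div (ger0_norm (sqrtr_ge0 _)).
    rewrite (eq_bigr (fun k => phi k w ^+ 2 / sum_sq phi w)).
      by rewrite -mulr_suml divff// gt_eqF.
    by move=> k _; rewrite expr_div_n sqr_sqrtr// ltW.
  have fP : P [set w' | J (h (w, w'))] \is a fin_num.
    apply: fin_num_measure.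
    have mi : measurable_fun setT (fun w' => h (w, i2 w')).
      apply: measurable_sum => k; apply: measurable_funM; first exact: (measurable_cst (a w k / sigma)).
      exact: (measurable_funPT (eps k)).
    by rewrite -[X in measurable X]setTI; exact: (mi measurableT J mJ).
  by rewrite -!lee_fin fineK// => -> ->.
have mB : measurable [set w : T | J (h (w, w))].
  have mi : measurable_fun setT (fun w => (i1 w, i2 w) : (T1 * T2)%type) by exact: measurable_fun_pair.
  by rewrite -[X in measurable X]setTI; exact: (mi measurableT (h @^-1` J) mE).
have PJ : P [set w | J (normalized_error phi eps theta w / sigma)] = P [set w : T | J (h (w, w))].
  have mA : measurable [set w | J (normalized_error phi eps theta w / sigma)].
    rewrite -[X in measurable X]setTI.
    have m1 : measurable_fun setT (fun w => normalized_error phi eps theta w / sigma).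
      by apply: measurable_funM => //; exact: measurable_normalized_error.
    exact: (m1 measurableT J mJ).
  have intE A : measurable A -> P A = (\int[P]_w (\1_A w)%:E)%E.
    by move=> mA'; rewrite integral_indic// setIT.
  rewrite (intE _ mA) (intE _ mB); apply: ae_eq_integral => //.
  - by apply/measurable_EFinP; exact: measurable_indic.
  - by apply/measurable_EFinP; exact: measurable_indic.
  apply: filterS (sum_sq_gt0 model) => w s0 _.
  rewrite !indicE; congr (_%:E); congr (nat_of_bool _)%:R.
  by apply/idP/idP; rewrite !inE /= normalized_error_combination.
have fI : (\int[P]_w P [set w' | J (h (w, w'))])%E \is a fin_num.
  by rewrite -PE; exact: (fin_num_measure P _ mB).
have cstE (b : R) : (b%:E = \int[P]_w (b%:E))%E.
  have PT : P [set: T] = 1%E by exact: probability_setT.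
  by rewrite integral_cst// -[LHS]mule1; congr (_ * _)%E; exact/esym/PT.
have sec0 (w : T) : (0 <= P [set w' | J (h (w, w'))])%E by exact: measure_ge0.
rewrite PJ PE; apply/andP; split.
  (* A nonpositive [b1] is trivial; otherwise the constant is nonnegative, as the comparison of
     integrals requires. *)
  have [b10|b10] := leP b1 0; first by rewrite (le_trans b10)// fine_ge0// integral_ge0.
  rewrite -lee_fin fineK// [leLHS]cstE; apply: ae_ge0_le_integral => //.
  - by move=> w _; rewrite lee_fin ltW.
  - by apply: filterS section_bounds => w /andP[h1 h2].
rewrite -lee_fin fineK// [leRHS]cstE; apply: ae_ge0_le_integral => //.
by apply: filterS section_bounds => w /andP[h1 h2].
Qed.

End conditioning.

(** * Bounds for the model and ratios to the Gaussian tail *)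

Section model_bounds.
Context {R : realType}.

Lemma measurable_linear_event (d : measure_display) (T : measurableType d)
    (P : probability T R) n (X : 'I_n -> {RV P >-> R}) (c : 'I_n -> R) (J : set R) :
  measurable J -> measurable [set w | J (\sum_(k < n) c k * X k w)].
Proof.
move=> mJ; rewrite -[X in measurable X]setTI.
have mf : measurable_fun setT (fun w => \sum_(k < n) c k * X k w).
  by apply: measurable_sum => k; exact: measurable_funM.
exact: (mf measurableT J mJ).
Qed.

(* The sign [s = 1] or [s = -1] covers right and left tails; the latter are right
   tails for the unit vector [- a]. *)
Lemma model_nonuniform : exists2 C : R, 0 < C &
  forall (d : measure_display) (T : measurableType d) (P : probability T R) (n : nat)
    (phi eps : 'I_n -> {RV P >-> R}) (theta sigma e1 e2 : R),
  regression_model phi eps sigma e1 e2 ->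
  forall (s x : R) (J : set R), s ^+ 2 = 1 -> 0 <= x -> measurable J ->
  (forall y, J y -> x <= s * y) -> (forall y, x < s * y -> J y) ->
  `|fine (P [set w | J (normalized_error phi eps theta w / sigma)]) - gtail x| <=
    C * (1 + x ^+ 2) * (e1 * e2 / sigma * `|ln (e1 * e2 / sigma)|)
      * expR (- (x_breve (e1 * e2 / sigma) x ^+ 2 / 2)).
Proof.
have [C C0 HC] := @chain_nonuniform R; exists C => //.
move=> d T P n phi eps theta sigma e1 e2 model s x J s1 x0 mJ J1 J2.
set b := C * _ * _ * _.
rewrite ler_distl; apply: (conditioning theta model mJ) => [|a a1 ae1].
  rewrite addr_ge0 ?gtail_ge0//.
  have e0 : 0 <= e1 * e2 / sigma.
    by rewrite divr_ge0 ?mulr_ge0// ltW//;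
      [exact: e1_gt0 model|exact: e2_gt0 model|exact: sigma_gt0 model].
  rewrite /b; move: (e1 * e2 / sigma) e0 => e e0.
  by rewrite !mulr_ge0 ?addr_ge0 ?sqr_ge0 ?expR_ge0// ltW.
have sa1 : \sum_(k < n) (s * a k) ^+ 2 = 1.
  by rewrite -[RHS]a1; apply: eq_bigr => k _; rewrite exprMn s1 mul1r.
have sae1 k : `|s * a k| <= e1.
  have /eqP := s1; rewrite sqrf_eq1 => /orP[] /eqP ->; rewrite ?mul1r ?mulN1r ?normrN; exact: ae1.
have sumE w : chainM eps sigma (fun k => s * a k) n w = s * \sum_(k < n) a k / sigma * eps k w.
  by rewrite chain_of_model_sum mulr_sumr; apply: eq_bigr => k _; rewrite !mulrA.
rewrite -ler_distl; apply: (HC _ _ _ _ _ _ _ _ (chain_of_model model sae1)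
    (chain_of_model_var sa1) (epsilon_le_half model) _ _ x0).
- exact: measurable_linear_event.
- by move=> w /J1; rewrite sumE.
- by move=> w; rewrite sumE => /J2.
Qed.

Lemma model_upper : exists2 C : R, 0 < C &
  forall (d : measure_display) (T : measurableType d) (P : probability T R) (n : nat)
    (phi eps : 'I_n -> {RV P >-> R}) (theta sigma e1 e2 : R),
  regression_model phi eps sigma e1 e2 -> e1 * e2 / sigma <= 64^-1 ->
  forall (x : R) (J : set R), 2 <= x -> x ^+ 2 * (e1 * e2 / sigma) <= 1 -> measurable J ->
  (forall y, J y -> x <= y) ->
  fine (P [set w | J (normalized_error phi eps theta w / sigma)]) <=
    C / x * expR (- (x_breve (e1 * e2 / sigma) x ^+ 2 / 2)).
Proof.
have [C C0 HC] := @chain_upper R; exists C => //.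
move=> d T P n phi eps theta sigma e1 e2 model e64 x J x2 xe mJ J1.
suff : 0 <= fine (P [set w | J (normalized_error phi eps theta w / sigma)]) <=
    C / x * expR (- (x_breve (e1 * e2 / sigma) x ^+ 2 / 2)) by case/andP.
apply: (conditioning theta model mJ) => [|a a1 ae1].
  have x0 : 0 <= x by lra.
  by rewrite mulr_ge0 ?expR_ge0// divr_ge0// ltW.
rewrite fine_ge0 ?measure_ge0//=.
apply: (HC _ _ _ _ _ _ _ _ (chain_of_model model ae1)
    (chain_of_model_var a1) e64 _ _ x2 xe).
- exact: measurable_linear_event.
- by move=> w /J1; rewrite chain_of_model_sum.
Qed.

Lemma x_breveN (e x : R) : x_breve e (- x) = x_breve e x.
Proof. by rewrite /x_breve normrN. Qed.

(** For [t = |x| > 1] and [e <= 1 / 2] the denominator in [x_breve] has square at most [6 t], so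
    [x_breve ^ 2 >= 2 t / 3]. Then [exp (t / 3) >= (1 + t / 6) ^ 2], and 36 times this square is
    [(6 + t) ^ 2], which exceeds [1 + t ^ 2]. *)
Lemma x_breve_decay (e x : R) : 0 < e -> e <= 2^-1 ->
  (1 + x ^+ 2) * expR (- (x_breve e x ^+ 2 / 2)) <= 36.
Proof.
move=> e0 e2; have [x1|x1] := leP `|x| 1.
  have h1 : x ^+ 2 <= 1 by rewrite -real_normK ?num_real// expr_le1.
  have h2 : expR (- (x_breve e x ^+ 2 / 2)) <= 1.
    by rewrite -[leRHS]expR0 ler_expR; have := sqr_ge0 (x_breve e x); lra.
  apply: (@le_trans _ _ (2 * 1)); last by lra.
  apply: ler_pM => //; first by rewrite addr_ge0// sqr_ge0.

  by move: h1; clear; lra.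
have xE : x ^+ 2 = `|x| ^+ 2 by rewrite real_normK ?num_real.
rewrite /x_breve xE; move: `|x| x1 => t t1 {xE}.
have t0 : 0 <= t by lra.
have te : t * e <= t * 2^-1 by exact: ler_wpM2l.
have te0 : 0 <= t * e by rewrite mulr_ge0// ltW.
set D := 1 + Num.sqrt _.
have D0 : 0 < D by apply: ltr_wpDr; [exact: sqrtr_ge0|exact: ltr01].
have D2 : D ^+ 2 <= 6 * t.
  have := @sqr_sqrtr R (1 + 2 * t * e); rewrite /D.
  set q := Num.sqrt _ => qE.
  have {}qE : q ^+ 2 = 1 + 2 * (t * e) by rewrite qE; [ring|rewrite -mulrA; lra].
  have -> : (1 + q) ^+ 2 = 2 + 2 * q ^+ 2 - (q - 1) ^+ 2 by ring.
  by have := sqr_ge0 (q - 1); lra.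
have hy : 2 * t / 3 <= (2 * t / D) ^+ 2.
  rewrite expr_div_n ler_pdivlMr ?exprn_gt0//.
  apply: (@le_trans _ _ (2 * t / 3 * (6 * t))); first by apply: ler_wpM2l => //; lra.
  by rewrite le_eqVlt; apply/orP; left; apply/eqP; field.
have hE : expR (- ((2 * t / D) ^+ 2 / 2)) <= expR (- (t / 3)) by rewrite ler_expR; lra.
have t2 : 0 <= 1 + t ^+ 2 by rewrite addr_ge0 ?sqr_ge0.
apply: (le_trans (ler_wpM2l t2 hE)).
rewrite expRN ler_pdivrMr ?expR_gt0//.
have hs : (1 + t / 6) ^+ 2 <= expR (t / 3).
  have -> : t / 3 = t / 6 + t / 6 by field.
  rewrite expRD -expr2 lerXn2r ?nnegrE ?expR_ge0//; first by lra.
  exact: expR_ge1Dx.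
apply: (@le_trans _ _ (36 * (1 + t / 6) ^+ 2)); last exact: ler_wpM2l.
have -> : 36 * (1 + t / 6) ^+ 2 = t ^+ 2 + 12 * t + 36 by field.
by lra.
Qed.

Lemma gtail_gt0 (x : R) : 0 <= x -> 0 < gtail x.
Proof. by move=> x0; apply: lt_le_trans (gtail_ge x0); rewrite divr_gt0 ?gpdf_gt0//; lra. Qed.

Lemma gtailV_le (x : R) : 0 <= x ->
  expR (- (x ^+ 2 / 2)) / gtail x <= (1 + x) / normal_peak 1.
Proof.
move=> x0; have g0 := gtail_gt0 x0; have := gtail_ge x0.
have p0 : 0 < normal_peak (1 : R) by rewrite normal_peak_gt0 ?oner_neq0.
have x10 : 0 < 1 + x by lra.
rewrite /gpdf ler_pdivrMr// => h.
rewrite ler_pdivrMr// [leRHS]mulrAC ler_pdivlMr//.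
by rewrite [leLHS]mulrC [leRHS]mulrC.
Qed.

(** In this range the Chernoff factor is at most a constant times the Gaussian one; dividing by the
    tail costs [1 + x], and [(1 + x ^ 2) (1 + x) <= 3 (1 + x ^ 3)]. *)
Lemma gtail_ratio_moderate (C delta e x p : R) : 0 <= C -> 0 <= delta -> 0 < e -> 0 <= x ->
  x ^+ 3 * e <= 1 ->
  `|p - gtail x| <= C * (1 + x ^+ 2) * delta * expR (- (x_breve e x ^+ 2 / 2)) ->
  `|p / gtail x - 1| <= 3 * C * expR 2^-1 / normal_peak 1 * (1 + x ^+ 3) * delta.
Proof.
move=> C0 d0 e0 x0 x3e h; have g0 := gtail_gt0 x0.
have [_ h2] := x_breve_bounds e0 x0.
have p0 : 0 < normal_peak (1 : R) by rewrite normal_peak_gt0 ?oner_neq0.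
have h3 : expR (- (x_breve e x ^+ 2 / 2)) <= expR 2^-1 * expR (- (x ^+ 2 / 2)).
  by apply: (le_trans h2); apply: ler_wpM2r; rewrite ?expR_ge0// ler_expR; lra.
have c0 : 0 <= C * (1 + x ^+ 2) * delta.
  by rewrite !mulr_ge0// addr_ge0// sqr_ge0.
have h4 := le_trans h (ler_wpM2l c0 h3).
have -> : p / gtail x - 1 = (p - gtail x) / gtail x by rewrite mulrBl divff// gt_eqF.
rewrite normrM (gtr0_norm (x := (gtail x)^-1)) ?invr_gt0//.
apply: (le_trans (ler_wpM2r (ltW (_ : 0 < (gtail x)^-1)) h4)); first by rewrite invr_gt0.
rewrite -!mulrA [X in _ * X](_ : _ = (1 + x ^+ 2) * delta * expR 2^-1 *
   (expR (- (x ^+ 2 / 2)) / gtail x)); last by rewrite !mulrA.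
have k0 : 0 <= (1 + x ^+ 2) * delta * expR 2^-1.
  by rewrite !mulr_ge0 ?expR_ge0// addr_ge0// sqr_ge0.
apply: (le_trans (ler_wpM2l C0 (ler_wpM2l k0 (gtailV_le x0)))).
have k1 : 0 <= C * (delta * expR 2^-1 / normal_peak 1).
  by rewrite !mulr_ge0 ?expR_ge0// invr_ge0 ltW.
rewrite [leLHS](_ : _ = C * (delta * expR 2^-1 / normal_peak 1) * ((1 + x ^+ 2) * (1 + x))); last first.
  by move: (expR _) (normal_peak 1)^-1 => E q; ring.
rewrite [leRHS](_ : _ = C * (delta * expR 2^-1 / normal_peak 1) * (3 * (1 + x ^+ 3))); last first.
  by move: (expR _) (normal_peak 1)^-1 => E q; ring.
apply: ler_wpM2l => //.
have : 0 <= (1 + x) * ((x - 1) ^+ 2 + 1).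
  by rewrite mulr_ge0 ?addr_ge0 ?sqr_ge0.
have : 0 <= x ^+ 3 by exact: exprn_ge0.
have : 0 <= (1 + x) * (x - 1) ^+ 2 by rewrite mulr_ge0 ?addr_ge0 ?sqr_ge0.
have -> : (1 + x) * (x - 1) ^+ 2 = x ^+ 3 - x ^+ 2 - x + 1 by ring.
have -> : (1 + x ^+ 2) * (1 + x) = 1 + x + x ^+ 2 + x ^+ 3 by ring.
by lra.
Qed.

(** The [1 / x] of the upper bound compensates the [1 + x] of the inverse tail, so the ratio stays
    bounded in terms of [K]. *)
Lemma gtail_ratio_large (C K e x p : R) : 0 <= C -> 0 < e -> 2 <= x -> 0 <= p ->
  x ^+ 3 * e <= K ^+ 3 -> p <= C / x * expR (- (x_breve e x ^+ 2 / 2)) ->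
  `|p / gtail x - 1| <= 1 + 2 * C * expR (K ^+ 3 / 2) / normal_peak 1.
Proof.
move=> C0 e0 x2 p0 x3e h; have x0 : 0 <= x by lra.
have xp : 0 < x by lra.
have g0 := gtail_gt0 x0; have [_ h2] := x_breve_bounds e0 x0.
have q0 : 0 < normal_peak (1 : R) by rewrite normal_peak_gt0 ?oner_neq0.
have h3 : expR (- (x_breve e x ^+ 2 / 2)) <= expR (K ^+ 3 / 2) * expR (- (x ^+ 2 / 2)).
  by apply: (le_trans h2); apply: ler_wpM2r; rewrite ?expR_ge0// ler_expR; lra.
have r0 : 0 <= p / gtail x by rewrite divr_ge0// ltW.
suff h4 : p / gtail x <= 2 * C * expR (K ^+ 3 / 2) / normal_peak 1.
  by rewrite ler_norml; apply/andP; split; lra.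
have c0 : 0 <= C / x by rewrite divr_ge0.
have h5 := le_trans h (ler_wpM2l c0 h3).
apply: (le_trans (ler_wpM2r (ltW (_ : 0 < (gtail x)^-1)) h5)); first by rewrite invr_gt0.
rewrite [leLHS](_ : _ = C / x * expR (K ^+ 3 / 2) *
   (expR (- (x ^+ 2 / 2)) / gtail x)); last by rewrite !mulrA.
have k0 : 0 <= C / x * expR (K ^+ 3 / 2) by rewrite mulr_ge0 ?expR_ge0.
apply: (le_trans (ler_wpM2l k0 (gtailV_le x0))).
have k1 : 0 <= C * expR (K ^+ 3 / 2) / normal_peak 1.
  by rewrite divr_ge0 ?(ltW q0)// mulr_ge0 ?expR_ge0.
rewrite [leLHS](_ : _ = C * expR (K ^+ 3 / 2) / normal_peak 1 * ((1 + x) / x)); last first.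
  by move: (expR _) (normal_peak 1)^-1 (x^-1) => E q y; ring.
rewrite [leRHS](_ : _ = C * expR (K ^+ 3 / 2) / normal_peak 1 * 2); last first.
  by move: (expR _) (normal_peak 1)^-1 => E q; ring.
by apply: ler_wpM2l => //; rewrite ler_pdivrMr//; lra.
Qed.

Lemma cube_le_powR (K e x : R) : 0 < e -> 0 <= x -> x <= K * e `^ (- 3^-1) ->
  x ^+ 3 * e <= K ^+ 3.
Proof.
move=> e0 x0 h.
have h3 : x ^+ 3 <= (K * e `^ (- 3^-1)) ^+ 3.
  by rewrite lerXn2r ?nnegrE// (le_trans x0).
apply: (le_trans (ler_wpM2r (ltW e0) h3)).
have E : (e `^ (- 3^-1)) ^+ 3 = e^-1.
  rewrite -powR_mulrn ?powR_ge0// -powRrM.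
  have -> : - 3^-1 * 3%:R = - 1 :> R by field.
  by rewrite powRN powRr1 ?ltW.
by rewrite exprMn E -mulrA mulVf ?mulr1// gt_eqF.
Qed.

End model_bounds.

(** * The events as rays of the rescaled error *)

Section events.
Context {d : measure_display} {T : measurableType d} {R : realType}.
Variables (P : probability T R) (n : nat).
Variables (phi eps : 'I_n -> {RV P >-> R}) (theta sigma : R).
Hypothesis s0 : 0 < sigma.

Local Notation err := (normalized_error phi eps theta).

Lemma cdf_event_compl (x : R) :
  fine (P [set w | err w <= x * sigma]) =
  1 - fine (P [set w | [set y | x < y] (err w / sigma)]).
Proof.
have mG : measurable [set w | [set y | x < y] (err w / sigma)].
  rewrite -[X in measurable X]setTI.
  have mf : measurable_fun setT (fun w => err w / sigma).
    by apply: measurable_funM => //; exact: measurable_normalized_error.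
  have -> : [set w | [set y | x < y] (err w / sigma)] =
      (fun w => err w / sigma) @^-1` `]x, +oo[%classic.
    by apply/seteqP; split => w /=; rewrite in_itv/= andbT.
  by apply: mf => //; exact: measurable_itv.
have -> : [set w | err w <= x * sigma] = ~` [set w | [set y | x < y] (err w / sigma)].
  by apply/seteqP; split => w /=; rewrite -ler_pdivrMr// leNgt => /negP.
by rewrite probability_setC// fineB// fin_num_measure.
Qed.

Lemma cdf_eventE (x : R) :
  [set w | err w <= x * sigma] = [set w | [set y | y <= x] (err w / sigma)].
Proof. by apply/seteqP; split => w /=; rewrite ler_pdivrMr. Qed.

Lemma tail_eventE (x : R) :
  [set w | x * sigma <= err w] = [set w | [set y | x <= y] (err w / sigma)].
Proof. by apply/seteqP; split => w /=; rewrite ler_pdivlMr. Qed.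

End events.

Section rays.
Context {R : realType}.

Lemma measurable_gt_ray (x : R) : measurable [set y | x < y].
Proof.
rewrite (_ : [set y | x < y] = `]x, +oo[%classic); first exact: measurable_itv.
by apply/seteqP; split => y /=; rewrite in_itv/= andbT.
Qed.

Lemma measurable_ge_ray (x : R) : measurable [set y | x <= y].
Proof.
rewrite (_ : [set y | x <= y] = `[x, +oo[%classic); first exact: measurable_itv.
by apply/seteqP; split => y /=; rewrite in_itv/= andbT.
Qed.

Lemma measurable_le_ray (x : R) : measurable [set y | y <= x].
Proof.
rewrite (_ : [set y | y <= x] = `]-oo, x]%classic); first exact: measurable_itv.
by apply/seteqP; split => y /=; rewrite in_itv.
Qed.

End rays.

Theorem theorem3p1 (R : realType) :
  [/\ (exists2 C : R, 0 < C &
        forall (d : measure_display) (T : measurableType d)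
          (P : probability T R) (n : nat) (phi eps : 'I_n -> {RV P >-> R})
          (theta sigma e1 e2 : R),
        regression_model phi eps sigma e1 e2 ->
        let e := e1 * e2 / sigma in
        forall x : R,
          `| fine (P [set w | normalized_error phi eps theta w <= x * sigma])
             - std_normal_cdf x |
          <= C * (1 + x ^+ 2) * (e * `|ln e|) * expR (- (x_breve e x ^+ 2 / 2))),
      (exists2 C : R, 0 < C &
        forall (d : measure_display) (T : measurableType d)
          (P : probability T R) (n : nat) (phi eps : 'I_n -> {RV P >-> R})
          (theta sigma e1 e2 : R),
        regression_model phi eps sigma e1 e2 ->
        let e := e1 * e2 / sigma in
        forall x : R,
          `| fine (P [set w | normalized_error phi eps theta w <= x * sigma])
             - std_normal_cdf x |
          <= C * (e * `|ln e|)) &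
      (exists2 C : R, 0 < C &
        forall K : R, 0 < K ->
        exists2 e0 : R, 0 < e0 &
        forall (d : measure_display) (T : measurableType d)
          (P : probability T R) (n : nat) (phi eps : 'I_n -> {RV P >-> R})
          (theta sigma e1 e2 : R),
        regression_model phi eps sigma e1 e2 ->
        let e := e1 * e2 / sigma in
        e <= e0 ->
        forall x : R, 0 <= x -> x <= K * e `^ (- 3^-1) ->
        exists2 vartheta : R, `|vartheta| <= 1 &
          fine (P [set w | x * sigma <= normalized_error phi eps theta w])
            / (1 - std_normal_cdf x)
          = 1 + vartheta * C * (1 + x ^+ 3) * (e * `|ln e|))].
Proof.
have [C1 C10 HC1] := @model_nonuniform R.
have [C2 C20 HC2] := @model_upper R.
have cdfE (x : R) : std_normal_cdf x = 1 - gtail x by rewrite /gtail subKr.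
have nonuniform (d : measure_display) (T : measurableType d)
    (P : probability T R) (n : nat) (phi eps : 'I_n -> {RV P >-> R})
    (theta sigma e1 e2 : R) : regression_model phi eps sigma e1 e2 ->
    let e := e1 * e2 / sigma in forall x : R,
    `| fine (P [set w | normalized_error phi eps theta w <= x * sigma]) - std_normal_cdf x |
     <= C1 * (1 + x ^+ 2) * (e * `|ln e|) * expR (- (x_breve e x ^+ 2 / 2)).
  move=> model e x; have s0 := sigma_gt0 model.
  (* For [x >= 0] the complement is a right tail; for [x < 0] the event is a left tail, treated with
     the sign -1 and the symmetry of the Gaussian. *)
  have [x0|x0] := leP 0 x.
    rewrite (cdf_event_compl phi eps theta s0) cdfE.
    have := HC1 _ _ _ _ _ _ theta _ _ _ model 1 x [set y | x < y] (expr1n _ _) x0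
      (measurable_gt_ray x).
    set p := fine _; have -> : 1 - p - (1 - gtail x) = - (p - gtail x) by ring.
    by rewrite normrN; apply => y /=; rewrite mul1r// => /ltW.
  rewrite (cdf_eventE phi eps theta s0) -x_breveN -(sqrrN x).
  have -> : std_normal_cdf x = gtail (- x) by rewrite gtailN cdfE.
  apply: (HC1 _ _ _ _ _ _ theta _ _ _ model (-1)) => //.
  - by rewrite sqrrN expr1n.
  - by rewrite oppr_ge0 ltW.
  - exact: measurable_le_ray.
  - by move=> y /=; rewrite mulN1r lerN2.
  - by move=> y /=; rewrite mulN1r ltrN2 => /ltW.
have e_gt0 (d : measure_display) (T : measurableType d) (P : probability T R) (n : nat)
    (phi eps : 'I_n -> {RV P >-> R}) (sigma e1 e2 : R) :
    regression_model phi eps sigma e1 e2 -> 0 < e1 * e2 / sigma.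
  move=> model; rewrite divr_gt0 ?mulr_gt0//;
    [exact: e1_gt0 model|exact: e2_gt0 model|exact: sigma_gt0 model].
split.
- by exists C1.
- exists (C1 * 36); first by rewrite mulr_gt0.
  move=> d T P n phi eps theta sigma e1 e2 model e x.
  apply: (le_trans (nonuniform _ _ _ _ _ _ theta _ _ _ model x)).
  have e0 : 0 < e by exact: e_gt0 model.
  rewrite -/e mulrAC -[X in X * _ <= _]mulrA; apply: ler_wpM2r.
    by rewrite mulr_ge0// ltW.
  by apply: ler_wpM2l; [exact: ltW|apply: x_breve_decay => //; exact: epsilon_le_half model].
pose c := 3 * C1 * expR 2^-1 / normal_peak 1.
have pk0 : 0 < normal_peak (1 : R) by rewrite normal_peak_gt0 ?oner_neq0.
have c0 : 0 < c by rewrite divr_gt0// !mulr_gt0 ?expR_gt0.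
(* [c] serves the range [x ^ 3 e <= 1]; in the other range [K] enters only through the threshold on
   [e], so the constant does not depend on it. *)
exists (c + 1); first by lra.
move=> K K0.
pose m := 1 + 2 * C2 * expR (K ^+ 3 / 2) / normal_peak 1.
(* The bound [1 / 64] forces [x >= 2] once [x ^ 3 e > 1]; [1 / K ^ 6] gives [x ^ 2 e <= 1], as
   [(x ^ 2 e) ^ 3 = (x ^ 3 e) ^ 2 e]; [exp (- m)] gives [|ln e| >= m], where [m] bounds the relative
   error. *)
exists (Num.min 64^-1 (Num.min (K ^+ 6)^-1 (expR (- m)))).
  by rewrite !lt_min invr_gt0 ltr0n/= invr_gt0 exprn_gt0//= expR_gt0.
move=> d T P n phi eps theta sigma e1 e2 model e.
rewrite !le_min => /andP[e64 /andP[eK em]] x x0 xK.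
have s0 := sigma_gt0 model.
have e0 : 0 < e by exact: e_gt0 model.
have e2' : e <= 2^-1 by exact: epsilon_le_half model.
have [lnE ln2] := ln_abs_ge e0 e2'.
have delta0 : 0 < e * `|ln e| by rewrite mulr_gt0//; lra.
have x30 : 0 <= x ^+ 3 by exact: exprn_ge0.
rewrite (tail_eventE phi eps theta s0) -[1 - std_normal_cdf x]/(gtail x).
set p := fine _.
have p0 : 0 <= p by rewrite fine_ge0.
suff h : `|p / gtail x - 1| <= (c + 1) * (1 + x ^+ 3) * (e * `|ln e|).
  set D := (c + 1) * _ * _ in h.
  have D0 : 0 < D by rewrite mulr_gt0// mulr_gt0//; lra.
  exists ((p / gtail x - 1) / D).
    by rewrite normrM normfV (gtr0_norm D0) ler_pdivrMr// mul1r.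
  rewrite [X in 1 + X](_ : _ = (p / gtail x - 1) / D * D); last by rewrite /D !mulrA.
  by rewrite divfK ?gt_eqF// addrC subrK.
have [x3e|x3e] := leP (x ^+ 3 * e) 1.
  have h : `|p - gtail x| <=
      C1 * (1 + x ^+ 2) * (e * `|ln e|) * expR (- (x_breve e x ^+ 2 / 2)).
    apply: (HC1 _ _ _ _ _ _ theta _ _ _ model 1) => //.
    - by rewrite expr1n.
    - exact: measurable_ge_ray.
    - by move=> y /=; rewrite mul1r.
    - by move=> y /=; rewrite mul1r => /ltW.
  apply: (le_trans (gtail_ratio_moderate (ltW C10) (ltW delta0) e0 x0 x3e h)).
  rewrite -/c; apply: ler_wpM2r; first exact: ltW.
  by apply: ler_wpM2r; lra.
have x3K := cube_le_powR e0 x0 xK.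
have x2 : 2 <= x.
  rewrite leNgt; apply/negP => x2.
  have : x ^+ 3 <= 2 ^+ 3 by rewrite lerXn2r ?nnegrE// ltW.
  have : x ^+ 3 * e <= x ^+ 3 * 64^-1 by exact: ler_wpM2l.
  by rewrite -natrX; lra.
have x2e : x ^+ 2 * e <= 1.
  rewrite -(@expr_le1 _ 3)//; last by rewrite mulr_ge0 ?sqr_ge0// ltW.
  have -> : (x ^+ 2 * e) ^+ 3 = (x ^+ 3 * e) ^+ 2 * e by ring.
  have h1 : (x ^+ 3 * e) ^+ 2 <= (K ^+ 3) ^+ 2.
    have h2 : 0 <= x ^+ 3 * e by rewrite mulr_ge0// ltW.
    have h3 : 0 <= K ^+ 3 by rewrite exprn_ge0// ltW.
    by rewrite lerXn2r ?nnegrE.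
  apply: (le_trans (ler_wpM2r (ltW e0) h1)).
  by rewrite -exprM mulrC -ler_pdivlMr ?exprn_gt0// mul1r.
have hp : p <= C2 / x * expR (- (x_breve e x ^+ 2 / 2)).
  by apply: (HC2 _ _ _ _ _ _ theta _ _ _ model) => //; exact: measurable_ge_ray.
apply: (le_trans (gtail_ratio_large (ltW C20) e0 x2 p0 x3K hp)); rewrite -/m.
have mln : m <= `|ln e|.
  rewrite lnE lerNr -(expRK (- m)) ler_ln ?posrE//; exact: expR_gt0.
apply: (le_trans mln).
have -> : (c + 1) * (1 + x ^+ 3) * (e * `|ln e|) =
    ((c + 1) * ((1 + x ^+ 3) * e)) * `|ln e| by rewrite !mulrA.
apply: ler_peMl => //.
rewrite -[leLHS]mulr1; apply: ler_pM => //; first by lra.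
by rewrite mulrDl mul1r; lra.
Qed.
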